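(* Let $\ell>0$ and $\mu\in\mathbb{R}$, and consider the switching time-delay wave system $$ \begin{cases} y_{tt}(x,t)-y_{xx}(x,t)=0, & (x,t)\in(0,\ell)\times(0,+\infty),\\ y(0,t)=0, & t\in(0,+\infty),\\ y_x(\ell,t)=0, & t\in(0,2\ell),\\ y_x(\ell,t)=\mu\, y_t(\ell,t-2\ell), & t\in(2\ell,+\infty),\\ y(x,0)=y_0(x),\quad y_t(x,0)=y_1(x), & x\in(0,\ell). \end{cases} $$ This system is well-posed (existence and uniqueness of solutions). Specifically, for every initial datum $(y_0,y_1)\in\mathcal V=V_{1/2}\times V$, the solution of the system has the following explicit form. On $[0,2\ell]$, $(y,y_t)=(y^0,y^0_t)$ with $$ \begin{pmatrix} y^0(t)\\ y^0_t(t)\end{pmatrix}=\mathcal S(t)\begin{pmatrix} y_0\\ y_1\end{pmatrix},\qquad t\in[0,2\ell], $$ and for every integer $j\ge 1$, on $[2j\ell,2(j+1)\ell]$, $(y,y_t)=(y^j,y^j_t)$ with $$ \begin{pmatrix} y^j(t)\\ y^j_t(t)\end{pmatrix}=\mathcal S(t-2j\ell)\begin{pmatrix} y^{j-1}(2j\ell)\\ y^{j-1}_t(2j\ell)\end{pmatrix}+\int_{2j\ell}^{t}\mathcal S_{-1}(t-s)\begin{pmatrix}0\\ -\mu\, y^{j-1}_t(\ell,s-2\ell)\,\delta_\ell\end{pmatrix}ds,\qquad t\in[2j\ell,2(j+1)\ell]. $$ Moreover, $(y^j,y^j_t)\in C([2j\ell,2(j+1)\ell];\mathcal V)$ for every integer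 $j\ge 0$.
   Context: $V=L^2(0,\ell)$. $A=-\partial_x^2$ is the unbounded operator in $V$ with domain $V_1=\mathcal D(A)=\{f\in H^2(0,\ell): f(0)=0,\ f_x(\ell)=0\}$. $V_{1/2}=\mathcal D(A^{1/2})=\{f\in H^1(0,\ell): f(0)=0\}$. $V_{-1/2}=(V_{1/2})'$, the duality being in the sense of the pivot space $V$. $\delta_\ell\in V_{-1/2}$ is the Dirac mass at $\ell$. The state space is the Hilbert space $\mathcal V=V_{1/2}\times V$. The operator $\mathcal A:\mathcal D(\mathcal A)=V_1\times V_{1/2}\subset\mathcal V\to\mathcal V$, $\mathcal A(y,z)=(z,-Ay)$, generates a strongly continuous group of isometries $(\mathcal S(t))_{t\in\mathbb R}$ on $\mathcal V$. $(\mathcal S_{-1}(t))_{t\in\mathbb R}$ denotes the extension of this group to $(\mathcal D(\mathcal A))'=V\times V_{-1/2}$. Well-posedness is understood in the sense of semigroup theory of linear operators. $y^{j-1}_t(\ell,\cdot)$ denotes the time derivative of the boundary trace $y^{j-1}(\ell,\cdot)$, a function in $L^2(2(j-1)\ell,2j\ell)$.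
   Formalization: The forcing term in the formula for y^j is taken as +μ y_t^{j-1}(ℓ,s-2ℓ)δ_ℓ instead of -μ: integration by parts gives y_tt = -Ay + y_x(ℓ,t)δ_ℓ, so the printed sign contradicts y_x(ℓ,t)=μ y_t(ℓ,t-2ℓ) (e.g. μ=1, y_0=0, y_1=1). *)

(* Defs.v *)
From HB Require Import structures.
From mathcomp Require Import all_boot all_order all_algebra.
From mathcomp Require Import all_classical all_reals all_analysis.

Set Implicit Arguments.
Unset Strict Implicit.
Unset Printing Implicit Defensive.

Import Order.TTheory GRing.Theory Num.Theory.
Import numFieldNormedType.Exports.

Local Open Scope classical_set_scope.
Local Open Scope ring_scope.

(* Elements of function spaces on an interval [a, b] are represented by
   functions R -> R of which only the restriction to [a, b] matters: elements
   of L^2 are compared almost everywhere, elements of H^1 are represented by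
   their continuous representative and compared pointwise on [a, b]. *)

Section Spaces.
Context {R : realType}.
Local Notation leb := (@lebesgue_measure R).
Implicit Types (a b l : R) (f g u : R -> R).

Definition L2 a b f : Prop :=
  measurable_fun `[a, b] f /\
  leb.-integrable `[a, b] (fun x => (f x ^+ 2)%:E).

Definition dotL2 a b f g : R := \int[leb]_(x in `[a, b]) (f x * g x).

Definition normL2 a b f : R := Num.sqrt (dotL2 a b f f).

Definition aeq l f g : Prop :=
  \forall x \ae leb, x \in `[0, l] -> f x = g x.

(* f is in H^1(a, b), with derivative g: in dimension one, H^1 functions are
   the absolutely continuous functions with square integrable derivative. *)
Definition H1deriv a b f g : Prop :=
  L2 a b g /\
  forall x, x \in `[a, b] -> f x = f a + \int[leb]_(s in `[a, x]) g s.

Definition H1 a b f : Prop := exists g, H1deriv a b f g.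

(* The derivative of an H^1 function, unique up to a null set. *)
Definition dx a b f : R -> R := xget (cst 0) [set g | H1deriv a b f g].

(* The space V_{1/2}; its norm |A^{1/2} f| is the L^2 norm of f_x. *)
Definition V12 l f : Prop := H1 0 l f /\ f 0 = 0.

Definition normV12 l f : R := normL2 0 l (dx 0 l f).

(* f is in V_1 = D(A) and A f = u; here g is the continuous representative of
   f_x, so that g l = 0 is the condition f_x(l) = 0. *)
Definition opA l f u : Prop :=
  exists g, [/\ H1deriv 0 l f g, H1deriv 0 l g (fun x => - u x),
                f 0 = 0 & g l = 0].

End Spaces.

Section Group.
Context {R : realType}.
Local Notation leb := (@lebesgue_measure R).

(* Pairs (y, z) with y in V_{1/2} and z in V. *)
Definition state : Type := ((R -> R) * (R -> R))%type.

Implicit Types (l t : R) (w : state).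

Definition calV l w : Prop := V12 l w.1 /\ L2 0 l w.2.

Definition eqV l w w' : Prop :=
  {in `[0, l], w.1 =1 w'.1} /\ aeq l w.2 w'.2.

Definition normV l w : R :=
  Num.sqrt (normV12 l w.1 ^+ 2 + normL2 0 l w.2 ^+ 2).

(* C(D; V_{1/2} x V). *)
Definition contV l (D : set R) (W : R -> state) : Prop :=
  forall t0, D t0 ->
    calV l (W t0) /\
    normV l (W t - W t0) @[t --> within D (nbhs t0)] --> (0 : R).

(* The graph of the operator (y, z) |-> (z, - A y) with domain V_1 x V_{1/2};
   w'.1 is the continuous representative of the class w.2. *)
Definition waveop l w w' : Prop :=
  [/\ V12 l w'.1, aeq l w'.1 w.2 &
      exists2 u, opA l w.1 u & aeq l w'.2 (fun x => - u x)].

(* S is the strongly continuous group of isometries of V_{1/2} x V generated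
   by the wave operator. *)
Record wave_group l (S : R -> state -> state) : Prop := WaveGroup {
  wg_stable : forall t w, calV l w -> calV l (S t w) ;
  wg_linear : forall t (c : R) w w', calV l w -> calV l w' ->
    eqV l (S t (c *: w + w')) (c *: S t w + S t w') ;
  wg_isometry : forall t w, calV l w -> normV l (S t w) = normV l w ;
  wg_0 : forall w, calV l w -> eqV l (S 0 w) w ;
  wg_add : forall s t w, calV l w -> eqV l (S (s + t) w) (S s (S t w)) ;
  wg_continuous : forall w, calV l w ->
    normV l (S t w - w) @[t --> (0 : R)] --> (0 : R) ;
  wg_generator : forall w w', calV l w -> calV l w' ->
    (normV l (h^-1 *: (S h w - w) - w') @[h --> (0 : R)^'] --> (0 : R)) <->
    waveop l w w' }.

(* V_{-1/2}: bounded linear functionals on V_{1/2}. *)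
Definition Vm12 l (F : (R -> R) -> R) : Prop :=
  (forall (c : R) f g, V12 l f -> V12 l g -> F (c *: f + g) = c * F f + F g) /\
  exists C : R, forall f, V12 l f -> `|F f| <= C * normV12 l f.

Definition normVm12 l (F : (R -> R) -> R) : R :=
  sup [set `|F f| | f in [set f | V12 l f /\ normV12 l f <= 1]].

Definition delta l : (R -> R) -> R := fun f => f l.

(* Pairs (y, F) with y in V and F in V_{-1/2}. *)
Definition xstate : Type := ((R -> R) * ((R -> R) -> R))%type.

Implicit Types X : xstate.

Definition calX l X : Prop := L2 0 l X.1 /\ Vm12 l X.2.

Definition eqX l X X' : Prop :=
  aeq l X.1 X'.1 /\ forall f, V12 l f -> X.2 f = X'.2 f.

Definition normX l X : R :=
  Num.sqrt (normL2 0 l X.1 ^+ 2 + normVm12 l X.2 ^+ 2).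

(* The inclusion of V_{1/2} x V in V x V_{-1/2}, with pivot space V. *)
Definition emb l w : xstate :=
  (w.1, fun f => dotL2 0 l w.2 f).

(* Each Sm1 t is the continuous extension of S t to V x V_{-1/2}; it is unique
   since V_{1/2} x V is dense in V x V_{-1/2}. *)
Record wave_group_extension l (S : R -> state -> state)
    (Sm1 : R -> xstate -> xstate) : Prop := WaveGroupExtension {
  wge_stable : forall t X, calX l X -> calX l (Sm1 t X) ;
  wge_linear : forall t (c : R) X X', calX l X -> calX l X' ->
    eqX l (Sm1 t (c *: X + X')) (c *: Sm1 t X + Sm1 t X') ;
  wge_bounded : forall t, exists C : R, forall X, calX l X ->
    normX l (Sm1 t X) <= C * normX l X ;
  wge_extends : forall t w, calV l w ->
    eqX l (Sm1 t (emb l w)) (emb l (S t w)) }.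

(* The duality between V x V_{-1/2} and V x V_{1/2}. *)
Definition pairing l X (p f : R -> R) : R := dotL2 0 l X.1 p + X.2 f.

(* X is the Bochner integral of G over [a, b] in V x V_{-1/2}: since this space
   is separable and reflexive, Bochner integrability amounts to weak
   measurability and a norm dominated by an integrable function, and the
   integral is determined by its pairings. *)
Definition X_integral l (a b : R) (G : R -> xstate) X : Prop :=
  [/\ calX l X,
      forall s, s \in `[a, b] -> calX l (G s),
      exists2 k : R -> R, leb.-integrable `[a, b] (EFin \o k) &
        forall s, s \in `[a, b] -> normX l (G s) <= k s &
      forall p f, L2 0 l p -> V12 l f ->
        leb.-integrable `[a, b] (fun s => (pairing l (G s) p f)%:E) /\
        pairing l X p f = \int[leb]_(s in `[a, b]) pairing l (G s) p f].

End Group.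

Arguments state : clear implicits.
Arguments xstate : clear implicits.

Section DelaySystem.
Context {R : realType}.
Local Notation leb := (@lebesgue_measure R).
Implicit Types (l mu t : R) (w : R -> state R).

(* The value y(l, t) of the first component at the end l. *)
Definition trace l w : R -> R := fun t => (w t).1 l.

(* The right-hand side of the boundary condition at l, where b is y_t(l, .). *)
Definition neumann l mu (b : R -> R) : R -> R :=
  fun t => if t < 2 * l then 0 else mu * b (t - 2 * l).

(* w = (y, y_t) is a finite-energy solution on [0, +oo[ of the switching delay
   system. The equation y_tt = y_xx and the Neumann condition at l
   are expressed by the identity
     d/dt <y_t, phi> + <y_x, phi_x> = y_x(l, t) phi(l)   (phi in V_{1/2}),
   integrated in time, i.e. by the integral form in V_{-1/2} of
     y_tt = - A y + y_x(l, t) delta_l.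
   The trace y(l, .) is required to have a derivative in L^2_loc, so that
   the boundary condition makes sense. *)
Record solution l mu (w0 : state R) w : Prop := Solution {
  sol_continuous : contV l [set t | 0 <= t] w ;
  sol_initial : eqV l (w 0) w0 ;
  sol_dt : forall t, 0 <= t ->
    normL2 0 l (h^-1 *: ((w (t + h)).1 - (w t).1) - (w t).2)
      @[h --> within [set h | 0 <= t + h] ((0 : R)^')] --> (0 : R) ;
  sol_wave : exists b : R -> R,
    (forall T, 0 < T -> H1deriv 0 T (trace l w) b) /\
    forall phi t, V12 l phi -> 0 <= t ->
      dotL2 0 l (w t).2 phi = dotL2 0 l (w 0).2 phi +
        \int[leb]_(s in `[0, t])
          (neumann l mu b s * phi l
           - dotL2 0 l (dx 0 l (w s).1) (dx 0 l phi)) }.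

Definition switch l (j : nat) : R := 2 * j%:R * l.

(* y^j_t(l, .), in L^2(2 j l, 2 (j + 1) l) when the trace of W j is in H^1. *)
Definition trace_dt l (W : nat -> R -> state R) (j : nat) : R -> R :=
  dx (switch l j) (switch l j.+1) (trace l (W j)).

(* The sequence W j = (y^j, y^j_t). The forcing term is + mu y_t delta_l: the
   condition y_x(l) = v corresponds to y_tt = - A y + v delta_l. *)
Definition explicit_form l mu (S : R -> state R -> state R)
    (Sm1 : R -> xstate R -> xstate R) (w0 : state R) (W : nat -> R -> state R) : Prop :=
  (forall t, t \in `[0, 2 * l] -> eqV l (W 0%N t) (S t w0)) /\
  forall j : nat,
    H1 (switch l j) (switch l j.+1) (trace l (W j)) /\
    forall t, t \in `[switch l j.+1, switch l j.+2] ->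
      exists2 X : xstate R,
        X_integral l (switch l j.+1) t
          (fun s => Sm1 (t - s)
             (0, (mu * trace_dt l W j (s - 2 * l)) *: delta l)) X &
        eqX l (emb l (W j.+1 t))
          (emb l (S (t - switch l j.+1) (W j (switch l j.+1))) + X).

End DelaySystem.

(* Main.v *)
(* Solutions are sought in d'Alembert's form y(x, t) = G(t + x) - G(t - x), so that
   with g = G' one has y_t = g(t + x) - g(t - x) and y_x = g(t + x) + g(t - x). The
   initial data determine g on [-l, l[, and the boundary condition at l becomes
   g(t + l) + g(t - l) = 0 for t < 2 l and g(t + l) + g(t - l) =
   mu (g(t - l) - g(t - 3 l)) afterwards: on the n-th interval of length 2 l, g is a
   scalar c_n times its restriction to [-l, l[. This gives existence.

   Uniqueness for a given forcing v at l is an energy argument for the difference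
   of two weak solutions, one derivative below the natural energy; it extends to the
   delay system by induction on the intervals of length 2 l, because v on one
   interval only depends on the trace on the previous one.

   For the explicit form, orbits of the group starting in the domain of its
   generator are weak solutions with v = 0, hence by density all orbits are free
   waves, with profile k such that k(s + l) + k(s - l) = 0. Testing a solution
   against a backward free wave phi gives <y(t), p> + <y_t(t), f> as the value at an
   earlier time plus the integral of v(s) phi(t - s, l), and phi(t - s, l) is
   precisely the pairing of Sm1(t - s)(0, delta_l) with (p, f), as one sees by
   approximating delta_l by L2 functions. *)

Require Import Defs.
From mathcomp Require Import all_boot all_order all_algebra.
From mathcomp Require Import all_classical all_reals all_analysis.
From mathcomp Require Import measurable_realfun ring lra.

Import Order.TTheory GRing.Theory Num.Theory.
Import numFieldNormedType.Exports.

Local Open Scope classical_set_scope.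
Local Open Scope ring_scope.

Set Implicit Arguments.
Unset Strict Implicit.
Unset Printing Implicit Defensive.

(** * Integrals over intervals *)

Section IntervalIntegral.
Context {R : realType}.
Local Notation leb := (@lebesgue_measure R).
Implicit Types (a b c d r x y : R) (f g h : R -> R).

(** Profiles are merely square integrable, so y_t has in general no time derivative in L2 and the
    energy |y_x|^2 + |y_t|^2 of a weak solution cannot be differentiated directly. What can be
    differentiated in L2 are translates of primitives of L2 functions, by continuity of
    translations; this is why x-primitives of y_t appear both in the uniqueness argument and in the
    weak equation for waves.

    The velocity y_t(l, .) is defined up to null sets only. Forcings are therefore compared through
    their time primitives: that of the delayed forcing is mu times an increment of the trace, a
    pointwise quantity.

    [S] and [Sm1] are known through their axioms alone, up to [eqV] and [eqX]. The generator on its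
    domain and the isometry determine the forward orbits of [S]. The axioms bound each [Sm1 t]
    separately; the bound uniform in time that a Bochner integral requires comes from the isometry,
    by duality.

    Free profiles are built for forward times only, which suffices because Duhamel's formula
    involves t - s >= 0. *)

Definition itg a b f : Prop := leb.-integrable `[a, b] (EFin \o f).
Definition ivint a b f : R := \int[leb]_(x in `[a, b]) f x.

Definition aeon a b f g : Prop :=
  \forall x \ae leb, x \in `[a, b] -> f x = g x.

Lemma mitv a b : measurable (`[a, b]%classic : set (measurableTypeR R)).
Proof. exact: measurable_itv. Qed.
#[local] Hint Resolve mitv : core.

Lemma itg_measurable a b f : itg a b f -> measurable_fun `[a, b] f.
Proof. by move=> /measurable_int /measurable_EFinP. Qed.

Lemma itg_eq a b f g : {in `[a, b], f =1 g} -> itg a b f -> itg a b g.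
Proof.
move=> fg; apply: eq_integrable => // x; rewrite inE/= => xab.
by rewrite fg.
Qed.

Lemma itgD a b f g : itg a b f -> itg a b g -> itg a b (fun x => f x + g x).
Proof. by move=> hf hg; have := integrableD (mitv a b) hf hg. Qed.

Lemma itgZ a b r f : itg a b f -> itg a b (fun x => r * f x).
Proof. by move=> hf; have := integrableZl (mitv a b) r hf. Qed.

Lemma itgB a b f g : itg a b f -> itg a b g -> itg a b (fun x => f x - g x).
Proof. by move=> hf hg; have := integrableB (mitv a b) hf hg. Qed.

Lemma itg_cst a b r : itg a b (fun=> r).
Proof.
apply: (@measurable_bounded_integrable _ _ _ _ (cst r)) => //.
  by rewrite /= lebesgue_measure_itv /=; case: ifP => // _; rewrite ltry.
by exists `|r|; split; [exact: num_real|move=> x rx y _ /=; exact: ltW].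
Qed.

Lemma itg_sub a b c d f : a <= c -> d <= b -> itg a b f -> itg c d f.
Proof.
move=> ac db; apply: integrableS => //.
by apply: subset_itv; rewrite ?bnd_simp.
Qed.

Lemma itg_norm a b f : itg a b f -> itg a b (fun x => `|f x|).
Proof. exact: integrable_norm. Qed.

Lemma itg_dom a b f g : measurable_fun `[a, b] f ->
  (forall x, x \in `[a, b] -> `|f x| <= g x) -> itg a b g -> itg a b f.
Proof.
move=> mf fg; apply: le_integrable => //; first exact/measurable_EFinP.
by move=> x xab /=; rewrite lee_fin (le_trans (fg _ xab))// ler_norm.
Qed.

Lemma ae_imp (P Q : R -> Prop) : (forall x, P x -> Q x) ->
  (\forall x \ae leb, P x) -> \forall x \ae leb, Q x.
Proof. by move=> PQ; have F := ae_filter_ringOfSetsType leb; apply: filterS. Qed.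

Lemma ae_and (P Q : R -> Prop) : (\forall x \ae leb, P x) ->
  (\forall x \ae leb, Q x) -> \forall x \ae leb, P x /\ Q x.
Proof. by have F := ae_filter_ringOfSetsType leb; apply: filterI. Qed.

Lemma eq_ivint a b f g : {in `[a, b], f =1 g} -> ivint a b f = ivint a b g.
Proof. by move=> fg; apply: eq_Rintegral => x; rewrite inE => /fg. Qed.

Lemma ivint_aeq a b f g : measurable_fun `[a, b] f -> measurable_fun `[a, b] g ->
  aeon a b f g -> ivint a b f = ivint a b g.
Proof.
move=> mf mg fg; congr fine; apply: ae_eq_integral => //;
  [exact/measurable_EFinP|exact/measurable_EFinP|].
by apply: ae_imp fg => x /= fg xab; rewrite fg.
Qed.

Lemma ivint_nil a b f : b <= a -> ivint a b f = 0.
Proof.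
rewrite le_eqVlt => /predU1P[->|ba]; rewrite /ivint.
  by rewrite set_itv1 Rintegral_set1.
by rewrite set_itv_ge ?Rintegral_set0// bnd_simp -ltNge.
Qed.

Lemma ivintD a b f g : itg a b f -> itg a b g ->
  ivint a b (fun x => f x + g x) = ivint a b f + ivint a b g.
Proof. by move=> hf hg; apply: RintegralD. Qed.

Lemma ivintB a b f g : itg a b f -> itg a b g ->
  ivint a b (fun x => f x - g x) = ivint a b f - ivint a b g.
Proof. by move=> hf hg; apply: RintegralB. Qed.

Lemma ivintZ a b r f : itg a b f -> ivint a b (fun x => r * f x) = r * ivint a b f.
Proof. by move=> hf; apply: RintegralZl. Qed.

Lemma ivint_cst a b r : a <= b -> ivint a b (fun=> r) = r * (b - a).
Proof.
move=> ab; rewrite /ivint Rintegral_cst//; congr *%R.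
transitivity (fine (leb `[a, b])) => //.
rewrite lebesgue_measure_itv/= lte_fin.
by case: ltP => //= ba; apply/eqP; rewrite eq_sym subr_eq0 eq_le ab ba.
Qed.

Lemma ivint0 a b : ivint a b (fun=> 0) = 0.
Proof. by rewrite /ivint Rintegral_cst // mul0r. Qed.

Lemma ivint_ge0 a b f : (forall x, x \in `[a, b] -> 0 <= f x) -> 0 <= ivint a b f.
Proof. by move=> f0; apply: Rintegral_ge0. Qed.

Lemma le_ivint a b f g : itg a b f -> itg a b g ->
  (forall x, x \in `[a, b] -> f x <= g x) -> ivint a b f <= ivint a b g.
Proof. by move=> hf hg fg; apply: le_Rintegral. Qed.

Lemma norm_ivint_le a b f : itg a b f -> `|ivint a b f| <= ivint a b (fun x => `|f x|).
Proof. by move=> hf; apply: le_normr_Rintegral. Qed.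

Lemma norm_ivint_le_cst a b r f : a <= b -> itg a b f ->
  (forall x, x \in `[a, b] -> `|f x| <= r) -> `|ivint a b f| <= r * (b - a).
Proof.
move=> ab hf fr; rewrite -ivint_cst// (le_trans (norm_ivint_le hf))//.
by apply: le_ivint => //; [exact: itg_norm|exact: itg_cst].
Qed.

Lemma ivint_chasles a b c f : a <= b -> b <= c -> itg a c f ->
  ivint a c f = ivint a b f + ivint b c f.
Proof.
move=> ab bc hf; have := @Rintegral_itvB R f (BLeft a) (BRight c) b hf.
rewrite !bnd_simp => /(_ ab bc) /eqP; rewrite subr_eq => /eqP E.
rewrite /ivint E addrC; congr (_ + _); apply: Rintegral_itv_obnd_cbnd.
by apply: integrableS hf => //; apply: subset_itv; rewrite !bnd_simp.
Qed.

Lemma measurable_comp_itv (p : R -> R) a b c d f : measurable_fun setT p ->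
  (forall x, (p x \in `[c, d]) = (x \in `[a, b])) ->
  measurable_fun `[c, d] f -> measurable_fun `[a, b] (f \o p).
Proof.
move=> mp pab mf; apply: (measurable_comp (F := `[c, d])) => //.
- by move=> _ [x xab <-] /=; rewrite pab.
- exact: measurable_funTS.
Qed.

(** Lebesgue measure is characterized by its values on half-open intervals, so the two measures are
    compared there. *)
Lemma measure_shift r (A : set R) : measurable A ->
  pushforward leb (fun x => x + r : measurableTypeR R) A = leb A.
Proof.
have mr : measurable_fun (setT : set (measurableTypeR R))
    (fun x => x + r : measurableTypeR R) by exact: measurable_funD.
move=> mA; apply/esym/lebesgue_measure_unique => //= _ [[x y] _ <-] /=.
rewrite /pushforward/=.
rewrite (_ : _ @^-1` _ = `]x - r, y - r]%classic); last first.
  by apply/seteqP; split => z /=; rewrite !in_itv/= ltrBlDr lerBrDr.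
rewrite !lebesgue_measure_itv/= !lte_fin ltrD2r.
by case: ifP => // _; rewrite -!EFinB; congr EFin; ring.
Qed.

Definition measure_preserving (p : R -> R) : Prop :=
  measurable_fun (setT : set (measurableTypeR R)) (p : R -> measurableTypeR R) /\
  forall A, measurable A -> pushforward leb (p : R -> measurableTypeR R) A = leb A.

Lemma itg_comp (p : R -> R) a b c d f : measure_preserving p ->
  (forall x, (p x \in `[c, d]) = (x \in `[a, b])) ->
  itg c d f -> itg a b (f \o p).
Proof.
move=> [mp pA] pab /integrableP[mf foo]; apply/integrableP; split.
  apply/measurable_EFinP; apply: measurable_comp_itv pab _ => //.
  exact/measurable_EFinP.
have E : p @^-1` `[c, d] = `[a, b]%classic.
  by apply/seteqP; split => x /=; rewrite pab.
rewrite -E.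
have := @ge0_integral_pushforward _ _ (measurableTypeR R) (measurableTypeR R) R p mp leb `[c, d]%classic
   (fun x => `|(f x)%:E|%E) (mitv c d).
move=> <- //; last exact: measurableT_comp.
apply: le_lt_trans foo; rewrite le_eqVlt; apply/orP; left; apply/eqP.
by apply: eq_measure_integral => A mA _; exact: (pA A mA).
Qed.

Lemma ivint_comp (p : R -> R) a b c d f : measure_preserving p ->
  (forall x, (p x \in `[c, d]) = (x \in `[a, b])) ->
  itg c d f -> ivint a b (f \o p) = ivint c d f.
Proof.
move=> [mp pA] pab fi.
have E : p @^-1` `[c, d] = `[a, b]%classic.
  by apply/seteqP; split => x /=; rewrite pab.
(* The change of variables for a pushforward measure is applied to a function measurable on the
   whole line, hence the extension by zero. *)
pose g := f \_ `[c, d].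
have gf : {in `[c, d], g =1 f} by move=> x xcd; rewrite /g patchE mem_set.
have mg : measurable_fun setT g.
  by apply/(measurable_restrictT f (mitv c d)); exact: itg_measurable.
rewrite -(eq_ivint gf) -(@eq_ivint _ _ (g \o p)); last first.
  by move=> x xab; rewrite /= gf// pab.
congr fine.
have gi : leb.-integrable `[a, b] ((EFin \o g) \o p).
  apply: (@itg_comp p a b c d g (conj mp pA) pab); apply: (itg_eq _ fi).
  by move=> x xcd; rewrite gf.
rewrite -E in gi.
have := @integral_pushforward _ _ (measurableTypeR R) (measurableTypeR R) R p
  mp leb `[c, d]%classic (EFin \o g) ((measurable_EFinP _ _).2 mg).
move=> /(_ gi (mitv c d)); rewrite E => <-.
by apply: eq_measure_integral => A mA _; exact: (pA A mA).
Qed.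

Lemma preserving_shift r : measure_preserving (fun x => x + r).
Proof.
by split; [exact: measurable_funD|move=> A mA; rewrite measure_shift].
Qed.

Lemma preserving_opp : measure_preserving (fun x => - x).
Proof.
by split; [exact: measurable_funN|move=> A mA; rewrite lebesgue_measureN].
Qed.

Lemma itg_shift a b r f : itg (a + r) (b + r) f -> itg a b (fun x => f (x + r)).
Proof.
apply: (itg_comp (preserving_shift r)) => x.
by rewrite !in_itv/= !lerD2r.
Qed.

Lemma ivint_shift a b r f : itg (a + r) (b + r) f ->
  ivint a b (fun x => f (x + r)) = ivint (a + r) (b + r) f.
Proof.
apply: (ivint_comp (preserving_shift r)) => x.
by rewrite !in_itv/= !lerD2r.
Qed.

Lemma itg_opp a b f : itg (- b) (- a) f -> itg a b (fun x => f (- x)).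
Proof.
apply: (itg_comp preserving_opp) => x.
by rewrite !in_itv/= !lerN2 andbC.
Qed.

Lemma ivint_opp a b f : itg (- b) (- a) f ->
  ivint a b (fun x => f (- x)) = ivint (- b) (- a) f.
Proof.
apply: (ivint_comp preserving_opp) => x.
by rewrite !in_itv/= !lerN2 andbC.
Qed.

End IntervalIntegral.
#[global] Hint Resolve mitv : core.

(** * Fubini's theorem on rectangles and integration by parts *)

Section Fubini.
Context {R : realType}.
Local Notation leb := (@lebesgue_measure R).
Local Notation mR := (measurableTypeR R).
Implicit Types (a b c d r x y : R) (f g h : R -> R).

Lemma ivint_patch a b f : ivint a b f = fine (\int[leb]_x (EFin (f \_ `[a, b] x)))%E.
Proof. by rewrite /ivint Rintegral_mkcond. Qed.

Lemma itg_patch a b f : itg a b f <-> leb.-integrable setT (EFin \o (f \_ `[a, b])).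
Proof.
rewrite /itg integrable_mkcond// restrict_EFin; exact: iff_refl.
Qed.

(** The bound by g is Tonelli's criterion for integrability on the product. Integrability of each
    section keeps the inner real-valued integrals faithful, since [fine] would turn an infinite
    value into 0. *)
Lemma ivint_swap a b c d (k : R -> R -> R) g :
  measurable_fun (setT : set (mR * mR)) (fun z => k z.1 z.2) ->
  (forall x, x \in `[a, b] -> itg c d (k x)) ->
  (forall y, y \in `[c, d] -> itg a b (k ^~ y)) ->
  itg c d g ->
  (forall y, y \in `[c, d] -> ivint a b (fun x => `|k x y|) <= g y) ->
  [/\ itg a b (fun x => ivint c d (k x)),
      itg c d (fun y => ivint a b (k ^~ y)) &
      ivint a b (fun x => ivint c d (k x)) =
      ivint c d (fun y => ivint a b (k ^~ y))].
Proof.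
move=> mk kx ky gi kg.
pose K (z : mR * mR) : \bar R :=
  ((\1_(`[a, b]%classic `*` `[c, d]%classic) z) * k z.1 z.2)%:E.
have mK : measurable_fun setT K.
  apply/measurable_EFinP; apply: measurable_funM => //.
  by apply: measurable_indic; apply: measurableX.
have Kpatch x y : K (x, y) =
    (((fun x => (k x \_ `[c, d]%classic) y) \_ `[a, b]%classic) x)%:E.
  rewrite /K indicE in_setX/= !patchE.
  by case: (x \in `[a, b]%classic); case: (y \in `[c, d]%classic);
    rewrite /= ?mul0r ?mul1r.
have Kpatch' x y : K (x, y) =
    (((fun y => ((k ^~ y) \_ `[a, b]%classic) x) \_ `[c, d]%classic) y)%:E.
  rewrite /K indicE in_setX/= !patchE.
  by case: (x \in `[a, b]%classic); case: (y \in `[c, d]%classic);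
    rewrite /= ?mul0r ?mul1r.
have innerx x : (\int[leb]_y K (x, y) =
    (((fun x => ivint c d (k x)) \_ `[a, b]%classic) x)%:E)%E.
  rewrite patchE; case: ifPn => xab; last first.
    by apply: integral0_eq => y _; rewrite Kpatch patchE (negbTE xab).
  rewrite ivint_patch fineK; last first.
    by apply: integrable_fin_num => //; apply/itg_patch/kx; move: xab; rewrite inE.
  by apply: eq_integral => y _; rewrite Kpatch patchE xab.
have innery y : (\int[leb]_x K (x, y) =
    (((fun y => ivint a b (k ^~ y)) \_ `[c, d]%classic) y)%:E)%E.
  rewrite patchE; case: ifPn => ycd; last first.
    by apply: integral0_eq => x _; rewrite Kpatch' patchE (negbTE ycd).
  rewrite ivint_patch fineK; last first.
    by apply: integrable_fin_num => //; apply/itg_patch/ky; move: ycd; rewrite inE.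
  by apply: eq_integral => x _; rewrite Kpatch' patchE ycd.
have innerA y : (\int[leb]_x `|K (x, y)| =
    (((fun y => ivint a b (fun x => `|k x y|)) \_ `[c, d]%classic) y)%:E)%E.
  rewrite patchE; case: ifPn => ycd; last first.
    by apply: integral0_eq => x _; rewrite Kpatch' patchE (negbTE ycd) abse0.
  rewrite ivint_patch fineK; last first.
    apply: integrable_fin_num => //; apply/itg_patch/itg_norm/ky.
    by move: ycd; rewrite inE.
  apply: eq_integral => x _; rewrite Kpatch' patchE ycd !patchE.
  by case: ifP => //=; rewrite normr0.
have iK : (leb \x leb)%E.-integrable setT K.
  apply/(integrable21ltyP _ _ mK).
  move/itg_patch: gi => gi.
  apply: le_lt_trans (integrable_lty _ gi) => //.
  apply: ge0_le_integral => //.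
  - by move=> y _; apply: integral_ge0.
  - apply: (@measurable_fun_fubini_tonelli_G _ _ _ _ _ leb (abse \o K)).
      exact: measurableT_comp.
    by move=> z; apply: abse_ge0.
  - by move/measurable_int: gi.
  - move=> y _; rewrite innerA lee_fin !patchE; case: ifPn => // ycd.
    by apply: kg; move: ycd; rewrite inE.
split.
- apply/itg_patch; apply: eq_integrable (integrable_fubini_F iK) => // x _.
  exact: innerx.
- apply: itg_dom gi => [|y ycd].
    apply/(measurable_restrictT _ (mitv c d))/measurable_EFinP.
    rewrite (_ : _ \o _ = fubini_G leb K); last first.
      by apply/funext => y; rewrite /= -innery.
    exact: (measurable_fubini_G iK).
  by apply: le_trans (norm_ivint_le (ky _ ycd)) (kg _ ycd).
- rewrite !(ivint_patch, (ivint_patch c d)); congr fine.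
  have := Fubini iK.
  under eq_integral do rewrite innerx.
  by under [in RHS]eq_integral do rewrite innery.
Qed.

Lemma eq_ivint_oo a b f g : measurable_fun `[a, b] f -> measurable_fun `[a, b] g ->
  {in `]a, b[, f =1 g} -> ivint a b f = ivint a b g.
Proof.
move=> mf mg fg; congr fine; apply: eq_integral_itv_bounded => //.
  by apply: measurable_funS mf; [exact: mitv|exact: subset_itv_oo_cc].
by apply: measurable_funS mg; [exact: mitv|exact: subset_itv_oo_cc].
Qed.

Lemma measurable_triangle : measurable [set z : mR * mR | z.2 <= z.1].
Proof.
rewrite -[X in measurable X]setTI.
exact: (@measurable_fun_le _ _ R setT (@snd mR mR) (@fst mR mR)).
Qed.

(* Fubini's theorem on the triangle y <= x. *)
Lemma ivint_parts a b f h : a <= b -> itg a b f -> itg a b h ->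
  [/\ itg a b (fun x => h x * ivint a x f), itg a b (fun x => f x * ivint a x h) &
  ivint a b (fun x => h x * ivint a x f) + ivint a b (fun x => f x * ivint a x h)
  = ivint a b f * ivint a b h].
Proof.
move=> ab fi hi.
(* The kernel below has to be measurable on the plane; f and h are replaced by their extensions by
   zero. *)
wlog [mf mh] : f h fi hi / measurable_fun setT f /\ measurable_fun setT h.
  move=> H; pose f' := f \_ `[a, b]; pose h' := h \_ `[a, b].
  have ff' : {in `[a, b], f' =1 f} by move=> x xab; rewrite /f' patchE mem_set.
  have hh' : {in `[a, b], h' =1 h} by move=> x xab; rewrite /h' patchE mem_set.
  have fi' : itg a b f' by apply: itg_eq fi => x /ff' ->.
  have hi' : itg a b h' by apply: itg_eq hi => x /hh' ->.
  have mf : measurable_fun setT f'.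
    by apply/(measurable_restrictT f (mitv a b)); exact: itg_measurable.
  have mh : measurable_fun setT h'.
    by apply/(measurable_restrictT h (mitv a b)); exact: itg_measurable.
  have E1 : {in `[a, b], (fun x => h' x * ivint a x f') =1
                         (fun x => h x * ivint a x f)}.
    move=> x xab; rewrite hh'//; congr *%R; apply: eq_ivint => y yax.
    by apply: ff'; move: xab yax; rewrite !in_itv/=; lra.
  have E2 : {in `[a, b], (fun x => f' x * ivint a x h') =1
                         (fun x => f x * ivint a x h)}.
    move=> x xab; rewrite ff'//; congr *%R; apply: eq_ivint => y yax.
    by apply: hh'; move: xab yax; rewrite !in_itv/=; lra.
  have [A B] := H f' h' fi' hi' (conj mf mh).
  rewrite (eq_ivint E1) (eq_ivint E2) (eq_ivint ff') (eq_ivint hh') => C.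
  by split => //; [exact: itg_eq E1 A|exact: itg_eq E2 B].
pose k x y := (\1_[set z : mR * mR | z.2 <= z.1] (x, y) : R) * (h x * f y).
have kE x y : k x y = if y <= x then h x * f y else 0.
  rewrite /k indicE; case: ifPn => yx; first by rewrite mem_set ?mul1r.
  by rewrite memNset ?mul0r//=; apply/negP.
have kle x y : `|k x y| <= `|h x| * `|f y|.
  by rewrite kE -normrM; case: ifP => _; rewrite // normr0.
have mk : measurable_fun (setT : set (mR * mR)) (fun z => k z.1 z.2).
  apply: measurable_funM.
    rewrite (_ : (fun _ => _) = \1_[set z : mR * mR | z.2 <= z.1]).
      by apply: measurable_indic; exact: measurable_triangle.
    by apply/funext => -[].
  by apply: measurable_funM; [exact: (measurableT_comp mh)|exact: (measurableT_comp mf)].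
have kx x : itg a b (k x).
  apply: (@itg_dom _ _ _ _ (fun y => `|h x| * `|f y|)) => //.
  - apply: measurable_funTS; exact: (measurableT_comp mk (pair1_measurable x)).
  - exact/itgZ/itg_norm.
have ky y : itg a b (k ^~ y).
  apply: (@itg_dom _ _ _ _ (fun x => `|f y| * `|h x|)) => //.
  - apply: measurable_funTS; exact: (measurableT_comp mk (pair2_measurable y)).
  - by move=> x _; rewrite mulrC.
  - exact/itgZ/itg_norm.
have xE : {in `[a, b], (fun x => ivint a b (k x)) =1 (fun x => h x * ivint a x f)}.
  move=> x; rewrite in_itv/= => /andP[ax xb].
  rewrite (@ivint_chasles _ _ x)// (_ : ivint x b _ = 0) ?addr0; last first.
    rewrite -(ivint0 x b); apply: eq_ivint_oo => //.
      by apply: itg_measurable; apply: itg_sub (kx x).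
    by move=> y; rewrite in_itv/= kE ltNge => /andP[/negbTE ->].
  rewrite -ivintZ; last exact: itg_sub fi.
  by apply: eq_ivint => y; rewrite in_itv/= kE => /andP[_ ->].
(* For fixed y the kernel sees h on [y, b], that is, the total integral minus the integral over
   [a, y]. The total is what produces the product on the right-hand side. *)
have yE : {in `[a, b], (fun y => ivint a b (k ^~ y)) =1
    (fun y => ivint a b h * f y - f y * ivint a y h)}.
  move=> y; rewrite in_itv/= => /andP[ay yb].
  rewrite (@ivint_chasles _ _ y)// (_ : ivint a y _ = 0) ?add0r; last first.
    rewrite -(ivint0 a y); apply: eq_ivint_oo => //.
      by apply: itg_measurable; apply: itg_sub (ky y).
    by move=> x; rewrite in_itv/= kE leNgt => /andP[_ ->].
  rewrite (@ivint_chasles _ a y b h)// mulrDl [f y * _]mulrC addrC addKr.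
  rewrite mulrC -ivintZ; last exact: itg_sub hi.
  by apply: eq_ivint => x; rewrite in_itv/= kE mulrC => /andP[->].
have [] := @ivint_swap a b a b k (fun y => ivint a b (fun x => `|h x|) * `|f y|) mk.
- by [].
- by [].
- exact/itgZ/itg_norm.
- move=> y _; rewrite mulrC -ivintZ; last exact: itg_norm.
  apply: le_ivint; [exact: itg_norm|exact/itgZ/itg_norm|].
  by move=> x _; rewrite mulrC.
rewrite (eq_ivint xE) (eq_ivint yE) => A B C.
have iA : itg a b (fun x => h x * ivint a x f) := itg_eq xE A.
have iB : itg a b (fun x => f x * ivint a x h).
  apply: itg_eq (itgB (itgZ (ivint a b h) fi) (itg_eq yE B)) => y _.
  by rewrite opprB addrC subrK.
split => //.
by rewrite C ivintB ?ivintZ ?subrK 1?mulrC//; exact: itgZ.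
Qed.

End Fubini.

(** * The space L2 *)

Section L2.
Context {R : realType}.
Local Notation leb := (@lebesgue_measure R).
Implicit Types (a b c d r x y : R) (f g h : R -> R).

Lemma L2_measurable a b f : L2 a b f -> measurable_fun `[a, b] f.
Proof. by case. Qed.

Lemma L2_itg2 a b f : L2 a b f -> itg a b (fun x => f x ^+ 2).
Proof. by case. Qed.

Lemma L2M a b f g : L2 a b f -> L2 a b g -> itg a b (fun x => f x * g x).
Proof.
move=> [mf f2] [mg g2]; apply: itg_dom (itgD f2 g2).
  exact: measurable_funM.
move=> x _ /=; rewrite ler_norml; apply/andP.
by split; [have := sqr_ge0 (f x + g x)|have := sqr_ge0 (f x - g x)];
  have := sqr_ge0 (f x); have := sqr_ge0 (g x); nra.
Qed.

Lemma L2_bounded a b r f : measurable_fun `[a, b] f ->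
  (forall x, x \in `[a, b] -> `|f x| <= r) -> L2 a b f.
Proof.
move=> mf fr; split => //; apply: itg_dom (itg_cst a b (r ^+ 2)).
  exact: measurable_funX.
move=> x xab; rewrite normrX ler_sqr ?nnegrE ?fr//.
exact: le_trans (fr _ xab).
Qed.

Lemma L2_cst a b r : L2 a b (fun=> r).
Proof. by apply: (@L2_bounded _ _ `|r|) => //; exact: measurable_cst. Qed.

Lemma L2_itg a b f : L2 a b f -> itg a b f.
Proof.
by move=> /L2M/(_ (L2_cst a b 1)); apply: itg_eq => x _; rewrite mulr1.
Qed.

Lemma L2D a b f g : L2 a b f -> L2 a b g -> L2 a b (fun x => f x + g x).
Proof.
move=> Lf Lg; split; first by apply: measurable_funD; [case: Lf|case: Lg].
have := itgD (itgD (L2_itg2 Lf) (L2_itg2 Lg)) (itgZ 2 (L2M Lf Lg)).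
by apply: itg_eq => x _; ring.
Qed.

Lemma L2Z a b r f : L2 a b f -> L2 a b (fun x => r * f x).
Proof.
move=> [mf f2]; split; first exact: measurable_funM.
by have := itgZ (r ^+ 2) f2; apply: itg_eq => x _; ring.
Qed.

Lemma L2N a b f : L2 a b f -> L2 a b (fun x => - f x).
Proof.
move=> [mf f2]; split; first exact: measurableT_comp.
by have := f2; apply: itg_eq => x _; ring.
Qed.

Lemma L2B a b f g : L2 a b f -> L2 a b g -> L2 a b (fun x => f x - g x).
Proof. by move=> Lf Lg; apply: L2D => //; exact: L2N. Qed.

Lemma L2_sub a b c d f : a <= c -> d <= b -> L2 a b f -> L2 c d f.
Proof.
move=> ac db [mf f2]; split; last exact: itg_sub f2.
apply: measurable_funS mf; first exact: mitv.
by apply: subset_itv; rewrite ?bnd_simp.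
Qed.

Lemma L2_eq a b f g : {in `[a, b], f =1 g} -> L2 a b f -> L2 a b g.
Proof.
move=> fg [mf f2]; split.
  by apply: eq_measurable_fun mf => x; rewrite inE => /fg.
by apply: itg_eq f2 => x xab; rewrite fg.
Qed.

Lemma dotE a b f g : dotL2 a b f g = ivint a b (fun x => f x * g x).
Proof. by []. Qed.

Lemma dotC a b f g : dotL2 a b f g = dotL2 a b g f.
Proof. by apply: eq_ivint => x _; rewrite mulrC. Qed.

Lemma eq_dot a b f g f' g' : {in `[a, b], f =1 f'} -> {in `[a, b], g =1 g'} ->
  dotL2 a b f g = dotL2 a b f' g'.
Proof. by move=> ff gg; apply: eq_ivint => x xab; rewrite ff// gg. Qed.

Lemma dot_aeq a b f g f' g' : L2 a b f -> L2 a b g -> L2 a b f' -> L2 a b g' ->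
  aeon a b f f' -> aeon a b g g' -> dotL2 a b f g = dotL2 a b f' g'.
Proof.
move=> Lf Lg Lf' Lg' ff gg; apply: ivint_aeq.
- by apply: itg_measurable; exact: L2M.
- by apply: itg_measurable; exact: L2M.
- by apply: ae_imp (ae_and ff gg) => x [fx gx] xab; rewrite fx// gx.
Qed.

Lemma dotDl a b f f' g : L2 a b f -> L2 a b f' -> L2 a b g ->
  dotL2 a b (fun x => f x + f' x) g = dotL2 a b f g + dotL2 a b f' g.
Proof.
move=> Lf Lf' Lg; rewrite !dotE -ivintD; [|exact: L2M|exact: L2M].
by apply: eq_ivint => x _; ring.
Qed.

Lemma dotBl a b f f' g : L2 a b f -> L2 a b f' -> L2 a b g ->
  dotL2 a b (fun x => f x - f' x) g = dotL2 a b f g - dotL2 a b f' g.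
Proof.
move=> Lf Lf' Lg; rewrite !dotE -ivintB; [|exact: L2M|exact: L2M].
by apply: eq_ivint => x _; ring.
Qed.

Lemma dotZl a b r f g : L2 a b f -> L2 a b g ->
  dotL2 a b (fun x => r * f x) g = r * dotL2 a b f g.
Proof.
move=> Lf Lg; rewrite !dotE -ivintZ; last exact: L2M.
by apply: eq_ivint => x _; ring.
Qed.

Lemma dotNl a b f g : L2 a b f -> L2 a b g ->
  dotL2 a b (fun x => - f x) g = - dotL2 a b f g.
Proof.
move=> Lf Lg; rewrite -mulN1r -dotZl//.
by apply: eq_dot => // x _; rewrite mulN1r.
Qed.

Lemma dotDr a b f g g' : L2 a b f -> L2 a b g -> L2 a b g' ->
  dotL2 a b f (fun x => g x + g' x) = dotL2 a b f g + dotL2 a b f g'.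
Proof. by move=> *; rewrite dotC dotDl// ![dotL2 _ _ f _]dotC. Qed.

Lemma dotZr a b r f g : L2 a b f -> L2 a b g ->
  dotL2 a b f (fun x => r * g x) = r * dotL2 a b f g.
Proof. by move=> *; rewrite dotC dotZl// ![dotL2 _ _ f _]dotC. Qed.

Lemma dot_sqrD a b f g : L2 a b f -> L2 a b g ->
  dotL2 a b (fun x => f x + g x) (fun x => f x + g x) =
  dotL2 a b f f + 2 * dotL2 a b f g + dotL2 a b g g.
Proof.
move=> Lf Lg; rewrite dotDl//; last exact: L2D.
by rewrite !dotDr// (dotC _ _ g f); ring.
Qed.

Lemma dot_ge0 a b f : 0 <= dotL2 a b f f.
Proof. by apply: ivint_ge0 => x _; rewrite -expr2 sqr_ge0. Qed.

Lemma norm_ge0 a b f : 0 <= normL2 a b f.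
Proof. exact: sqrtr_ge0. Qed.

Lemma norm_sqr a b f : normL2 a b f ^+ 2 = dotL2 a b f f.
Proof. by rewrite sqr_sqrtr// dot_ge0. Qed.

Lemma eq_norm a b f g : {in `[a, b], f =1 g} -> normL2 a b f = normL2 a b g.
Proof. by move=> fg; rewrite /normL2 (eq_dot fg fg). Qed.

Lemma norm_aeq a b f g : L2 a b f -> L2 a b g -> aeon a b f g ->
  normL2 a b f = normL2 a b g.
Proof. by move=> Lf Lg fg; rewrite /normL2 (dot_aeq Lf Lf Lg Lg). Qed.

Lemma norm_le a b f r : 0 <= r -> dotL2 a b f f <= r ^+ 2 -> normL2 a b f <= r.
Proof.
by move=> r0 fr; rewrite -(@ler_pXn2r _ 2)// ?nnegrE ?norm_ge0// norm_sqr.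
Qed.

Lemma cauchy_schwarz a b f g : L2 a b f -> L2 a b g ->
  `|dotL2 a b f g| <= normL2 a b f * normL2 a b g.
Proof.
move=> Lf Lg; rewrite -(@ler_pXn2r _ 2)// ?nnegrE ?mulr_ge0 ?norm_ge0//.
rewrite exprMn !norm_sqr real_normK ?num_real//.
set p := dotL2 a b f f; set q := dotL2 a b g g; set s := dotL2 a b f g.
have Q t : 0 <= p + 2 * t * s + t ^+ 2 * q.
  have := dot_ge0 a b (fun x => f x + t * g x).
  rewrite dotDl ?dotDr ?dotZl ?dotZr//; try by [exact: L2Z|exact: L2D (L2Z _ _)|
     apply: L2D => //; exact: L2Z].
  by rewrite (dotC _ _ g f) -/p -/q -/s; congr (_ <= _); ring.
have p0 : 0 <= p := dot_ge0 _ _ _.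
have q0 : 0 <= q := dot_ge0 _ _ _.
have [q_eq0|q_neq0] := eqVneq q 0.
  suff -> : s = 0 by rewrite expr0n mulr_ge0.
  apply/eqP; apply/negP => /negP s0.
  (* When q = 0 the quadratic is affine in t; at this t it would equal -1. Otherwise the minimizer
     -s / q gives the discriminant inequality. *)
  have := Q (- (p + 1) / (2 * s)); rewrite q_eq0 mulr0 addr0.
  rewrite (_ : p + _ = -1) ?oppr_ge0 ?ler10//.
  by field.
have := Q (- s / q).
rewrite (_ : p + _ + _ = (p * q - s ^+ 2) / q); last by field.
by rewrite pmulr_lge0 ?invr_gt0 ?lt0r ?q_neq0// subr_ge0.
Qed.

Lemma normD a b f g : L2 a b f -> L2 a b g ->
  normL2 a b (fun x => f x + g x) <= normL2 a b f + normL2 a b g.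
Proof.
move=> Lf Lg; apply: norm_le; first by rewrite addr_ge0 ?norm_ge0.
rewrite dotDl ?dotDr//; try exact: L2D.
have := ler_norm (dotL2 a b f g); have := cauchy_schwarz Lf Lg.
rewrite (dotC _ _ g f) -!norm_sqr; nra.
Qed.

Lemma normZ a b r f : L2 a b f -> normL2 a b (fun x => r * f x) = `|r| * normL2 a b f.
Proof.
move=> Lf; rewrite /normL2 dotZl ?dotZr//; last exact: L2Z.
by rewrite mulrA -expr2 sqrtrM ?sqr_ge0// sqrtr_sqr.
Qed.

Lemma normN a b f : normL2 a b (fun x => - f x) = normL2 a b f.
Proof.
by rewrite /normL2; congr Num.sqrt; apply: eq_ivint => x _; rewrite mulrNN.
Qed.

Lemma normB a b f g : L2 a b f -> L2 a b g ->
  normL2 a b (fun x => f x - g x) <= normL2 a b f + normL2 a b g.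
Proof.
by move=> Lf Lg; rewrite -(normN a b g); apply: normD => //; exact: L2N.
Qed.

Lemma normBC a b f g : normL2 a b (fun x => f x - g x) = normL2 a b (fun x => g x - f x).
Proof. by rewrite -normN; apply: eq_norm => x _; rewrite opprB. Qed.

Lemma normL2B_le a b f g h : L2 a b f -> L2 a b g -> L2 a b h ->
  normL2 a b (fun x => f x - h x) <=
  normL2 a b (fun x => f x - g x) + normL2 a b (fun x => g x - h x).
Proof.
move=> Lf Lg Lh; apply: le_trans (normD (L2B Lf Lg) (L2B Lg Lh)).
rewrite le_eqVlt; apply/orP; left; apply/eqP.
by apply: eq_norm => x _; ring.
Qed.

Lemma norm0_aeq a b f : L2 a b f -> normL2 a b f = 0 -> aeon a b f (fun=> 0).
Proof.
move=> Lf f0.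
have : (\int[leb]_(x in `[a, b]) `|(EFin \o (fun x => f x ^+ 2)%R) x| = 0)%E.
  have : dotL2 a b f f = 0 by rewrite -norm_sqr f0 expr0n.
  rewrite /dotL2 /Rintegral => H.
  transitivity (\int[leb]_(x in `[a, b]) (f x * f x)%:E)%E.
    by apply: eq_integral => x _; rewrite /= ger0_norm ?sqr_ge0// expr2.
  rewrite -[LHS]fineK ?H//; apply: integrable_fin_num => //; exact: L2M.
move/ae_eq_integral_abs => H.
have {H} := H (mitv a b) (measurable_int _ (L2_itg2 Lf)).
apply: ae_imp => x H xab; apply/eqP; rewrite -sqrf_eq0.
by have /= [->] := H xab.
Qed.

Lemma norm_mono a b c d f : a <= c -> d <= b -> L2 a b f ->
  normL2 c d f <= normL2 a b f.
Proof.
move=> ac db Lf; apply: ler_wsqrtr.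
rewrite !dotE.
have [cd|cd] := leP c d; last first.
  by rewrite (ivint_nil _ (ltW cd)); exact: dot_ge0.
have i := L2M Lf Lf.
rewrite (@ivint_chasles _ a c b)//; [|lra].
rewrite (@ivint_chasles _ c d b)//; last exact: itg_sub i.
have P u v : 0 <= ivint u v (fun x => f x * f x).
  by apply: ivint_ge0 => x _; rewrite -expr2 sqr_ge0.
by have := P a c; have := P d b; lra.
Qed.

Lemma norm_cst1 a b : a <= b -> normL2 a b (fun=> 1) = Num.sqrt (b - a).
Proof.
move=> ab; rewrite /normL2 dotE (@eq_ivint _ _ _ _ (fun=> 1)) ?ivint_cst ?mul1r//.
Qed.

Lemma ivint_le_norm a b f : a <= b -> L2 a b f ->
  `|ivint a b f| <= Num.sqrt (b - a) * normL2 a b f.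
Proof.
move=> ab Lf; rewrite -norm_cst1// mulrC.
rewrite (@eq_ivint _ _ _ _ (fun x => f x * 1)) => [|x _]; last by rewrite mulr1.
exact: cauchy_schwarz Lf (L2_cst _ _ _).
Qed.

End L2.

(** * H1 functions of one variable *)

Section H1.
Context {R : realType}.
Local Notation leb := (@lebesgue_measure R).
Implicit Types (a b c d l r x y : R) (f g h q : R -> R).

Lemma ae_neq a : \forall x \ae leb, x != a.
Proof.
exists [set a]; split => //; first exact: lebesgue_measure_set1.
by move=> x /= /negP; rewrite negbK => /eqP.
Qed.

(** Lebesgue's differentiation theorem: almost everywhere f is the derivative of its primitive,
    which is identically 0 once f is extended by zero beyond b. *)
Lemma aeon_ivint0 a b f : itg a b f ->
  (forall x, x \in `[a, b] -> ivint a x f = 0) -> aeon a b f (fun=> 0).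
Proof.
move=> fi f0.
have [ba|ab] := ltP b a.
  by apply: (ae_imp _ (ae_neq a)) => x _; rewrite in_itv/=; lra.
pose g := f \_ `[a, b].
have gf : {in `[a, b], g =1 f} by move=> x xab; rewrite /g patchE mem_set.
have gi y : leb.-integrable `]-oo, y] (EFin \o g).
  apply: (@integrableS _ _ _ leb setT) => //; exact/itg_patch.
have gi' y : itg a y g.
  apply: (@integrableS _ _ _ leb setT) => //; exact/itg_patch.
have glb : locally_integrable [set: R] g := integrable_locally (mitv a b) fi.
have g0 y : ivint a y g = 0.
  have [yb|yb] := leP y b.
    have [ya|ya] := leP a y; last by rewrite ivint_nil// ltW.
    rewrite -(f0 y) ?in_itv/= ?ya//; apply: eq_ivint => x; rewrite in_itv/= => xy.
    by apply: gf; rewrite in_itv/=; lra.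
  rewrite (@ivint_chasles _ a b y)//; last exact: ltW.
  rewrite (eq_ivint gf) f0 ?in_itv/= ?lexx ?ab// add0r -(ivint0 b y).
  apply: eq_ivint_oo.
  - by apply: itg_measurable; apply: itg_sub (gi' y).
  - exact: measurable_cst.
  - move=> x; rewrite in_itv/= => xb; rewrite /g patchE memNset//=.
    by rewrite in_itv/=; lra.
have := FTC1 (fun y => gi' y) glb.
move=> H; apply: ae_imp (ae_and H (ae_neq a)) => x [/= Hx xa] xab.
have ax : (a%:E < x%:E)%E.
  by move: xab xa; rewrite in_itv/= lte_fin lt_neqAle eq_sym => /andP[-> _] ->.
have [_] := Hx ax; rewrite gf// => <-.
rewrite (_ : (fun _ => _) = cst 0) ?derive1_cst//.
by apply/funext => y; exact: g0.
Qed.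

Lemma H1deriv_itg a b f g : H1deriv a b f g -> itg a b g.
Proof. by case=> /L2_itg. Qed.

Lemma H1derivE a b f g x : H1deriv a b f g -> x \in `[a, b] ->
  f x = f a + ivint a x g.
Proof. by move=> [_]; exact. Qed.

Lemma H1deriv_intro a b f g : L2 a b g ->
  (forall x, x \in `[a, b] -> f x = f a + ivint a x g) -> H1deriv a b f g.
Proof. by split. Qed.

Lemma H1deriv_uniq a b f g g' : H1deriv a b f g -> H1deriv a b f g' ->
  aeon a b g g'.
Proof.
move=> H H'; have := @aeon_ivint0 a b (fun x => g x - g' x) _ _.
move=> X; apply: ae_imp (X _ _) => [x gg xab||].
- by apply/eqP; rewrite -subr_eq0 gg.
- by apply: itgB; apply: H1deriv_itg; [exact: H|exact: H'].
- move=> x xab; rewrite ivintB.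
  + by have := H1derivE H xab; rewrite (H1derivE H' xab); lra.
  + apply: itg_sub (H1deriv_itg H) => //; by move: xab; rewrite in_itv/= => /andP[].
  + apply: itg_sub (H1deriv_itg H') => //; by move: xab; rewrite in_itv/= => /andP[].
Qed.

Lemma dx_spec a b f : H1 a b f -> H1deriv a b f (dx a b f).
Proof.
move=> [g fg]; rewrite /dx; by case: xgetP => [//|/(_ g)].
Qed.

Lemma dx_aeon a b f g : H1deriv a b f g -> aeon a b (dx a b f) g.
Proof. by move=> H; apply: (H1deriv_uniq (dx_spec (ex_intro _ g H)) H). Qed.

Lemma dx_L2 a b f : H1 a b f -> L2 a b (dx a b f).
Proof. by case/dx_spec. Qed.

Lemma H1deriv_eq a b f f' g : {in `[a, b], f =1 f'} -> H1deriv a b f g ->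
  H1deriv a b f' g.
Proof.
move=> ff [Lg H]; split => // x xab.
have aab : a \in `[a, b] by move: xab; rewrite !in_itv/=; lra.
by rewrite -!ff//; exact: H.
Qed.

Lemma H1deriv_aeq a b f g g' : L2 a b g' -> aeon a b g g' -> H1deriv a b f g ->
  H1deriv a b f g'.
Proof.
move=> Lg' gg [Lg H]; split => // x xab; rewrite H//; congr (_ + _).
move: xab; rewrite in_itv/= => /andP[ax xb].
apply: ivint_aeq.
- by apply: itg_measurable; apply: itg_sub (L2_itg Lg).
- by apply: itg_measurable; apply: itg_sub (L2_itg Lg').
- by apply: ae_imp gg => y gg ya; apply: gg; move: ya; rewrite !in_itv/=; lra.
Qed.

(** A true equality, not one up to null sets: f and f' have the same set of derivatives, and [xget]
    depends on that set only. *)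
Lemma dx_eq a b f f' : {in `[a, b], f =1 f'} -> dx a b f = dx a b f'.
Proof.
move=> ff; rewrite /dx; congr xget; apply/seteqP; split => g /=.
  exact: H1deriv_eq.
by apply: H1deriv_eq => x xab; rewrite ff.
Qed.

Lemma H1derivD a b f g f' g' : H1deriv a b f g -> H1deriv a b f' g' ->
  H1deriv a b (fun x => f x + f' x) (fun x => g x + g' x).
Proof.
move=> H H'; split; first by apply: L2D; [case: H|case: H'].
move=> x xab; rewrite (H1derivE H xab) (H1derivE H' xab).
rewrite -/(ivint a x _) ivintD; first ring.
  by apply: itg_sub (H1deriv_itg H) => //; move: xab; rewrite in_itv/= => /andP[].
by apply: itg_sub (H1deriv_itg H') => //; move: xab; rewrite in_itv/= => /andP[].
Qed.

Lemma H1derivZ a b r f g : H1deriv a b f g ->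
  H1deriv a b (fun x => r * f x) (fun x => r * g x).
Proof.
move=> H; split; first by apply: L2Z; case: H.
move=> x xab; rewrite (H1derivE H xab).
rewrite -/(ivint a x _) ivintZ; first ring.
by apply: itg_sub (H1deriv_itg H) => //; move: xab; rewrite in_itv/= => /andP[].
Qed.

Lemma H1derivB a b f g f' g' : H1deriv a b f g -> H1deriv a b f' g' ->
  H1deriv a b (fun x => f x - f' x) (fun x => g x - g' x).
Proof.
move=> H /(H1derivZ (-1)) H'; have [L E] := H1derivD H H'; split.
  by apply: L2_eq L => x _; rewrite mulN1r.
move=> x xab; have := E x xab; rewrite !mulN1r => ->; congr (_ + _).
by apply: eq_ivint => y _; rewrite mulN1r.
Qed.

(** Each factor is its initial value plus a primitive, so the product rule reduces to Fubini on the
    triangle; no pointwise differentiation occurs. *)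
Lemma H1_parts a b f g f' g' : a <= b -> H1deriv a b f g -> H1deriv a b f' g' ->
  dotL2 a b g f' + dotL2 a b f g' = f b * f' b - f a * f' a.
Proof.
move=> ab H H'.
have gi := H1deriv_itg H; have gi' := H1deriv_itg H'.
have [i1 i2 E] := ivint_parts ab gi' gi.
rewrite !dotE.
rewrite (@eq_ivint _ _ _ _ (fun x => f' a * g x + g x * ivint a x g')); last first.
  by move=> x xab; rewrite (H1derivE H' xab); ring.
rewrite (@eq_ivint _ _ _ (fun x => f x * g' x)
  (fun x => f a * g' x + g' x * ivint a x g)); last first.
  by move=> x xab; rewrite (H1derivE H xab); ring.
rewrite !ivintD ?ivintZ//; try exact: itgZ.
have bab : b \in `[a, b] by rewrite in_itv/= ab lexx.
rewrite (H1derivE H bab) (H1derivE H' bab).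
by move: E; set p := ivint _ _ _; set q := ivint _ _ _ => E;
  rewrite addrACA E; ring.
Qed.

Lemma primitive_H1deriv a b c g : L2 a b g ->
  H1deriv a b (fun x => c + ivint a x g) g.
Proof. by move=> Lg; split => // x _; rewrite (ivint_nil _ (lexx a)) addr0. Qed.

Lemma primitive_measurable a b g : itg a b g ->
  measurable_fun `[a, b] (fun x => ivint a x g).
Proof.
move=> gi; have [ab|ba] := leP a b; last first.
  rewrite set_itv_ge; last by rewrite bnd_simp -ltNge.
  exact: measurable_fun_set0.
apply: subspace_continuous_measurable_fun => //.
exact: parameterized_integral_continuous.
Qed.

Lemma H1_measurable a b f : H1 a b f -> measurable_fun `[a, b] f.
Proof.
move=> [g H].
apply: (@eq_measurable_fun _ _ _ _ _ (fun x => f a + ivint a x g)).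
  by move=> x; rewrite inE => /= xab; rewrite -(H1derivE H xab).
apply: measurable_funD; first exact: measurable_cst.
by apply: primitive_measurable; exact: H1deriv_itg H.
Qed.

Lemma H1_L2 a b f : H1 a b f -> L2 a b f.
Proof.
move=> fH; have [g H] := fH.
apply: (@L2_bounded _ _ _ (`|f a| + ivint a b (fun x => `|g x|))).
  exact: H1_measurable.
move=> x xab; rewrite (H1derivE H xab) (le_trans (ler_normD _ _))// lerD2l.
move: xab; rewrite in_itv/= => /andP[ax xb].
have gi := H1deriv_itg H; have gn := itg_norm gi.
rewrite (@ivint_chasles _ a x b)// (le_trans (norm_ivint_le _))//.
  exact: itg_sub gi.
by rewrite lerDl; apply: ivint_ge0.
Qed.

End H1.

(** * Differential calculus on a compact time interval *)

Section Calculus.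
Context {R : realType}.
Implicit Types (a b c l r s t x y T : R) (f g h q e d : R -> R).

(* On [0, T], one-sided at the end points; [d] is the derivative of [e]. *)
Definition ediff T e d : Prop := forall t, 0 <= t <= T -> forall eps, 0 < eps ->
  exists2 del, 0 < del & forall s, 0 <= s <= T -> `|s - t| < del ->
    `|e s - e t - (s - t) * d t| <= eps * `|s - t|.

Definition econt T d : Prop := forall t, 0 <= t <= T -> forall eps, 0 < eps ->
  exists2 del, 0 < del & forall s, 0 <= s <= T -> `|s - t| < del ->
    `|d s - d t| <= eps.

Lemma min_dist c x y : `|Num.min x c - Num.min y c| <= `|x - y|.
Proof.
have H1 := ler_norm (x - y); have H2 := ler_norm (y - x); rewrite distrC in H2.
rewrite /Num.min ler_norml.
by case: (ltP x c) => ?; case: (ltP y c) => ?; apply/andP; split; lra.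
Qed.

Lemma max_dist c x y : `|Num.max c x - Num.max c y| <= `|x - y|.
Proof.
have H1 := ler_norm (x - y); have H2 := ler_norm (y - x); rewrite distrC in H2.
rewrite /Num.max ler_norml.
by case: (ltP c x) => ?; case: (ltP c y) => ?; apply/andP; split; lra.
Qed.

(** The projection p of the line onto [0, T] is 1-Lipschitz, so e composed with p has a two-sided
    zero derivative at every real number, end points included. *)
Lemma ediff0_cst T e : ediff T e (fun=> 0) -> forall t, 0 <= t <= T -> e t = e 0.
Proof.
move=> He t tT.
pose p s := Num.max 0 (Num.min s T).
have T0 : 0 <= T by case/andP: tT => /le_trans; exact.
have pT s : 0 <= p s <= T.
  by rewrite /p le_max lexx/= ge_max T0/= ge_min lexx orbT.
have pl s s' : `|p s - p s'| <= `|s - s'|.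
  exact: le_trans (max_dist _ _ _) (min_dist _ _ _).
have pid s : 0 <= s <= T -> p s = s.
  by move=> /andP[s0 sT]; rewrite /p min_l// max_r.
suff H x : is_derive x (1 : R) (e \o p) 0.
  have /= := is_derive_0_is_cst t 0 H.
  by rewrite !pid// lexx.
have cv : h^-1 *: ((e \o p) (h *: 1 + x) - (e \o p) x) @[h --> (0 : R)^'] --> (0 : R).
  apply/cvgrPdist_le => eps eps0.
  have [del del0 Hd] := He _ (pT x) _ eps0.
  near=> h; rewrite sub0r normrN /= /GRing.scale/= mulr1 normrM.
  have h0 : h != 0 by near: h; exact: nbhs_dnbhs_neq.
  have hd : `|h| < del.
    near: h; apply: nbhs_dnbhs.
    by exists del => //= h; rewrite /= sub0r normrN.
  rewrite normfV ler_pdivrMl ?normr_gt0//.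
  have ph : `|p (h + x) - p x| <= `|h|.
    by rewrite (le_trans (pl _ _))// addrK.
  have := Hd (p (h + x)) (pT _) (le_lt_trans ph hd).
  rewrite mulr0 subr0 => /le_trans; apply.
  by rewrite mulrC ler_wpM2r// ltW.
split; first by apply/cvg_ex; exists 0.
exact: cvg_lim cv.
Unshelve. all: by end_near. Qed.

Lemma econt_within T d : econt T d -> {within `[0, T], continuous d}.
Proof.
move=> dc; apply/subspace_continuousP => t /=; rewrite in_itv/= => tT.
apply/cvgrPdist_le => eps eps0; have [del del0 Hd] := dc _ tT _ eps0.
rewrite near_withinE; exists del => //= s /= std; rewrite in_itv/= => sT.
by rewrite distrC; apply: Hd => //; rewrite distrC.
Qed.

Lemma econt_itg T d : econt T d -> itg 0 T d.
Proof.
by move=> dc; apply: continuous_compact_integrable;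
  [exact: segment_compact|exact: econt_within].
Qed.

(** A quantitative form of the fundamental theorem. Differentiability of the primitive alone would
    not serve when d itself depends on s and t, as happens in the uniqueness argument. *)
Lemma ivint_increment T d c r s t : itg 0 T d -> 0 <= s <= T -> 0 <= t <= T ->
  (forall x, 0 <= x <= T -> `|x - t| <= `|s - t| -> `|d x - c| <= r) ->
  `|ivint 0 s d - ivint 0 t d - (s - t) * c| <= r * `|s - t|.
Proof.
move=> di sT tT H.
have key u v : 0 <= u -> u <= v -> v <= T ->
    (forall x, u <= x <= v -> `|d x - c| <= r) ->
    `|ivint 0 v d - ivint 0 u d - (v - u) * c| <= r * (v - u).
  move=> u0 uv vT {}H.
  rewrite (@ivint_chasles _ 0 u v)//; last exact: itg_sub di.
  have iuv : itg u v d by apply: itg_sub di.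
  rewrite (_ : _ - _ = ivint u v (fun x => d x - c)).
    by apply: norm_ivint_le_cst => //; apply: itgB => //; exact: itg_cst.
  rewrite ivintB// ?ivint_cst//; last exact: itg_cst.
  ring.
move: tT sT => /andP[t0 tT] /andP[s0 sT].
have [ts|st] := leP t s.
  rewrite (ger0_norm (_ : 0 <= s - t)) ?subr_ge0//.
  apply: key => // x /andP[tx xs]; apply: H; first by apply/andP; split; lra.
  by rewrite !ger0_norm; lra.
rewrite (_ : _ - _ = - (ivint 0 t d - ivint 0 s d - (t - s) * c)); last by ring.
rewrite normrN (distrC s t) (ger0_norm (_ : 0 <= t - s)); last by lra.
apply: key => //; first exact: ltW.
move=> x /andP[sx xt]; apply: H; first by apply/andP; split; lra.
by rewrite !ler0_norm; lra.
Qed.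

Lemma ediff_primitive T d : econt T d -> ediff T (fun t => ivint 0 t d) d.
Proof.
move=> dc t tT eps eps0; have [del del0 Hd] := dc _ tT _ eps0.
exists del => // s sT std; apply: ivint_increment (econt_itg dc) sT tT _.
by move=> x xT xs; apply: Hd => //; exact: le_lt_trans std.
Qed.

Lemma ediffB T e d e' d' : ediff T e d -> ediff T e' d' ->
  ediff T (fun t => e t - e' t) (fun t => d t - d' t).
Proof.
move=> H H' t tT eps eps0; have e20 : 0 < eps / 2 by lra.
have [del del0 Hd] := H _ tT _ e20; have [del' del0' Hd'] := H' _ tT _ e20.
exists (Num.min del del') => [|s sT]; first by rewrite lt_min del0.
rewrite lt_min => /andP[/(Hd _ sT) A /(Hd' _ sT) B].
rewrite (_ : _ - _ = (e s - e t - (s - t) * d t) - (e' s - e' t - (s - t) * d' t)).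
  by apply: le_trans (ler_normB _ _) _; lra.
ring.
Qed.

Lemma ediff_ivint T e d t : econt T d -> ediff T e d -> 0 <= t <= T ->
  e t = e 0 + ivint 0 t d.
Proof.
move=> dc ed tT; have H := ediffB ed (ediff_primitive dc).
have := @ediff0_cst T (fun t => e t - ivint 0 t d) _ t tT.
rewrite (ivint_nil _ (lexx 0)) subr0 => E; rewrite -E ?subrK//.
move=> s sT eps eps0; have [del del0 Hd] := H s sT eps eps0.
by exists del => // s' s'T ss; have := Hd s' s'T ss; rewrite subrr.
Qed.

End Calculus.

(** * The energy space: Sobolev and Poincare inequalities, norms *)

Section EnergySpace.
Context {R : realType}.
Implicit Types (l r t x y : R) (f g h q : R -> R) (w : state R).

Lemma V12_deriv l f : V12 l f -> H1deriv 0 l f (dx 0 l f).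
Proof. by move=> [fH _]; exact: dx_spec. Qed.

Lemma V12_dx_L2 l f : V12 l f -> L2 0 l (dx 0 l f).
Proof. by case/V12_deriv. Qed.

Lemma V12_L2 l f : V12 l f -> L2 0 l f.
Proof. by case=> /H1_L2. Qed.

Lemma V12_of l f g : H1deriv 0 l f g -> f 0 = 0 -> V12 l f.
Proof. by move=> H f0; split => //; exists g. Qed.

Lemma dot_dx l f g q : H1deriv 0 l f g -> L2 0 l q ->
  dotL2 0 l (dx 0 l f) q = dotL2 0 l g q.
Proof.
move=> H Lq; apply: dot_aeq => //; [|by case: H|exact: dx_aeon H|exact: aeW].
by apply: dx_L2; exists g.
Qed.

Lemma normV12E l f g : H1deriv 0 l f g -> normV12 l f = normL2 0 l g.
Proof.
move=> H; apply: norm_aeq; [|by case: H|exact: dx_aeon H].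
by apply: dx_L2; exists g.
Qed.

Lemma V12B l f g : V12 l f -> V12 l g -> V12 l (fun x => f x - g x).
Proof.
move=> Vf Vg; apply: V12_of (H1derivB (V12_deriv Vf) (V12_deriv Vg)) _.
by case: Vf => _ ->; case: Vg => _ ->; rewrite subr0.
Qed.

Lemma V12Z l r f : V12 l f -> V12 l (fun x => r * f x).
Proof.
move=> Vf; apply: V12_of (H1derivZ r (V12_deriv Vf)) _.
by case: Vf => _ ->; rewrite mulr0.
Qed.

Lemma normV12_eq l f g : {in `[0, l], f =1 g} -> normV12 l f = normV12 l g.
Proof. by move=> fg; rewrite /normV12 (dx_eq fg). Qed.

Lemma V12_primitive l q : L2 0 l q ->
  V12 l (fun x => ivint 0 x q) /\ H1deriv 0 l (fun x => ivint 0 x q) q.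
Proof.
move=> Lq; have H : H1deriv 0 l (fun x => ivint 0 x q) q.
  by have := primitive_H1deriv 0 Lq; apply: H1deriv_eq => x _; rewrite add0r.
by split => //; apply: V12_of H _; rewrite ivint_nil.
Qed.

(** As f 0 = 0, this is the Cauchy-Schwarz inequality for the integral of f_x over [0, x]. It makes
    the trace at l and the Dirac mass continuous. *)
Lemma V12_pt l f x : V12 l f -> x \in `[0, l] ->
  `|f x| <= Num.sqrt l * normV12 l f.
Proof.
move=> Vf xl; have [_ f0] := Vf; have H := V12_deriv Vf.
rewrite (H1derivE H xl) f0 add0r.
move: xl; rewrite in_itv/= => /andP[x0 xl].
rewrite (le_trans (ivint_le_norm x0 _))//; first by apply: L2_sub (V12_dx_L2 Vf).
rewrite subr0; apply: ler_pM => //; [exact: norm_ge0|exact: ler_wsqrtr|].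
by apply: norm_mono => //; exact: V12_dx_L2.
Qed.

Lemma V12_norm_le l f : 0 <= l -> V12 l f -> normL2 0 l f <= l * normV12 l f.
Proof.
move=> l0 Vf; apply: norm_le; first by rewrite mulr_ge0 ?norm_ge0.
have Lf := V12_L2 Vf; have ff := L2M Lf Lf.
set N := normV12 l f.
rewrite dotE (_ : (l * N) ^+ 2 = l * N ^+ 2 * (l - 0)); last by ring.
rewrite -[leLHS]ger0_norm ?dot_ge0//; apply: norm_ivint_le_cst => // x xl.
have := V12_pt Vf xl; rewrite -/N => H.
rewrite -expr2 normrX (_ : l * _ = (Num.sqrt l * N) ^+ 2).
  by rewrite ler_sqr ?nnegrE// mulr_ge0 ?sqrtr_ge0 ?norm_ge0.
by rewrite exprMn (sqr_sqrtr l0).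
Qed.

Lemma normV12_0 l f : V12 l f -> normV12 l f = 0 -> {in `[0, l], forall x, f x = 0}.
Proof.
by move=> Vf f0 x xl; have := V12_pt Vf xl; rewrite f0 mulr0 normr_le0 => /eqP.
Qed.

Lemma aeon_refl l f : aeon 0 l f f.
Proof. exact: aeW. Qed.

Lemma aeon_sym l f g : aeon 0 l f g -> aeon 0 l g f.
Proof. by apply: ae_imp => x fg /fg. Qed.

Lemma aeon_trans l f g h : aeon 0 l f g -> aeon 0 l g h -> aeon 0 l f h.
Proof.
by move=> fg gh; apply: ae_imp (ae_and fg gh) => x [fg' gh'] xl; rewrite fg'// gh'.
Qed.

Lemma aeon_eq l f g : {in `[0, l], f =1 g} -> aeon 0 l f g.
Proof. by move=> fg; apply: aeW => x /fg. Qed.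

Lemma aeonZ l r f f' : aeon 0 l f f' ->
  aeon 0 l (fun x => r * f x) (fun x => r * f' x).
Proof. by apply: ae_imp => x fx xl; rewrite fx. Qed.

Lemma aeonB l f f' g g' : aeon 0 l f f' -> aeon 0 l g g' ->
  aeon 0 l (fun x => f x - g x) (fun x => f' x - g' x).
Proof.
by move=> ff gg; apply: ae_imp (ae_and ff gg) => x [fx gx] xl; rewrite fx// gx.
Qed.

Lemma eqV_refl l w : eqV l w w.
Proof. by split=> //; exact: aeon_refl. Qed.

Lemma eqV_sym l w w' : eqV l w w' -> eqV l w' w.
Proof. by move=> [A B]; split; [move=> x /A|exact: aeon_sym]. Qed.

Lemma eqV_trans l w w' w'' : eqV l w w' -> eqV l w' w'' -> eqV l w w''.
Proof.
move=> [A B] [A' B']; split; last exact: aeon_trans B B'.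
by move=> x xl; rewrite A// A'.
Qed.

Lemma eqVB l w w' u u' : eqV l w w' -> eqV l u u' -> eqV l (w - u) (w' - u').
Proof.
move=> [A B] [A' B']; split; last exact: aeonB B B'.
by move=> x xl; change (w.1 x - u.1 x = w'.1 x - u'.1 x); rewrite A// A'.
Qed.

Lemma eqVZ l r w w' : eqV l w w' -> eqV l (r *: w) (r *: w').
Proof.
move=> [A B]; split; last exact: aeonZ B.
by move=> x xl; change (r * w.1 x = r * w'.1 x); rewrite A.
Qed.

Lemma calVB l w w' : calV l w -> calV l w' -> calV l (w - w').
Proof. by move=> [A B] [A' B']; split; [exact: V12B|exact: L2B]. Qed.

Lemma calVZ l r w : calV l w -> calV l (r *: w).
Proof. by move=> [A B]; split; [exact: V12Z|exact: L2Z]. Qed.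

Lemma normV_ge0 l w : 0 <= normV l w.
Proof. exact: sqrtr_ge0. Qed.

Lemma normV12_le_normV l w : normV12 l w.1 <= normV l w.
Proof.
rewrite -[leLHS]ger0_norm ?norm_ge0// -sqrtr_sqr; apply: ler_wsqrtr.
by rewrite lerDl sqr_ge0.
Qed.

Lemma normL2_le_normV l w : normL2 0 l w.2 <= normV l w.
Proof.
rewrite -[leLHS]ger0_norm ?norm_ge0// -sqrtr_sqr; apply: ler_wsqrtr.
by rewrite lerDr sqr_ge0.
Qed.

Lemma normV_le l w : normV l w <= normV12 l w.1 + normL2 0 l w.2.
Proof.
have p : 0 <= normV12 l w.1 := norm_ge0 _ _ _.
have q : 0 <= normL2 0 l w.2 := norm_ge0 _ _ _.
rewrite -[leRHS]ger0_norm ?addr_ge0// -sqrtr_sqr; apply: ler_wsqrtr.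
by nra.
Qed.

Lemma normV_eqV l w w' : calV l w -> calV l w' -> eqV l w w' ->
  normV l w = normV l w'.
Proof.
move=> [_ L] [_ L'] [A B]; rewrite /normV (normV12_eq A).
by rewrite (norm_aeq L L' B).
Qed.

Lemma normV_eqV0 l w w' : calV l w -> calV l w' -> normV l (w - w') = 0 -> eqV l w w'.
Proof.
move=> Vw Vw' w0; have [A B] := calVB Vw Vw'; split.
  move=> x xl; apply/eqP; rewrite -subr_eq0; apply/eqP.
  apply: (normV12_0 A _ xl); apply/eqP; rewrite eq_le norm_ge0 andbT.
  by rewrite -w0; exact: (normV12_le_normV l (w - w')).
have : normL2 0 l (w - w').2 = 0.
  apply/eqP; rewrite eq_le norm_ge0 andbT.
  by apply: le_trans (normL2_le_normV l (w - w')) _; rewrite w0.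
move/(norm0_aeq B); apply: ae_imp => x H xl.
by apply/eqP; rewrite -subr_eq0; apply/eqP; exact: H.
Qed.

Lemma normV12B_le l f g h : V12 l f -> V12 l g -> V12 l h ->
  normV12 l (fun x => f x - h x) <=
  normV12 l (fun x => f x - g x) + normV12 l (fun x => g x - h x).
Proof.
move=> /V12_deriv Vf /V12_deriv Vg /V12_deriv Vh.
rewrite (normV12E (H1derivB Vf Vh)) (normV12E (H1derivB Vf Vg)).
rewrite (normV12E (H1derivB Vg Vh)).
have L1 : L2 0 l (fun x => dx 0 l f x - dx 0 l g x).
  by apply: L2B; [case: Vf|case: Vg].
have L2' : L2 0 l (fun x => dx 0 l g x - dx 0 l h x).
  by apply: L2B; [case: Vg|case: Vh].
apply: le_trans (normD L1 L2'); rewrite le_eqVlt; apply/orP; left; apply/eqP.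
by apply: eq_norm => x _; ring.
Qed.

End EnergySpace.

(** * Weak solutions of the wave equation and their uniqueness *)

Section WeakSolutions.
Context {R : realType}.
Implicit Types (a b l r s t x y T : R) (f g h q v : R -> R) (F G : R -> R -> R).

(** Differentiability with values in L2. Elements of L2 are plain functions with a seminorm, hence
    the explicit estimate; it is multiplied out by s - t so that s = t is harmless. *)
Definition ediffL a b T F G : Prop := forall t, 0 <= t <= T ->
  forall eps, 0 < eps -> exists2 del, 0 < del &
  forall s, 0 <= s <= T -> `|s - t| < del ->
    normL2 a b (fun x => F s x - F t x - (s - t) * G t x) <= eps * `|s - t|.

Definition econtL a b T F : Prop := forall t, 0 <= t <= T ->
  forall eps, 0 < eps -> exists2 del, 0 < del &
  forall s, 0 <= s <= T -> `|s - t| < del ->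
    normL2 a b (fun x => F s x - F t x) <= eps.

Definition L2on a b T F : Prop := forall t, 0 <= t <= T -> L2 a b (F t).

Lemma ediffL_dot a b T F G q : L2on a b T F -> L2on a b T G -> L2 a b q ->
  ediffL a b T F G ->
  ediff T (fun t => dotL2 a b (F t) q) (fun t => dotL2 a b (G t) q).
Proof.
move=> LF LG Lq FG t tT eps eps0.
have N0 : 0 < normL2 a b q + 1 by rewrite ltr_wpDl// norm_ge0.
have [del del0 H] := FG t tT (eps / (normL2 a b q + 1)) (divr_gt0 eps0 N0).
exists del => // s sT std; have {}H := H s sT std.
have LD : L2 a b (fun x => F s x - F t x) by apply: L2B; [exact: LF|exact: LF].
rewrite -dotBl//; [|exact: LF|exact: LF].
rewrite -dotZl//; last exact: LG.
rewrite -dotBl//; last by apply: L2Z; exact: LG.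
apply: le_trans (cauchy_schwarz _ Lq) _.
  by apply: L2B => //; apply: L2Z; exact: LG.
apply: le_trans (ler_wpM2r (norm_ge0 _ _ _) H) _.
rewrite mulrAC ler_wpM2r// -mulrA ler_piMr//; first exact: ltW.
by rewrite mulrC ler_pdivrMr// mul1r lerDl.
Qed.

Lemma econtL_dot a b T F q : L2on a b T F -> L2 a b q -> econtL a b T F ->
  econt T (fun t => dotL2 a b (F t) q).
Proof.
move=> LF Lq FC t tT eps eps0.
have N0 : 0 < normL2 a b q + 1 by rewrite ltr_wpDl// norm_ge0.
have [del del0 H] := FC t tT (eps / (normL2 a b q + 1)) (divr_gt0 eps0 N0).
exists del => // s sT std; have {}H := H s sT std.
have LD : L2 a b (fun x => F s x - F t x) by apply: L2B; [exact: LF|exact: LF].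
rewrite -dotBl//; [|exact: LF|exact: LF].
apply: le_trans (cauchy_schwarz LD Lq) _.
apply: le_trans (ler_wpM2r (norm_ge0 _ _ _) H) _.
rewrite -mulrA ler_piMr//; first exact: ltW.
by rewrite mulrC ler_pdivrMr// mul1r lerDl.
Qed.

Lemma ediffL_sqr a b T F G : L2on a b T F -> L2on a b T G -> ediffL a b T F G ->
  ediff T (fun t => dotL2 a b (F t) (F t)) (fun t => 2 * dotL2 a b (F t) (G t)).
Proof.
move=> LF LG FG t tT eps eps0.
set N := normL2 a b (F t); set M := normL2 a b (G t).
have N0 : 0 <= N := norm_ge0 _ _ _.
have M0 : 0 <= M := norm_ge0 _ _ _.
(* Writing F s = F t + D G t + rho, the error is 2 <F t, rho> + |D G t + rho|^2. The bound eps / (4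
   (N + 1)) makes the first term at most eps / 2 times |D|; e1 <= 1 bounds |D G t + rho| by |D| (M +
   1), and d2 below then makes its square at most eps / 2 times |D|. *)
pose e1 := Num.min 1 (eps / (4 * (N + 1))).
have e10 : 0 < e1 by rewrite lt_min ltr01/= divr_gt0//; lra.
have e11 : e1 <= 1 by rewrite ge_min lexx.
have e1N : N * e1 <= eps / 4.
  have : e1 <= eps / (4 * (N + 1)) by rewrite ge_min lexx orbT.
  rewrite ler_pdivlMr; last lra.
  by move=> ?; rewrite ler_pdivlMr; nra.
have [del del0 H] := FG t tT e1 e10.
pose d2 := eps / (2 * (M + 1) ^+ 2).
have d20 : 0 < d2 by rewrite divr_gt0// mulr_gt0// exprn_gt0//; lra.
exists (Num.min del d2) => [|s sT]; first by rewrite lt_min del0.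
rewrite lt_min => /andP[/(H s sT) {}H]; set D := s - t => sd2.
set rho := (fun x => F s x - F t x - _ * G t x) in H.
have Lr : L2 a b rho.
  by apply: L2B; [apply: L2B; exact: LF|apply: L2Z; exact: LG].
have Ld : L2 a b (fun x => D * G t x + rho x).
  by apply: L2D => //; apply: L2Z; exact: LG.
rewrite (@eq_dot _ a b (F s) (F s) (fun x => F t x + (D * G t x + rho x))
   (fun x => F t x + (D * G t x + rho x))); last 2 first.
- by move=> x _; rewrite /rho /D; ring.
- by move=> x _; rewrite /rho /D; ring.
have LFt := LF t tT; have LGt := LG t tT.
have LDG : L2 a b (fun x => D * G t x) by exact: L2Z.
rewrite dot_sqrD// dotDr// dotZr//.
have cs := cauchy_schwarz LFt Lr.
have nd : normL2 a b (fun x => D * G t x + rho x) <= `|D| * (M + 1).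
  apply: le_trans (normD _ Lr) _; first by apply: L2Z; exact: LG.
  rewrite normZ; last exact: LG.
  rewrite mulrDr mulr1 lerD2l (le_trans H)// ler_piMl//.
rewrite (_ : _ - _ = 2 * dotL2 a b (F t) rho +
   dotL2 a b (fun x => D * G t x + rho x) (fun x => D * G t x + rho x)); last by ring.
rewrite -norm_sqr.
have H1 : `|dotL2 a b (F t) rho| <= eps / 4 * `|D|.
  apply: (le_trans cs); apply: le_trans (ler_wpM2l N0 H) _.
  by rewrite mulrA ler_wpM2r.
have H2 : normL2 a b (fun x => D * G t x + rho x) ^+ 2 <= eps / 2 * `|D|.
  apply: (@le_trans _ _ ((`|D| * (M + 1)) ^+ 2)).
    by rewrite ler_sqr ?nnegrE ?norm_ge0// mulr_ge0//; lra.
  rewrite exprMn expr2 -mulrA mulrC ler_wpM2r//.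
  rewrite -ler_pdivlMr; last by rewrite exprn_gt0//; lra.
  by apply: ltW; apply: lt_le_trans sd2 _; rewrite /d2 invfM mulrA.
rewrite (le_trans (ler_normD _ _))// normrM.
rewrite (ger0_norm (_ : 0 <= 2))// (ger0_norm (sqr_ge0 _)).
by have := normr_ge0 D; lra.
Qed.

Lemma ediffD T (e d e' d' : R -> R) : ediff T e d -> ediff T e' d' ->
  ediff T (fun t => e t + e' t) (fun t => d t + d' t).
Proof.
move=> H H' t tT eps eps0; have e20 : 0 < eps / 2 by lra.
have [del del0 Hd] := H _ tT _ e20; have [del' del0' Hd'] := H' _ tT _ e20.
exists (Num.min del del') => [|s sT]; first by rewrite lt_min del0.
rewrite lt_min => /andP[/(Hd _ sT) A /(Hd' _ sT) B].
rewrite (_ : _ - _ = (e s - e t - (s - t) * d t) + (e' s - e' t - (s - t) * d' t)).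
  by apply: le_trans (ler_normD _ _) _; lra.
ring.
Qed.

(** The increments of f^2 are twice the integrals of f g, which vanish by Cauchy-Schwarz; hence f^2
    is a constant, and its integral over an interval of positive length is 0. *)
Lemma H1_norm0 a b f g : a < b -> H1deriv a b f g -> normL2 a b f = 0 ->
  forall x, x \in `[a, b] -> f x = 0.
Proof.
move=> ab H f0.
have Lf : L2 a b f by apply: H1_L2; exists g.
have Lg : L2 a b g by case: H.
have K x : x \in `[a, b] -> f x ^+ 2 = f a ^+ 2.
  move=> xab; move: (xab); rewrite in_itv/= => /andP[ax xb].
  have Hx : H1deriv a x f g.
    split; first exact: L2_sub Lg.
    by move=> y; rewrite in_itv/= => /andP[ay yx]; apply: H1derivE H _;
       rewrite in_itv/= ay (le_trans yx).
  have := H1_parts ax Hx Hx; rewrite (dotC a x g f).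
  have : dotL2 a x f g = 0.
    apply/eqP; rewrite -normr_le0.
    have Lfx : L2 a x f by apply: L2_sub Lf.
    have Lgx : L2 a x g by apply: L2_sub Lg.
    apply: le_trans (cauchy_schwarz Lfx Lgx) _.
    by rewrite mulr_le0_ge0 ?norm_ge0// -f0 norm_mono.
  by move=> ->; rewrite !expr2; lra.
have : dotL2 a b f f = f a ^+ 2 * (b - a).
  rewrite dotE -ivint_cst; last exact: ltW.
  by apply: eq_ivint => x /K; rewrite expr2.
rewrite -norm_sqr f0 expr0n /= => /esym/eqP; rewrite mulf_eq0 orbC subr_eq0 gt_eqF//=.
by move=> /eqP fa x /K; rewrite fa => /eqP; rewrite sqrf_eq0 => /eqP.
Qed.

(** The common ground of delay solutions, d'Alembert waves and group orbits: a finite time interval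
    and an arbitrary boundary forcing v, which enters through its integrals only. *)
Record weaksol l T v (w : R -> state R) : Prop := WeakSol {
  ws_calV : forall t, 0 <= t <= T -> calV l (w t) ;
  ws_cont : econtL 0 l T (fun t => dx 0 l (w t).1) ;
  ws_dt : ediffL 0 l T (fun t => (w t).1) (fun t => (w t).2) ;
  ws_wave : forall phi t, V12 l phi -> 0 <= t <= T ->
    dotL2 0 l (w t).2 phi = dotL2 0 l (w 0).2 phi +
      ivint 0 t (fun s => v s * phi l - dotL2 0 l (dx 0 l (w s).1) (dx 0 l phi)) }.

End WeakSolutions.

(* Keeps unification from unfolding integrals. *)
#[local] Opaque dotL2 ivint.

Section Uniqueness.
Context {R : realType}.
Implicit Types (a b l r s t x y T : R) (f g h q v : R -> R) (F G : R -> R -> R)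
  (w : R -> state R).

Lemma econtLB a b T F F' : L2on a b T F -> L2on a b T F' ->
  econtL a b T F -> econtL a b T F' -> econtL a b T (fun t x => F t x - F' t x).
Proof.
move=> LF LF' H H' t tT eps eps0; have e20 : 0 < eps / 2 by lra.
have [del del0 Hd] := H _ tT _ e20; have [del' del0' Hd'] := H' _ tT _ e20.
exists (Num.min del del') => [|s sT]; first by rewrite lt_min del0.
rewrite lt_min => /andP[/(Hd _ sT) A /(Hd' _ sT) B].
rewrite (@eq_norm _ _ _ _ (fun x => (F s x - F t x) - (F' s x - F' t x))).
  apply: le_trans (normB _ _) _; [| |lra].
  + by apply: L2B; exact: LF.
  + by apply: L2B; exact: LF'.
by move=> x _; ring.
Qed.

Lemma ediffLB a b T F G F' G' : L2on a b T F -> L2on a b T F' ->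
  L2on a b T G -> L2on a b T G' -> ediffL a b T F G -> ediffL a b T F' G' ->
  ediffL a b T (fun t x => F t x - F' t x) (fun t x => G t x - G' t x).
Proof.
move=> LF LF' LG LG' H H' t tT eps eps0; have e20 : 0 < eps / 2 by lra.
have [del del0 Hd] := H _ tT _ e20; have [del' del0' Hd'] := H' _ tT _ e20.
exists (Num.min del del') => [|s sT]; first by rewrite lt_min del0.
rewrite lt_min => /andP[/(Hd _ sT) A /(Hd' _ sT) B].
rewrite (@eq_norm _ _ _ _ (fun x => (F s x - F t x - (s - t) * G t x)
                                  - (F' s x - F' t x - (s - t) * G' t x))).
  apply: le_trans (normB _ _) _; [| |lra].
  + by apply: L2B; [apply: L2B; exact: LF|apply: L2Z; exact: LG].
  + by apply: L2B; [apply: L2B; exact: LF'|apply: L2Z; exact: LG'].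
by move=> x _; ring.
Qed.

(* Energy argument, one derivative below the natural one: with
   Z(t, x) the integral of z(t) over [x, l], the weak equation reads Z_t = - Y_x,
   so that |Y|^2 + |Z|^2 is conserved. *)
Lemma weak_wave_zero l T (Y D z : R -> R -> R) : 0 < l ->
  (forall t, 0 <= t <= T -> H1deriv 0 l (Y t) (D t)) ->
  (forall t, 0 <= t <= T -> Y t 0 = 0) ->
  L2on 0 l T z -> econtL 0 l T D -> ediffL 0 l T Y z ->
  (forall phi t, V12 l phi -> 0 <= t <= T ->
    dotL2 0 l (z t) phi = - ivint 0 t (fun s => dotL2 0 l (D s) (dx 0 l phi))) ->
  normL2 0 l (Y 0) = 0 ->
  forall t, 0 <= t <= T ->
    (forall x, x \in `[0, l] -> Y t x = 0) /\ aeon 0 l (z t) (fun=> 0).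
Proof.
move=> l0 HY Y0 Lz Dc Yd W Yi t tT.
have LY : L2on 0 l T Y by move=> s sT; apply: H1_L2; exists (D s); exact: HY.
have LD : L2on 0 l T D by move=> s sT; case: (HY s sT).
have T0 : 0 <= T by case/andP: tT => /le_trans; exact.
have zT : 0 <= (0 : R) <= T by rewrite lexx.
pose Z s x := ivint x l (z s).
have HZ s : 0 <= s <= T -> H1deriv 0 l (Z s) (fun x => - z s x).
  move=> sT; apply: H1deriv_intro; first exact/L2N/Lz.
  move=> x; rewrite in_itv/= => /andP[x0 xl].
  have zi := L2_itg (Lz s sT).
  rewrite /Z (@ivint_chasles _ 0 x l)//.
  rewrite (@eq_ivint _ 0 x (fun x => - z s x) (fun x => -1 * z s x)); last first.
    by move=> y _; rewrite mulN1r.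
  by rewrite ivintZ; [ring|exact: itg_sub zi].
have LZ : L2on 0 l T Z by move=> s sT; apply: H1_L2; exists (fun x => - z s x); exact: HZ.
have Zdot s phi g : 0 <= s <= T -> H1deriv 0 l phi g -> phi 0 = 0 ->
    dotL2 0 l (Z s) g = dotL2 0 l (z s) phi.
  move=> sT Hp p0; have := H1_parts (ltW l0) (HZ s sT) Hp.
  rewrite p0 /Z (ivint_nil _ (lexx l)) mulr0 mul0r subr0 dotNl.
  - by rewrite addrC => /eqP; rewrite subr_eq0 => /eqP.
  - exact: Lz.
  - by apply: H1_L2; exists g.
(* Every q in L2 is the derivative of a test function, namely its primitive from 0. The weak
   equation thus becomes Z_t = - Y_x, integrated in time and tested against all of L2. *)
have Zq s q : 0 <= s <= T -> L2 0 l q ->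
    dotL2 0 l (Z s) q = - ivint 0 s (fun r => dotL2 0 l (D r) q).
  move=> sT Lq; have [Vp Hp] := V12_primitive Lq.
  have E := Zdot s _ q sT Hp (ivint_nil q (lexx 0)).
  rewrite E (W _ _ Vp sT); congr (- _).
  apply: eq_ivint => r; rewrite in_itv/= => /andP[r0 rs].
  have rT : 0 <= r <= T by case/andP: sT => _ sT; rewrite r0 (le_trans rs).
  by rewrite dotC (dot_dx Hp (LD r rT)) dotC.
have Zd : ediffL 0 l T Z (fun t x => - D t x).
  move=> s sT eps eps0; have [del del0 H] := Dc s sT eps eps0.
  exists del => // r rT rs.
  set rho := fun x => _ - _ - _.
  have Lr : L2 0 l rho.
    by apply: L2B; [apply: L2B; exact: LZ|apply: L2Z; apply: L2N; exact: LD].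
  (* The remainder is tested against itself: |rho|^2 becomes an increment of a primitive, so |rho|^2
     <= eps |r - s| |rho|, and one factor |rho| cancels. *)
  have E : dotL2 0 l rho rho = - (ivint 0 r (fun r => dotL2 0 l (D r) rho) -
     ivint 0 s (fun r => dotL2 0 l (D r) rho) - (r - s) * dotL2 0 l (D s) rho).
    rewrite {1}/rho dotBl//; [|by apply: L2B; exact: LZ|
      by apply: L2Z; apply: L2N; exact: LD].
    rewrite dotBl//; [|exact: LZ|exact: LZ].
    rewrite dotZl//; [|by apply: L2N; exact: LD].
    rewrite dotNl//; [|exact: LD].
    by rewrite !Zq//; ring.
  have : normL2 0 l rho ^+ 2 <= (eps * `|r - s|) * normL2 0 l rho.
    rewrite norm_sqr -[leLHS]ger0_norm ?dot_ge0// E normrN mulrAC.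
    apply: (@ivint_increment _ T) => //; first exact/econt_itg/econtL_dot.
    move=> x xT xs; rewrite -dotBl//; [|exact: LD|exact: LD].
    apply: le_trans (cauchy_schwarz _ Lr) _; first by apply: L2B; exact: LD.
    by rewrite ler_wpM2r ?norm_ge0// H// (le_lt_trans xs).
  have := norm_ge0 0 l rho; rewrite le_eqVlt => /predU1P[<- _|n0].
    by rewrite mulr_ge0// ltW.
  by rewrite expr2 ler_pM2r.
pose E s := dotL2 0 l (Y s) (Y s) + dotL2 0 l (Z s) (Z s).
have LN : L2on 0 l T (fun t x => - D t x) by move=> s sT; apply/L2N/LD.
have Et : E t = E 0.
  apply: (@ediff0_cst _ T) => // s sT eps eps0.
  have [del del0 H] := ediffD (ediffL_sqr LY Lz Yd) (ediffL_sqr LZ LN Zd) sT eps0.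
  exists del => // r rT rs; have := H r rT rs.
  (* The cross terms <Y, z> and <Z, D> cancel by [Zdot] with phi = Y s, which is admissible since Y
     s vanishes at 0. *)
  rewrite (_ : 2 * _ + 2 * _ = 0) ?mulr0//.
  rewrite [dotL2 0 l (Z s) _]dotC dotNl; [|exact: LD|exact: LZ].
  by rewrite (dotC _ _ (D s)) (Zdot _ _ _ sT (HY s sT)) ?Y0// dotC; ring.
have Z00 : dotL2 0 l (Z 0) (Z 0) = 0.
  by rewrite (Zq 0 _ zT (LZ 0 zT)) (ivint_nil _ (lexx 0)) oppr0.
have E0 : E 0 = 0 by rewrite /E Z00 -norm_sqr Yi expr0n addr0.
have [Yt Zt] : dotL2 0 l (Y t) (Y t) = 0 /\ dotL2 0 l (Z t) (Z t) = 0.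
  have p := dot_ge0 0 l (Y t); have q := dot_ge0 0 l (Z t).
  by move: Et p q; rewrite E0 /E; set A := dotL2 _ _ _ _; set B := dotL2 _ _ _ _;
     clear; split; lra.
have nY : normL2 0 l (Y t) = 0 by rewrite /normL2 Yt sqrtr0.
have nZ : normL2 0 l (Z t) = 0 by rewrite /normL2 Zt sqrtr0.
split; first exact: H1_norm0 l0 (HY t tT) nY.
have Z0 := H1_norm0 l0 (HZ t tT) nZ.
have HZ0 : H1deriv 0 l (Z t) (fun=> 0).
  apply: H1deriv_intro; first exact: L2_cst.
  have zl : 0 \in `[0, l] by rewrite in_itv/= lexx ltW.
  by move=> x xl; rewrite (Z0 x xl) (Z0 0 zl) ivint0 addr0.
have := H1deriv_uniq (HZ t tT) HZ0; apply: ae_imp => x H /H.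
by move/eqP; rewrite oppr_eq0 => /eqP.
Qed.

(** The forcings are compared by their primitives because two derivatives of the same boundary trace
    may differ on a null set. In the equation for the difference they cancel, which leaves the
    homogeneous problem. *)
Lemma weaksol_uniq l T v v' w w' : 0 < l -> itg 0 T v -> itg 0 T v' ->
  (forall t, 0 <= t <= T -> ivint 0 t v = ivint 0 t v') ->
  weaksol l T v w -> weaksol l T v' w' -> eqV l (w 0) (w' 0) ->
  forall t, 0 <= t <= T -> eqV l (w t) (w' t).
Proof.
move=> l0 vi vi' vv [Vw cw dw ww] [Vw' cw' dw' ww'] [e1 e2] t tT.
have T0 : 0 <= T by case/andP: tT => /le_trans; exact.
have zT : 0 <= (0 : R) <= T by rewrite lexx.
pose D s x := dx 0 l (w s).1 x - dx 0 l (w' s).1 x.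
have Ld : L2on 0 l T (fun s => dx 0 l (w s).1).
  by move=> s /Vw[/V12_dx_L2].
have Ld' : L2on 0 l T (fun s => dx 0 l (w' s).1).
  by move=> s /Vw'[/V12_dx_L2].
have [] := @weak_wave_zero l T (fun s x => (w s).1 x - (w' s).1 x) D
  (fun s x => (w s).2 x - (w' s).2 x) l0 _ _ _ _ _ _ _ t tT.
- move=> s sT; apply: H1derivB; apply: V12_deriv.
    by case: (Vw s sT).
  by case: (Vw' s sT).
- by move=> s sT; case: (Vw s sT) => -[_ ->] _; case: (Vw' s sT) => -[_ ->] _; rewrite subr0.
- by move=> s sT; apply: L2B; [case: (Vw s sT)|case: (Vw' s sT)].
- exact: (econtLB Ld Ld' cw cw').
- apply: ediffLB => // s sT.
  + by case: (Vw s sT) => /V12_L2.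
  + by case: (Vw' s sT) => /V12_L2.
  + by case: (Vw s sT).
  + by case: (Vw' s sT).
- move=> phi s Vp sT.
  have Lp := V12_dx_L2 Vp.
  have dc := econt_itg (econtL_dot Ld Lp cw).
  have dc' := econt_itg (econtL_dot Ld' Lp cw').
  have sT' : s <= T by case/andP: sT.
  have vi0 : itg 0 s v := itg_sub (lexx 0) sT' vi.
  have vi0' : itg 0 s v' := itg_sub (lexx 0) sT' vi'.
  have vpi : itg 0 s (fun r => phi l * v r) by exact: itgZ.
  have vpi' : itg 0 s (fun r => phi l * v' r) by exact: itgZ.
  have dci : itg 0 s (fun r => dotL2 0 l (dx 0 l (w r).1) (dx 0 l phi)).
    exact: (itg_sub (lexx 0) sT' dc).
  have dci' : itg 0 s (fun r => dotL2 0 l (dx 0 l (w' r).1) (dx 0 l phi)).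
    exact: (itg_sub (lexx 0) sT' dc').
  have Lphi := V12_L2 Vp.
  rewrite (dotBl (Vw s sT).2 (Vw' s sT).2 Lphi) (ww _ _ Vp sT) (ww' _ _ Vp sT).
  rewrite (@eq_ivint _ _ _ (fun s => v s * phi l - _)
     (fun s => phi l * v s - dotL2 0 l (dx 0 l (w s).1) (dx 0 l phi))); last first.
    by move=> r _; rewrite mulrC.
  rewrite (@eq_ivint _ _ _ (fun s => v' s * phi l - _)
     (fun s => phi l * v' s - dotL2 0 l (dx 0 l (w' s).1) (dx 0 l phi))); last first.
    by move=> r _; rewrite mulrC.
  rewrite (ivintB vpi dci) (ivintB vpi' dci') (ivintZ _ vi0) (ivintZ _ vi0').
  rewrite (@eq_ivint _ 0 s (fun r => dotL2 0 l (D r) _)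
     (fun r => dotL2 0 l (dx 0 l (w r).1) (dx 0 l phi) -
               dotL2 0 l (dx 0 l (w' r).1) (dx 0 l phi))); last first.
    move=> r; rewrite in_itv/= => /andP[r0 rs].
    have rT : 0 <= r <= T by rewrite r0 (le_trans rs).
    by rewrite (dotBl (Ld r rT) (Ld' r rT) Lp).
  rewrite (ivintB dci dci') (vv _ sT).
  rewrite (dot_aeq (Vw 0 zT).2 Lphi (Vw' 0 zT).2 Lphi e2 (aeon_refl _ _)).
  have key (p q r u : R) : p + (q - r) - (p + (q - u)) = - (r - u) by ring.
  exact: key.
- rewrite (@eq_norm _ _ _ _ (fun=> 0)); last by move=> x /e1 ->; rewrite subrr.
  by rewrite /normL2 dotE (@eq_ivint _ _ _ _ (fun=> 0)) ?ivint0 ?sqrtr0// => x _; rewrite mulr0.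
move=> A B; split.
  by move=> x /A /eqP; rewrite subr_eq0 => /eqP.
by apply: ae_imp B => x H /H /eqP; rewrite subr_eq0 => /eqP.
Qed.

End Uniqueness.

(** * Translations in L2 *)

Section Translation.
Context {R : realType}.
Local Notation leb := (@lebesgue_measure R).
Implicit Types (a b l r s t x y T : R) (f g h q v : R -> R).

Lemma L2_shift a b r f : L2 (a + r) (b + r) f -> L2 a b (fun x => f (x + r)).
Proof.
move=> [mf f2]; split; last exact: (itg_shift f2).
apply: measurable_comp_itv mf; first exact: measurable_funD.
by move=> x; rewrite !in_itv/= !lerD2r.
Qed.

Lemma L2_opp a b f : L2 (- b) (- a) f -> L2 a b (fun x => f (- x)).
Proof.
move=> [mf f2]; split; last exact: (itg_opp f2).
apply: measurable_comp_itv mf; first exact: measurable_funN.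
by move=> x; rewrite !in_itv/= !lerN2 andbC.
Qed.

Lemma norm_shift a b r f : L2 (a + r) (b + r) f ->
  normL2 a b (fun x => f (x + r)) = normL2 (a + r) (b + r) f.
Proof.
by move=> Lf; rewrite /normL2 !dotE -(ivint_shift (L2M Lf Lf)).
Qed.

Lemma unif_continuous_itv a b f eps : continuous f -> 0 < eps ->
  exists2 del, 0 < del & forall h : R, `|h| < del ->
    forall x, x \in `[a, b] -> `|f (x + h) - f x| <= eps.
Proof.
move=> cf eps0.
have := (@compact_near_coveringP _ (`[a, b]%classic : set R)).1 (@segment_compact R a b).
move=> /(_ R (nbhs (0 : R)) (fun (d x : R) => `|f (x + d) - f x| <= eps)) [].
  move=> x _.
  have e2 : 0 < eps / 2 by lra.
  have /cvgrPdist_le/(_ _ e2)[d /= d0 Hd] := cf x.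
  exists (ball x (d / 2), ball 0 (d / 2)) => /=.
    by split; apply: nbhsx_ballx; lra.
  move=> [x' h] [/= xx' hh].
  have A : `|f x - f (x' + h)| <= eps / 2.
    apply: Hd; rewrite /ball_/= (_ : _ - _ = (x - x') + (0 - h)); last by ring.
    by apply: le_lt_trans (ler_normD _ _) _; rewrite /ball/= in xx' hh; lra.
  have B : `|f x - f x'| <= eps / 2.
    by apply: Hd; rewrite /ball_/=; rewrite /ball/= in xx'; lra.
  rewrite (_ : _ - _ = (f x - f x') - (f x - f (x' + h))); last by ring.
  by apply: le_trans (ler_normB _ _) _; lra.
move=> del /= del0 H; exists del => // h hd x xab.
by apply: (H h) => //; rewrite /ball_/= sub0r normrN.
Qed.

Lemma continuous_L2 a b f : continuous f -> L2 a b f.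
Proof.
move=> cf.
have mf : measurable_fun `[a, b] f.
  by apply: measurable_funTS; exact: continuous_measurable_fun.
split => //; apply: continuous_compact_integrable; first exact: segment_compact.
apply: continuous_subspaceT => x.
by apply: (@continuous_comp _ _ _ f (fun y => y ^+ 2));
  [exact: cf|exact: exprn_continuous].
Qed.

Definition clip (M y : R) : R := Num.max (- M) (Num.min y M).

Lemma clip_norm M y : 0 <= M -> `|clip M y| <= M.
Proof.
move=> M0; rewrite /clip ler_norml le_max lexx/= ge_max ge_min lexx orbT andbT.
by rewrite ge0_cp.
Qed.

Lemma clip_id M y : `|y| <= M -> clip M y = y.
Proof. by rewrite ler_norml => /andP[yM My]; rewrite /clip min_l// max_r. Qed.

Lemma clip_dist M y z : `|clip M y - clip M z| <= `|y - z|.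
Proof.
exact: le_trans (max_dist _ _ _) (min_dist _ _ _).
Qed.

Lemma clip_continuous M : continuous (clip M).
Proof.
move=> y; apply/cvgrPdist_lt => eps eps0; exists eps => //= z yz.
exact: le_lt_trans (clip_dist _ _ _) yz.
Qed.

Lemma clip_measurable a b M f : measurable_fun `[a, b] f ->
  measurable_fun `[a, b] (fun x => clip M (f x)).
Proof.
move=> mf; apply: (@measurableT_comp _ _ _ _ _ _ (clip M)) => //.
by apply: continuous_measurable_fun; exact: clip_continuous.
Qed.

Lemma clip_approx a b g eps : L2 a b g -> 0 < eps ->
  exists2 M, 0 < M & normL2 a b (fun x => g x - clip M (g x)) <= eps.
Proof.
move=> Lg eps0; have mg := L2_measurable Lg.
pose u n x := (g x - clip n%:R (g x)) ^+ 2.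
have mu n : measurable_fun `[a, b] (u n).
  by apply: measurable_funX; apply: measurable_funB => //; exact: clip_measurable.
have [] := @dominated_convergence _ _ _ leb `[a, b]%classic (mitv a b)
  (fun n x => (u n x)%:E) (fun=> 0%E) (fun x => (4 * g x ^+ 2)%:E).
- by move=> n; apply/measurable_EFinP; exact: mu.
- exact: measurable_cst.
- apply: aeW => x _; apply: cvg_near_cst.
  near=> n; rewrite /u clip_id ?subrr ?expr0n//.
  by near: n; exact: nbhs_infty_ger.
- exact: (itgZ 4 (L2_itg2 Lg)).
- apply: aeW => x n _; rewrite /u gee0_abs ?lee_fin ?sqr_ge0//.
  have := clip_dist n%:R (g x) 0; rewrite (@clip_id _ 0) ?normr0// !subr0 => H.
  rewrite -real_normK ?num_real// (_ : 4 * g x ^+ 2 = (2 * `|g x|) ^+ 2).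
    rewrite ler_sqr ?nnegrE ?mulr_ge0// (le_trans (ler_normB _ _))//; lra.
  by rewrite exprMn real_normK ?num_real//; ring.
move=> _ _; rewrite integral0 => /fine_cvgP[_] /cvgrPdist_le.
have e2 : 0 < eps ^+ 2 by rewrite exprn_gt0.
move=> /(_ _ e2)[N _ HN].
(* The successor makes the truncation level positive. *)
exists N.+1%:R => //; apply: norm_le; first exact: ltW.
have := HN N.+1 (leqnSn N); rewrite /= sub0r normrN.
rewrite dotE (@eq_ivint _ _ _ _ (u N.+1)); last by move=> x _; rewrite /u expr2.
by apply: le_trans; exact: ler_norm.
Unshelve. all: by end_near. Qed.

(** Density in L1 is upgraded to L2 by truncation: for functions bounded by M one has |k - f|^2 <= 2
    M |k - f|, and [clip M] brings the approximants below M without increasing their distance to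
    k. *)
Lemma continuous_approx a b g eps : L2 a b g -> 0 < eps ->
  exists2 f, continuous f & normL2 a b (fun x => g x - f x) <= eps.
Proof.
move=> Lg eps0; have e2 : 0 < eps / 2 by lra.
have [M M0 HM] := clip_approx Lg e2.
have mg := L2_measurable Lg.
pose k x := clip M (g x).
have kM x : `|k x| <= M by apply: clip_norm; exact: ltW.
have mk : measurable_fun `[a, b] k by exact: clip_measurable.
have Lk : L2 a b k by apply: (L2_bounded mk) => x _; exact: kM.
have fin : (leb `[a, b]%classic < +oo)%E.
  by rewrite lebesgue_measure_itv/=; case: ifP => // _; rewrite ltry.
have [f_ [cf fi]] := approximation_continuous_integrable (mitv a b) fin (L2_itg Lk).
move=> /fine_cvgP[_] /cvgrPdist_le.
have d0 : 0 < (eps / 2) ^+ 2 / (2 * M) by rewrite divr_gt0 ?mulr_gt0 ?exprn_gt0.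
move=> /(_ _ d0)[N _ /(_ N (leqnn N))]; rewrite /= sub0r normrN => H.
pose f x := clip M (f_ N x).
have cf' : continuous f.
  by move=> x; apply: (@continuous_comp _ _ _ (f_ N) (clip M));
    [exact: cf|exact: clip_continuous].
exists f => //.
have Lf : L2 a b f := continuous_L2 a b cf'.
apply: le_trans (normL2B_le Lg Lk Lf) _.
suff : normL2 a b (fun x => k x - f x) <= eps / 2 by lra.
apply: norm_le; first exact: ltW.
have di : itg a b (fun x => `|k x - f_ N x|).
  apply: itg_norm; apply: itgB; [exact: L2_itg|exact: fi].
have : ivint a b (fun x => `|k x - f_ N x|) <= (eps / 2) ^+ 2 / (2 * M).
  by apply: le_trans H; exact: ler_norm.
rewrite ler_pdivlMr ?mulr_gt0// mulrC -ivintZ//; apply: le_trans.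
rewrite dotE; apply: le_ivint; first by apply: L2M; exact: L2B.
  exact: itgZ.
move=> x _; rewrite -expr2 -real_normK ?num_real// expr2.
apply: ler_pM => //.
  apply: le_trans (ler_normB _ _) _.
  by have := kM x; have : `|f x| <= M by [apply: clip_norm; exact: ltW]; lra.
by rewrite -[X in `|X - _| <= _](clip_id (kM x)); exact: clip_dist.
Qed.

Lemma translation_continuous a b g eps : (forall c d, L2 c d g) -> 0 < eps ->
  exists2 del, 0 < del & forall h : R, `|h| < del ->
    normL2 a b (fun x => g (x + h) - g x) <= eps.
Proof.
move=> Lg eps0.
have [ba|ab] := ltP b a.
  exists 1 => // h _; rewrite /normL2 dotE ivint_nil ?sqrtr0; exact: ltW.
have e3 : 0 < eps / 3 by lra.
(* The margin of 1 on both sides absorbs the translation by h, as |h| < 1 below. *)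
have [f cf Hf] := continuous_approx (Lg (a - 1) (b + 1)) e3.
have s0 : 0 <= Num.sqrt (b - a) := sqrtr_ge0 _.
have e4 : 0 < eps / (3 * (Num.sqrt (b - a) + 1)) by rewrite divr_gt0//; lra.
have [del del0 H] := unif_continuous_itv a b cf e4.
exists (Num.min 1 del) => [|h]; first by rewrite lt_min ltr01.
rewrite lt_min => /andP[h1 /H {}H].
have [hl hr] : -1 <= h /\ h <= 1.
  by have := ler_norm h; have := ler_norm (- h); rewrite normrN; split; lra.
have Lf c d : L2 c d f := continuous_L2 c d cf.
have Lgh : L2 a b (fun x => g (x + h)) by exact: L2_shift.
have Lfh : L2 a b (fun x => f (x + h)) by exact: L2_shift.
have LA : L2 a b (fun x => g (x + h) - f (x + h)) by exact: L2B.
have LB : L2 a b (fun x => f (x + h) - f x) by exact: L2B.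
have LC : L2 a b (fun x => f x - g x) by exact: L2B.
rewrite (@eq_norm _ _ _ _ (fun x => ((g (x + h) - f (x + h)) +
   (f (x + h) - f x)) + (f x - g x))); last by move=> x _; ring.
apply: le_trans (normD (L2D LA LB) LC) _.
have nA : normL2 a b (fun x => g (x + h) - f (x + h)) <= eps / 3.
  rewrite (@norm_shift a b h (fun x => g x - f x)); last exact: L2B.
  by apply: le_trans Hf; apply: norm_mono; [lra|lra|exact: L2B].
have nC : normL2 a b (fun x => f x - g x) <= eps / 3.
  by rewrite normBC; apply: le_trans Hf; apply: norm_mono; [lra|lra|exact: L2B].
have nB : normL2 a b (fun x => f (x + h) - f x) <= eps / 3.
  apply: norm_le; first exact: ltW.
  rewrite dotE -[leLHS]ger0_norm; last by rewrite -dotE dot_ge0.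
  set c := eps / (3 * (Num.sqrt (b - a) + 1)) in H e4.
  apply: (@le_trans _ _ (c ^+ 2 * (b - a))).
    apply: norm_ivint_le_cst => //; first exact: L2M.
    move=> x xab; rewrite -expr2 normrX ler_sqr ?nnegrE//; last exact: ltW.
    exact: H.
  rewrite -(@sqr_sqrtr _ (b - a)) ?subr_ge0// -exprMn.
  rewrite ler_sqr ?nnegrE ?mulr_ge0//; [|exact: ltW|lra].
  rewrite /c mulrAC ler_pdivrMr; last lra.
  nra.
by apply: le_trans (lerD (normD LA LB) (lexx _)) _; lra.
Qed.

End Translation.

(** * Primitives of locally square integrable functions *)

Section Primitives.
Context {R : realType}.
Implicit Types (a b c d l r s t x y T : R) (f g q v G : R -> R).

Definition locL2 g : Prop :=
  measurable_fun (setT : set (measurableTypeR R)) g /\ forall a b, L2 a b g.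

(** G is locally H1 on the whole line with derivative g. Increments instead of a base point make the
    notion stable under translation, reflection and the addition of constants. *)
Definition isprim G g : Prop :=
  locL2 g /\ forall a b, a <= b -> G b - G a = ivint a b g.

Lemma locL2_of g : (forall a b, L2 a b g) -> locL2 g.
Proof.
move=> Lg; split => //.
rewrite (_ : setT = \bigcup_n `[- n%:R, n%:R]%classic); last first.
  apply/seteqP; split=> // x _; exists (Num.truncn `|x|).+1 => //=.
  have := ltW (truncnS_gt `|x|); rewrite ler_norml in_itv/= => /andP[].
  by move=> -> ->.
apply/measurable_fun_bigcup => // n.
exact: L2_measurable.
Qed.

Lemma locL2D f g : locL2 f -> locL2 g -> locL2 (fun x => f x + g x).
Proof. by move=> [mf Lf] [mg Lg]; split; [exact: measurable_funD|move=> *; exact: L2D]. Qed.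

Lemma locL2B f g : locL2 f -> locL2 g -> locL2 (fun x => f x - g x).
Proof. by move=> [mf Lf] [mg Lg]; split; [exact: measurable_funB|move=> *; exact: L2B]. Qed.

Lemma locL2Z r f : locL2 f -> locL2 (fun x => r * f x).
Proof. by move=> [mf Lf]; split; [exact: measurable_funM|move=> *; exact: L2Z]. Qed.

Lemma locL2_shift r f : locL2 f -> locL2 (fun x => f (x + r)).
Proof.
move=> [mf Lf]; split; last by move=> a b; exact: L2_shift.
by apply: measurableT_comp => //; exact: measurable_funD.
Qed.

Lemma locL2_opp f : locL2 f -> locL2 (fun x => f (- x)).
Proof.
by move=> [mf Lf]; split; [exact: measurableT_comp|move=> a b; exact: L2_opp].
Qed.

Lemma isprim_H1 a b G g : isprim G g -> H1deriv a b G g.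
Proof.
move=> [[_ Lg] Gg]; apply: H1deriv_intro => // x; rewrite in_itv/= => /andP[ax _].
by rewrite -Gg//; ring.
Qed.

Lemma isprim_locL2 G g : isprim G g -> locL2 G.
Proof.
by move=> Gg; apply: locL2_of => a b; apply: H1_L2; exists g; exact: isprim_H1.
Qed.

Lemma isprimD G g G' g' : isprim G g -> isprim G' g' ->
  isprim (fun x => G x + G' x) (fun x => g x + g' x).
Proof.
move=> [Lg Gg] [Lg' Gg']; split; first exact: locL2D.
move=> a b ab; rewrite (ivintD (L2_itg (Lg.2 a b)) (L2_itg (Lg'.2 a b))).
by rewrite -Gg// -Gg'//; ring.
Qed.

Lemma isprimB G g G' g' : isprim G g -> isprim G' g' ->
  isprim (fun x => G x - G' x) (fun x => g x - g' x).
Proof.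
move=> [Lg Gg] [Lg' Gg']; split; first exact: locL2B.
move=> a b ab; rewrite (ivintB (L2_itg (Lg.2 a b)) (L2_itg (Lg'.2 a b))).
by rewrite -Gg// -Gg'//; ring.
Qed.

Lemma isprimZ r G g : isprim G g -> isprim (fun x => r * G x) (fun x => r * g x).
Proof.
move=> [Lg Gg]; split; first exact: locL2Z.
move=> a b ab; rewrite (ivintZ _ (L2_itg (Lg.2 a b))).
by rewrite -Gg//; ring.
Qed.

Lemma isprim_shift r G g : isprim G g ->
  isprim (fun x => G (x + r)) (fun x => g (x + r)).
Proof.
move=> [Lg Gg]; split; first exact: locL2_shift.
move=> a b ab; rewrite (ivint_shift (L2_itg (Lg.2 _ _))) Gg// lerD2r//.
Qed.

Lemma isprim_opp G g : isprim G g ->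
  isprim (fun x => - G (- x)) (fun x => g (- x)).
Proof.
move=> [Lg Gg]; split; first exact: locL2_opp.
move=> a b ab; rewrite (ivint_opp (L2_itg (Lg.2 _ _))) -Gg ?lerN2//; ring.
Qed.

Lemma isprim_cst r G g : isprim G g -> isprim (fun x => G x + r) g.
Proof. by move=> [Lg Gg]; split => // a b ab; rewrite -Gg//; ring. Qed.

Lemma eq_isprim G g G' g' : G =1 G' -> g =1 g' -> isprim G g -> isprim G' g'.
Proof. by move=> /funext <- /funext <-. Qed.

Lemma isprim_plus t G g : isprim G g ->
  isprim (fun x => G (t + x)) (fun x => g (t + x)).
Proof. by move=> /(isprim_shift t); apply: eq_isprim => x; rewrite addrC. Qed.

Lemma isprim_minus t G g : isprim G g ->
  isprim (fun x => - G (t - x)) (fun x => g (t - x)).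
Proof.
by move=> /isprim_opp/(isprim_shift (- t)); apply: eq_isprim => x;
  rewrite opprD opprK addrC.
Qed.

(** The oriented integral from 0 to x: [ivint] vanishes when its bounds are reversed, so at most one
    term is nonzero. *)
Definition prim g : R -> R := fun x => ivint 0 x g - ivint x 0 g.

Lemma prim_isprim g : locL2 g -> isprim (prim g) g.
Proof.
move=> Lg; split => // a b ab; rewrite /prim.
have gi c d : itg c d g := L2_itg (Lg.2 c d).
have [a0|a0] := leP 0 a.
  rewrite (ivint_nil _ a0) (ivint_nil _ (le_trans a0 ab)).
  by rewrite (ivint_chasles a0 ab (gi _ _)); ring.
have [b0|b0] := leP b 0.
  rewrite (ivint_nil _ b0) (ivint_nil _ (ltW a0)).
  by rewrite (ivint_chasles ab b0 (gi _ _)); ring.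
rewrite (ivint_nil _ (ltW a0)) (ivint_nil _ (ltW b0)).
by rewrite (ivint_chasles (ltW a0) (ltW b0) (gi _ _)); ring.
Qed.

(* Cauchy-Schwarz in r, then Tonelli. *)
Lemma norm_average a b c d g eps : c <= d -> 0 <= eps -> locL2 g ->
  L2 a b (fun x => ivint c d (fun r => g (r + x) - g x)) ->
  (forall r, r \in `[c, d] -> normL2 a b (fun x => g (x + r) - g x) <= eps) ->
  normL2 a b (fun x => ivint c d (fun r => g (r + x) - g x)) <= eps * (d - c).
Proof.
move=> cd eps0 [mg Lg] LF H.
have dc0 : 0 <= d - c by rewrite subr_ge0.
apply: norm_le; first exact: mulr_ge0.
pose k x r := (g (r + x) - g x) ^+ 2.
have Lx x : L2 c d (fun r => g (r + x) - g x).
  by apply: L2B; [exact: L2_shift|exact: L2_cst].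
have Lr r : L2 a b (fun x => g (x + r) - g x) by apply: L2B => //; exact: L2_shift.
have kE r x : k x r = (g (x + r) - g x) ^+ 2 by rewrite /k (addrC r x).
have Er r : ivint a b (k ^~ r) = normL2 a b (fun x => g (x + r) - g x) ^+ 2.
  rewrite norm_sqr dotE; apply: eq_ivint => x _; exact: kE.
have kir r : itg a b (k ^~ r).
  by apply: itg_eq (L2_itg2 (Lr r)) => x _; rewrite kE.
have [] := @ivint_swap R a b c d k (fun=> eps ^+ 2).
- apply: measurable_funX; apply: measurable_funB.
    apply: (measurableT_comp mg); apply: measurable_funD.
      exact: measurable_snd.
    exact: measurable_fst.
  by apply: (measurableT_comp mg); exact: measurable_fst.
- by move=> x _; exact: L2_itg2 (Lx x).
- by move=> r _; exact: kir.
- exact: itg_cst.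
- move=> r rcd; rewrite (@eq_ivint _ _ _ _ (k ^~ r)); last first.
    by move=> x _; rewrite ger0_norm// sqr_ge0.
  by rewrite Er ler_sqr ?nnegrE ?norm_ge0// H.
move=> i1 i2 E.
rewrite dotE; apply: (@le_trans _ _ (ivint a b (fun x => (d - c) * ivint c d (k x)))).
  apply: le_ivint; [exact: L2M|exact: itgZ|move=> x _].
  rewrite -expr2 -real_normK ?num_real//.
  have := ivint_le_norm cd (Lx x); rewrite -ler_sqr ?nnegrE ?mulr_ge0 ?sqrtr_ge0 ?norm_ge0//.
  move=> /le_trans; apply; rewrite exprMn (sqr_sqrtr dc0) norm_sqr dotE.
  by rewrite (@eq_ivint _ _ _ _ (k x)) => [|r _]; [exact: lexx|rewrite /k expr2].
rewrite (ivintZ _ i1) E (_ : (eps * (d - c)) ^+ 2 = (d - c) * (eps ^+ 2 * (d - c))).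
  apply: (ler_wpM2l dc0); rewrite -(ivint_cst _ cd).
  apply: (le_ivint i2 (itg_cst _ _ _)).
  by move=> r rcd; rewrite Er ler_sqr ?nnegrE ?norm_ge0// H.
by ring.
Qed.

(** The remainder is the integral over r in [0, h] of g (x + r) - g x, an average of translation
    errors. Negative h is treated apart because [ivint] is not oriented. *)
Lemma primitive_diff a b G g eps : isprim G g -> 0 < eps ->
  exists2 del, 0 < del & forall h : R, `|h| < del ->
    normL2 a b (fun x => G (x + h) - G x - h * g x) <= eps * `|h|.
Proof.
move=> Gg eps0; have [Lg GE] := Gg.
have [del del0 H] := translation_continuous a b Lg.2 eps0.
exists del => // h hd.
have LF : L2 a b (fun x => G (x + h) - G x - h * g x).
  apply: L2B; last by apply: L2Z; exact: Lg.2.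
  have := isprimB (isprim_shift h Gg) Gg => /(isprim_H1 a b) HG.
  by apply: H1_L2; exists (fun x => g (x + h) - g x).
have [h0|h0] := leP 0 h.
  have E x : G (x + h) - G x - h * g x = ivint 0 h (fun r => g (r + x) - g x).
    rewrite ivintB; [|apply: itg_shift; exact: L2_itg (Lg.2 _ _)|exact: itg_cst].
    rewrite (ivint_shift (L2_itg (Lg.2 _ _))) ivint_cst// add0r (addrC h x) GE ?lerDl//.
    by ring.
  rewrite (eq_norm (g := fun x => ivint 0 h (fun r => g (r + x) - g x))) => [|x _]; last exact: E.
  rewrite (ger0_norm h0) -[X in eps * X](subr0 h).
  apply: norm_average => //; [exact: ltW|by apply: L2_eq LF => x _; exact: E|].
  move=> r; rewrite in_itv/= => /andP[r0 rh]; apply: H.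
  by rewrite ger0_norm//; move: hd; rewrite ger0_norm//; exact: le_lt_trans.
have E x : G (x + h) - G x - h * g x = - ivint h 0 (fun r => g (r + x) - g x).
  rewrite ivintB; [|apply: itg_shift; exact: L2_itg (Lg.2 _ _)|exact: itg_cst].
  rewrite (ivint_shift (L2_itg (Lg.2 _ _))) ivint_cst ?(ltW h0)//.
  by rewrite add0r (addrC h x) -GE ?gerDl ?(ltW h0)//; ring.
rewrite (eq_norm (g := fun x => - ivint h 0 (fun r => g (r + x) - g x))) => [|x _]; last exact: E.
rewrite normN (ltr0_norm h0) -[X in eps * X]sub0r.
apply: norm_average => //; [exact: ltW|exact: ltW| |].
  by apply: L2_eq (L2N LF) => x _; rewrite E opprK.
move=> r; rewrite in_itv/= => /andP[hr r0]; apply: H.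
by rewrite ler0_norm//; move: hd; rewrite ltr0_norm//; apply: le_lt_trans; rewrite lerN2.
Qed.

End Primitives.

(** * D'Alembert's formula *)

Section DAlembert.
Context {R : realType}.
Implicit Types (a b c d l r s t x y T : R) (f g q v G : R -> R).

Definition wave G g t : state R :=
  (fun x => G (t + x) - G (t - x), fun x => g (t + x) - g (t - x)).

Lemma wave_isprim G g t : isprim G g ->
  isprim (wave G g t).1 (fun x => g (t + x) + g (t - x)).
Proof.
move=> Gg; have := isprimD (isprim_plus t Gg) (isprim_minus t Gg).
exact: eq_isprim.
Qed.

(** The conjugate wave G (t + x) + G (t - x) is an x-primitive of y_t, while its time derivative is
    y_x. *)
Lemma wave_sum_isprim G g t : isprim G g ->
  isprim (fun x => G (t + x) + G (t - x)) (wave G g t).2.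
Proof.
move=> Gg; have := isprimB (isprim_plus t Gg) (isprim_minus t Gg).
by apply: eq_isprim => x //; rewrite opprK.
Qed.

Lemma wave_calV l G g t : isprim G g -> calV l (wave G g t).
Proof.
move=> Gg; split; last exact: (wave_sum_isprim t Gg).1.2.
by apply: V12_of (isprim_H1 0 l (wave_isprim t Gg)) _; rewrite /= addr0 subr0 subrr.
Qed.

Lemma econtL_plus a b T g : locL2 g -> econtL a b T (fun t x => g (t + x)).
Proof.
move=> [mg Lg] t tT eps eps0.
have [del del0 H] := @translation_continuous _ a b (fun x => g (x + t)) eps
  (fun c d => L2_shift (Lg _ _)) eps0.
exists del => // s sT std; have := H _ std.
by rewrite (eq_norm (g := fun x => g (s + x) - g (t + x))) => // x _;
  congr (g _ - g _); ring.
Qed.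

Lemma econtL_minus a b T g : locL2 g -> econtL a b T (fun t x => g (t - x)).
Proof.
move=> Lg t tT eps eps0.
have Lgt : locL2 (fun x => g (t - x)).
  by have [] := isprim_minus t (prim_isprim Lg).
have [del del0 H] := translation_continuous a b Lgt.2 eps0.
exists del => // s sT std; have := H (t - s); rewrite distrC => /(_ std).
by rewrite (eq_norm (g := fun x => g (s - x) - g (t - x))) => // x _;
  congr (g _ - g _); ring.
Qed.

Lemma ediffL_plus a b T G g : isprim G g ->
  ediffL a b T (fun t x => G (t + x)) (fun t x => g (t + x)).
Proof.
move=> Gg t tT eps eps0.
have [del del0 H] := primitive_diff a b (isprim_shift t Gg) eps0.
exists del => // s sT std; have := H _ std.
rewrite (eq_norm (g := fun x => G (s + x) - G (t + x) - (s - t) * g (t + x))) => // x _.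
by congr (G _ - G _ - _ * g _); ring.
Qed.

Lemma ediffL_minus a b T G g : isprim G g ->
  ediffL a b T (fun t x => G (t - x)) (fun t x => g (t - x)).
Proof.
move=> Gg t tT eps eps0.
have [del del0 H] := primitive_diff a b (isprim_minus t Gg) eps0.
exists del => // s sT std; have := H (t - s); rewrite distrC => /(_ std).
rewrite -normN (eq_norm (g := fun x => G (s - x) - G (t - x) - (s - t) * g (t - x))) => // x _.
rewrite (_ : t - (x + (t - s)) = s - x); ring.
Qed.

Lemma econtLD a b T (F F' : R -> R -> R) : L2on a b T F -> L2on a b T F' ->
  econtL a b T F -> econtL a b T F' -> econtL a b T (fun t x => F t x + F' t x).
Proof.
move=> LF LF' H H' t tT eps eps0; have e20 : 0 < eps / 2 by lra.
have [del del0 Hd] := H _ tT _ e20; have [del' del0' Hd'] := H' _ tT _ e20.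
exists (Num.min del del') => [|s sT]; first by rewrite lt_min del0.
rewrite lt_min => /andP[/(Hd _ sT) A /(Hd' _ sT) B].
rewrite (eq_norm (g := fun x => (F s x - F t x) + (F' s x - F' t x))).
  apply: le_trans (normD (L2B (LF s sT) (LF t tT)) (L2B (LF' s sT) (LF' t tT))) _.
  lra.
by move=> x _; ring.
Qed.

Lemma ediffLD a b T (F G F' G' : R -> R -> R) : L2on a b T F -> L2on a b T F' ->
  L2on a b T G -> L2on a b T G' -> ediffL a b T F G -> ediffL a b T F' G' ->
  ediffL a b T (fun t x => F t x + F' t x) (fun t x => G t x + G' t x).
Proof.
move=> LF LF' LG LG' H H' t tT eps eps0; have e20 : 0 < eps / 2 by lra.
have [del del0 Hd] := H _ tT _ e20; have [del' del0' Hd'] := H' _ tT _ e20.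
exists (Num.min del del') => [|s sT]; first by rewrite lt_min del0.
rewrite lt_min => /andP[/(Hd _ sT) A /(Hd' _ sT) B].
rewrite (eq_norm (g := fun x => (F s x - F t x - (s - t) * G t x)
                              + (F' s x - F' t x - (s - t) * G' t x))).
  apply: le_trans (normD (L2B (L2B (LF s sT) (LF t tT)) (L2Z (s - t) (LG t tT)))
     (L2B (L2B (LF' s sT) (LF' t tT)) (L2Z (s - t) (LG' t tT)))) _.
  lra.
by move=> x _; ring.
Qed.

Lemma econtL_aeon a b T (F F' : R -> R -> R) : L2on a b T F -> L2on a b T F' ->
  (forall t, 0 <= t <= T -> aeon a b (F t) (F' t)) -> econtL a b T F -> econtL a b T F'.
Proof.
move=> LF LF' FF H t tT eps eps0; have [del del0 Hd] := H t tT eps eps0.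
exists del => // s sT std; apply: le_trans (Hd s sT std).
rewrite le_eqVlt (norm_aeq (L2B (LF' s sT) (LF' t tT)) (L2B (LF s sT) (LF t tT))) ?eqxx//.
apply: ae_imp (ae_and (FF s sT) (FF t tT)) => x [Fs Ft] xab.
by rewrite Fs// Ft.
Qed.

Lemma ivint_plus a b c g : locL2 g ->
  ivint a b (fun x => g (x + c)) = ivint (a + c) (b + c) g.
Proof. by move=> Lg; apply: ivint_shift; exact: L2_itg (Lg.2 _ _). Qed.

(** Since y_t is not differentiable in L2, <y_t, phi> is first integrated by parts in x, onto the
    conjugate wave A. The interior term is differentiable with A_t = y_x, and the boundary term A(t,
    l) phi(l) yields the forcing, as G (t + l) + G (t - l) has derivative g (t + l) + g (t - l). *)
Lemma wave_weaksol l T G g : 0 < l -> isprim G g ->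
  weaksol l T (fun s => g (s + l) + g (s - l)) (wave G g).
Proof.
move=> l0 Gg; have Lg := Gg.1.
have Lp t : locL2 (fun x => g (t + x)) by have [] := isprim_plus t Gg.
have Lm t : locL2 (fun x => g (t - x)) by have [] := isprim_minus t Gg.
have LGp t : L2 0 l (fun x => G (t + x)).
  by apply: H1_L2; eexists; exact: isprim_H1 (isprim_plus t Gg).
have LGm t : L2 0 l (fun x => G (t - x)).
  have := isprim_minus t Gg => /(isprim_H1 0 l) H.
  have : L2 0 l (fun x => - G (t - x)) by apply: H1_L2; eexists; exact: H.
  by move/L2N; apply: L2_eq => x _; rewrite opprK.
have Lpm t : L2 0 l (fun x => g (t + x) + g (t - x)).
  by apply: L2D; [exact: (Lp t).2|exact: (Lm t).2].
have Vw t := wave_calV l t Gg.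
have dxE t : aeon 0 l (dx 0 l (wave G g t).1) (fun x => g (t + x) + g (t - x)).
  exact: dx_aeon (isprim_H1 0 l (wave_isprim t Gg)).
have C : econtL 0 l T (fun t x => g (t + x) + g (t - x)).
  by apply: econtLD; [move=> t _; exact: (Lp t).2|move=> t _; exact: (Lm t).2|
     exact: econtL_plus|exact: econtL_minus].
have Ldx : L2on 0 l T (fun t => dx 0 l (wave G g t).1).
  by move=> t _; exact: V12_dx_L2 (Vw t).1.
split.
- by move=> t _.
- by apply: econtL_aeon C => // t _; exact: aeon_sym.
- by apply: ediffLB; [move=> t _; exact: LGp|move=> t _; exact: LGm|
    move=> t _; exact: (Lp t).2|move=> t _; exact: (Lm t).2|
    exact: ediffL_plus|exact: ediffL_minus].
- move=> phi t Vp tT; have Lphi := V12_dx_L2 Vp.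
  pose A t x := G (t + x) + G (t - x).
  have parts s : dotL2 0 l (wave G g s).2 phi =
      A s l * phi l - dotL2 0 l (A s) (dx 0 l phi).
    have := H1_parts (ltW l0) (isprim_H1 0 l (wave_sum_isprim s Gg)) (V12_deriv Vp).
    case: Vp => _ ->; rewrite mulr0 subr0 => <-.
    by rewrite /A addrK.
  have dA : ediffL 0 l T A (fun t x => g (t + x) + g (t - x)).
    by apply: ediffLD; [move=> s _; exact: LGp|move=> s _; exact: LGm|
      move=> s _; exact: (Lp s).2|move=> s _; exact: (Lm s).2|
      exact: ediffL_plus|exact: ediffL_minus].
  have dot_ediff : ediff T (fun s => dotL2 0 l (A s) (dx 0 l phi))
      (fun s => dotL2 0 l (fun x => g (s + x) + g (s - x)) (dx 0 l phi)).
    by apply: (ediffL_dot _ _ Lphi dA) => s _; [exact: L2D|exact: Lpm].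
  have dot_econt := econtL_dot (fun s _ => Lpm s) Lphi C.
  have dE s : dotL2 0 l (fun x => g (s + x) + g (s - x)) (dx 0 l phi) =
      dotL2 0 l (dx 0 l (wave G g s).1) (dx 0 l phi).
    by rewrite (dot_dx (isprim_H1 0 l (wave_isprim s Gg)) Lphi).
  have E1 := ediff_ivint dot_econt dot_ediff tT.
  have [t0 tT'] : 0 <= t /\ t <= T by case/andP: tT.
  have di : itg 0 t (fun s => dotL2 0 l (dx 0 l (wave G g s).1) (dx 0 l phi)).
    apply: (@itg_eq R 0 t _ _ _ (itg_sub (lexx 0) tT' (econt_itg dot_econt))).
    by move=> s _; exact: dE.
  have vi : itg 0 t (fun s => phi l * (g (s + l) + g (s - l))).
    apply/itgZ/L2_itg/L2D; first exact: (locL2_shift l Lg).2.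
    exact: (locL2_shift (- l) Lg).2.
  rewrite (@eq_ivint _ 0 t _ (fun s => phi l * (g (s + l) + g (s - l))
     - dotL2 0 l (dx 0 l (wave G g s).1) (dx 0 l phi))); last first.
    by move=> s _; rewrite mulrC.
  rewrite (ivintB vi di).
  rewrite ivintZ; last first.
    apply/L2_itg/L2D; first exact: (locL2_shift l Lg).2.
    exact: (locL2_shift (- l) Lg).2.
  rewrite (ivintD (L2_itg ((locL2_shift l Lg).2 0 t)) (L2_itg ((locL2_shift (- l) Lg).2 0 t))).
  rewrite (ivint_plus _ _ _ Lg) (ivint_plus _ _ (- l) Lg).
  rewrite -(Gg.2 _ _ (_ : 0 + l <= t + l)) ?lerD2r//.
  rewrite -(Gg.2 _ _ (_ : 0 - l <= t - l)) ?lerD2r//.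
  rewrite !parts E1 (@eq_ivint _ 0 t (fun s => dotL2 0 l (dx 0 l (wave G g s).1) _)
     (fun s => dotL2 0 l (fun x => g (s + x) + g (s - x)) (dx 0 l phi))); last first.
    by move=> s _; rewrite dE.
  rewrite /A; move: (dotL2 _ _ _ _) (ivint _ _ _) => p q; ring.
Qed.

End DAlembert.

(** * The solution of the delay system *)

Section DelayedProfile.
Context {R : realType}.
Local Notation leb := (@lebesgue_measure R).
Implicit Types (a b l mu r s t x y T : R) (f g q v G p : R -> R).

Lemma locL2_patch a b f (D : set R) : measurable D -> D `<=` `[a, b] ->
  L2 a b f -> locL2 (f \_ D).
Proof.
move=> mD Dab [mf f2].
have mp : measurable_fun setT (f \_ D).
  apply/(measurable_restrictT f mD); apply: measurable_funS mf => //.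
split => // c d; split; first exact: measurable_funTS.
have : leb.-integrable D (fun x => (f x ^+ 2)%:E).
  by apply: (integrableS (mitv a b) _ Dab f2).
move=> H0; have H := (@integrable_mkcond _ (measurableTypeR R) R leb D
  (fun x => (f x ^+ 2)%:E) mD).1 H0.
have := integrableS measurableT (mitv c d) (@subsetT _ _) H.
apply: eq_integrable => // x _; rewrite !patchE.
by case: ifP => //; rewrite expr0n.
Qed.

(* The boundary condition g(t + l) + g(t - l) = mu (g(t - l) - g(t - 3 l)) reads
   g(s) = (mu - 1) g(s - 2 l) - mu g(s - 4 l). *)
Definition coef mu (n : nat) : R :=
  (iter n (fun c : R * R => (c.2, (mu - 1) * c.2 - mu * c.1)) (1, -1)).1.

Lemma coef0 mu : coef mu 0 = 1. Proof. by []. Qed.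

Lemma coef1 mu : coef mu 1 = -1. Proof. by []. Qed.

Lemma coefSS mu n : coef mu n.+2 = (mu - 1) * coef mu n.+1 - mu * coef mu n.
Proof. by []. Qed.

(* The profile g of the solution y_t = g(t + x) - g(t - x): on the n-th interval
   of length 2 l it is [coef mu n] times the initial profile p, which is
   supported in [-l, l[. *)
Definition psum l mu p (N : nat) : R -> R :=
  fun s => \sum_(n < N) coef mu n * p (s - 2 * n%:R * l).

Definition profile l mu p : R -> R :=
  fun s => psum l mu p (Num.truncn (`|s| / l)).+1 s.

Section Profile.
Context (l mu : R) (p : R -> R) (l0 : 0 < l).
Context (pl : forall x, l <= x -> p x = 0) (pr : forall x, x < - l -> p x = 0).
Local Notation psum := (psum l mu p).
Local Notation profile := (profile l mu p).

Lemma psum_stable (N k : nat) s : s < (2 * N%:R - 1) * l ->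
  psum (N + k) s = psum N s.
Proof.
move=> sN; rewrite /psum big_split_ord/= [X in _ + X]big1 ?addr0// => i _.
rewrite pr ?mulr0// natrD.
have : 0 <= (i : nat)%:R * l by rewrite mulr_ge0// ltW.
by move: sN; set u := N%:R; set k' := i%:R; lra.
Qed.

(** Terms of index at least N evaluate p to the left of -l, where it vanishes, so every large enough
    N gives the same sum. The number M of terms in [profile] is large enough: s < M l <= (2 M - 1) l
    because M >= 1. *)
Lemma profileE (N : nat) s : s < (2 * N%:R - 1) * l -> profile s = psum N s.
Proof.
move=> sN; set M := (Num.truncn (`|s| / l)).+1.
have sM : s < (2 * M%:R - 1) * l.
  have : `|s| / l < M%:R := truncnS_gt _.
  rewrite ltr_pdivrMr// => H.
  have M1 : 1 <= M%:R :> R by rewrite ler1n.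
  have K : 0 <= (M%:R - 1) * l by rewrite mulr_ge0 ?subr_ge0// ltW.
  have := ler_norm s; move: H K; move: (M%:R) => u; lra.
have [NM|MN] := leqP N M.
  by rewrite /profile -/M -(subnKC NM) psum_stable.
by rewrite /profile -/M -(subnKC (ltnW MN)) psum_stable.
Qed.

Lemma locL2_psum N : locL2 p -> locL2 (psum N).
Proof.
move=> Lp; elim: N => [|N IH].
  apply: locL2_of => a b; apply: (L2_eq (f := fun=> 0)); last exact: L2_cst.
  by move=> x _; rewrite /psum big_ord0.
rewrite (_ : psum N.+1 = fun x => psum N x + coef mu N * p (x - 2 * N%:R * l)).
  exact: locL2D IH (locL2Z (coef mu N) (locL2_shift (- (2 * N%:R * l)) Lp)).
by apply/funext => x; rewrite /psum big_ord_recr.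
Qed.

Lemma locL2_profile : locL2 p -> locL2 profile.
Proof.
move=> Lp; apply: locL2_of => a b.
pose N := (Num.truncn (`|b| / l)).+1.
apply: (L2_eq (f := psum N)); last exact: (locL2_psum N Lp).2.
move=> x; rewrite in_itv/= => /andP[_ xb]; rewrite (@profileE N)//.
have : `|b| / l < N%:R := truncnS_gt _.
rewrite ltr_pdivrMr// => H.
have N1 : 1 <= N%:R :> R by rewrite ler1n.
have K : 0 <= (N%:R - 1) * l by rewrite mulr_ge0 ?subr_ge0// ltW.
by have := ler_norm b; move: H K; move: (N%:R) => u; lra.
Qed.

Lemma profile_init s : s < l -> profile s = p s.
Proof.
move=> sl; rewrite (@profileE 1); last by rewrite mulr1; lra.
by rewrite /psum big_ord1 coef0 mul1r mulr0 mul0r subr0.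
Qed.

Lemma psum_recl N s : psum N.+1 s =
  p s + \sum_(n < N) coef mu n.+1 * p (s - 2 * l - 2 * n%:R * l).
Proof.
rewrite /psum big_ord_recl coef0 mul1r mulr0 mul0r subr0; congr (_ + _).
by apply: eq_bigr => i _; congr (_ * p _); rewrite lift0 -addn1 natrD; ring.
Qed.

(** Before 2 l only [coef] 0 and 1 occur, and 1 + (-1) = 0. Afterwards p vanishes at t + l and t -
    l, all sums run over the values p (t - 3 l - 2 i l), and the identity holds term by term by
    [coefSS]. *)
Lemma profile_neumann t : 0 <= t -> profile (t + l) + profile (t - l) =
  neumann l mu (fun s => profile (s + l) - profile (s - l)) t.
Proof.
move=> t0; rewrite /neumann; case: ltP => tl.
  rewrite (@profileE 2); last by lra.
  rewrite (@profileE 1); last by lra.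
  rewrite psum_recl pl ?add0r; last by lra.
  rewrite /psum !big_ord1 coef0 coef1 mulr0 mul0r !subr0.
  by rewrite (_ : t + l - 2 * l = t - l); ring.
pose N := (Num.truncn (`|t| / l)).+1.
have tN : t < N%:R * l.
  have : `|t| / l < N%:R := truncnS_gt _.
  by rewrite ltr_pdivrMr//; apply: le_lt_trans; exact: ler_norm.
have N1 : 1 <= N%:R :> R by rewrite ler1n.
have NS1 : N.+1%:R = N%:R + 1 :> R by rewrite -addn1 natrD.
(* With N + 2, N + 1 and N terms at t + l, t - l and t - 3 l, peeling off the vanishing leading
   terms leaves three sums over the same N indices. *)
have NS2 : N.+2%:R = N%:R + 2 :> R by rewrite -addn2 natrD.
rewrite (@profileE N.+2 (t + l)); last by rewrite NS2; nra.
rewrite (@profileE N.+1 (t - l)); last by rewrite NS1; nra.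
rewrite (_ : t - 2 * l + l = t - l); last by ring.
rewrite (@profileE N.+1 (t - l)); last by rewrite NS1; nra.
rewrite (@profileE N (t - 2 * l - l)); last by nra.
rewrite (psum_recl N.+1) !(psum_recl N (t - l)) [p (t + l)]pl ?add0r; last by lra.
rewrite [p (t - l)]pl ?add0r; last by lra.
rewrite big_ord_recl /= coef1 mulr0 mul0r subr0.
rewrite (_ : t + l - 2 * l = t - l); last by ring.
rewrite [p (t - l)]pl ?mulr0 ?add0r; last by lra.
rewrite /psum -sumrB -big_split/= mulr_sumr; apply: eq_bigr => i _.
rewrite /bump/= add1n coefSS.
rewrite (_ : t - l - 2 * i.+1%:R * l = t - l - 2 * l - 2 * i%:R * l); last first.
  by rewrite -addn1 natrD; ring.
rewrite (_ : t - 2 * l - l = t - l - 2 * l); last by ring.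
move: (p _) (coef _ _) (coef _ _) => u c c'; ring.
Qed.

End Profile.

End DelayedProfile.

(** * Existence for the delay system *)

Section Solutions.
Context {R : realType}.
Local Notation leb := (@lebesgue_measure R).
Implicit Types (a b c l mu r s t x y T : R) (f g q v G p : R -> R) (w : R -> state R) (wi : state R).

Lemma cvg_within_eps (D : set R) f t0 : (forall t, 0 <= f t) ->
  f t @[t --> within D (nbhs t0)] --> (0 : R) <->
  forall eps, 0 < eps -> exists2 del, 0 < del &
    forall t, D t -> `|t - t0| < del -> f t <= eps.
Proof.
move=> f0; split.
  move=> /cvgrPdist_le H eps eps0; have := H eps eps0.
  rewrite near_withinE => -[del /= del0 Hd]; exists del => // t Dt td.
  have := Hd t; rewrite /ball_/= distrC => /(_ td Dt).
  by rewrite sub0r normrN ger0_norm.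
move=> H; apply/cvgrPdist_le => eps eps0; have [del del0 Hd] := H eps eps0.
rewrite near_withinE; exists del => // t /= td Dt.
by rewrite sub0r normrN ger0_norm// Hd// distrC.
Qed.

Lemma cvg_dnbhs_eps (D : set R) f : (forall t, 0 <= f t) ->
  f h @[h --> within D ((0 : R)^')] --> (0 : R) <->
  forall eps, 0 < eps -> exists2 del, 0 < del &
    forall h : R, D h -> h != 0 -> `|h| < del -> f h <= eps.
Proof.
move=> f0; split.
  move=> /cvgrPdist_le H eps eps0; have := H eps eps0.
  rewrite near_withinE /dnbhs near_withinE => -[del /= del0 Hd].
  exists del => // t Dt t0 td.
  have := Hd t; rewrite /ball_/= sub0r normrN => /(_ td t0 Dt).
  by rewrite sub0r normrN ger0_norm.
move=> H; apply/cvgrPdist_le => eps eps0; have [del del0 Hd] := H eps eps0.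
rewrite near_withinE /dnbhs near_withinE; exists del => // t /=.
rewrite sub0r normrN => td t0 Dt.
by rewrite sub0r normrN ger0_norm// Hd.
Qed.

Lemma contV_econtL l T w : contV l [set t | 0 <= t] w ->
  econtL 0 l T (fun t => dx 0 l (w t).1).
Proof.
move=> cw t /andP[t0 _] eps eps0; have [Vt] := cw t t0.
move/(cvg_within_eps _ _ (fun s => normV_ge0 l (w s - w t))).
move=> /(_ eps eps0)[del del0 H]; exists del => // s /andP[s0 _] std.
apply: le_trans (H s s0 std); apply: le_trans (normV12_le_normV _ _).
have [Vs _] := cw s s0.
by rewrite (normV12E (H1derivB (V12_deriv Vs.1) (V12_deriv Vt.1))).
Qed.

Lemma quotient_norm a b (f f' z : R -> R) (h : R) : h != 0 ->
  L2 a b f -> L2 a b f' -> L2 a b z ->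
  normL2 a b (fun x => f' x - f x - h * z x) =
  `|h| * normL2 a b (h^-1 *: (f' - f) - z).
Proof.
move=> h0 Lf Lf' Lz.
have L : L2 a b (fun x => h^-1 * (f' x - f x) - z x).
  by apply: L2B => //; apply: L2Z; exact: L2B.
rewrite -normZ//; apply: eq_norm => x _.
rewrite mulrBr mulrA divff// mul1r.
by [].
Qed.

Lemma sol_dt_ediffL l T w : (forall t, 0 <= t -> calV l (w t)) ->
  (forall t, 0 <= t ->
    normL2 0 l (h^-1 *: ((w (t + h)).1 - (w t).1) - (w t).2)
      @[h --> within [set h | 0 <= t + h] ((0 : R)^')] --> (0 : R)) ->
  ediffL 0 l T (fun t => (w t).1) (fun t => (w t).2).
Proof.
move=> Vw H t /andP[t0 _] eps eps0.
have := (cvg_dnbhs_eps _ (fun h => norm_ge0 0 l (h^-1 *: ((w (t + h)).1 - (w t).1) - (w t).2))).1 (H t t0).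
move=> /(_ eps eps0)[del del0 Hd]; exists del => // s /andP[s0 _] std.
have [->|st] := eqVneq s t.
  rewrite (eq_norm (g := fun=> 0)) => [|x _]; last by ring.
  by rewrite subrr normr0 mulr0 /normL2 dotE (@eq_ivint _ _ _ _ (fun=> 0)) ?ivint0 ?sqrtr0// => x _; rewrite mulr0.
have h0 : s - t != 0 by rewrite subr_eq0.
have := Hd (s - t); rewrite /= (_ : t + (s - t) = s); last by ring.
move=> /(_ s0 h0 std) Hs.
rewrite (quotient_norm h0 (V12_L2 (Vw t t0).1) (V12_L2 (Vw s s0).1) (Vw t t0).2).
by rewrite mulrC ler_wpM2r.
Qed.

Lemma solution_weaksol l mu T w (b : R -> R) : contV l [set t | 0 <= t] w ->
  (forall t, 0 <= t ->
    normL2 0 l (h^-1 *: ((w (t + h)).1 - (w t).1) - (w t).2)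
      @[h --> within [set h | 0 <= t + h] ((0 : R)^')] --> (0 : R)) ->
  (forall phi t, V12 l phi -> 0 <= t ->
      dotL2 0 l (w t).2 phi = dotL2 0 l (w 0).2 phi +
        \int[leb]_(s in `[0, t])
          (neumann l mu b s * phi l
           - dotL2 0 l (dx 0 l (w s).1) (dx 0 l phi))) ->
  weaksol l T (neumann l mu b) w.
Proof.
move=> cw dw ww; have Vw t : 0 <= t -> calV l (w t) by move=> /cw[].
split.
- by move=> t /andP[/Vw].
- exact: contV_econtL.
- exact: sol_dt_ediffL.
- by move=> phi t Vp /andP[t0 _]; exact: ww.
Qed.

Lemma wave_contV l G g : isprim G g -> 0 < l -> contV l [set t | 0 <= t] (wave G g).
Proof.
move=> Gg l0 t /= t0; have Vw s := wave_calV l s Gg; split => //.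
apply/(cvg_within_eps _ _ (fun s => normV_ge0 l (wave G g s - wave G g t))).
move=> eps eps0; have e2 : 0 < eps / 2 by lra.
have tT : 0 <= t <= t + 1 by apply/andP; split; lra.
have [_ C1 _ _] := wave_weaksol (t + 1) l0 Gg.
have C2 : econtL 0 l (t + 1) (fun s => (wave G g s).2).
  apply: econtLB.
  - by move=> s _; have [[_ L] _] := isprim_plus s Gg; exact: L.
  - by move=> s _; have [[_ L] _] := isprim_minus s Gg; exact: L.
  - exact: econtL_plus Gg.1.
  - exact: econtL_minus Gg.1.
have [d1 d10 H1] := C1 t tT _ e2; have [d2 d20 H2] := C2 t tT _ e2.
exists (Num.min 1 (Num.min d1 d2)) => [|s s0]; first by rewrite !lt_min ltr01 d10.
rewrite !lt_min => /and3P[s1 sd1 sd2].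
have sT : 0 <= s <= t + 1 by apply/andP; split => //; have := ler_norm (s - t); lra.
apply: le_trans (normV_le _ _) _.
have := H1 s sT sd1; rewrite -(normV12E (H1derivB (V12_deriv (Vw s).1) (V12_deriv (Vw t).1))).
have := H2 s sT sd2.
rewrite -[X in X <= _ -> _]/(normL2 0 l (wave G g s - wave G g t).2).
rewrite -[X in _ -> X <= _ -> _]/(normV12 l (wave G g s - wave G g t).1).
by move: (normL2 _ _ _) (normV12 _ _) => u u'; lra.
Qed.

Lemma wave_sol_dt l G g t : isprim G g -> 0 < l -> 0 <= t ->
    normL2 0 l (h^-1 *: ((wave G g (t + h)).1 - (wave G g t).1) - (wave G g t).2)
      @[h --> within [set h | 0 <= t + h] ((0 : R)^')] --> (0 : R).
Proof.
move=> Gg l0 t0; have Vw s := wave_calV l s Gg.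
apply/(cvg_dnbhs_eps _ (fun h => norm_ge0 0 l (h^-1 *: ((wave G g (t + h)).1 - (wave G g t).1) - (wave G g t).2))).
move=> eps eps0; have tT : 0 <= t <= t + 1 by apply/andP; split; lra.
have [_ _ D _] := wave_weaksol (t + 1) l0 Gg.
have [d d0 H] := D t tT _ eps0.
exists (Num.min 1 d) => [|h hD h0]; first by rewrite lt_min ltr01.
rewrite lt_min => /andP[h1 hd].
have sT : 0 <= t + h <= t + 1.
  by apply/andP; split => //; have := ler_norm h; lra.
have := H (t + h) sT; rewrite (_ : t + h - t = h); last by ring.
move=> /(_ hd).
rewrite (quotient_norm h0 (V12_L2 (Vw t).1) (V12_L2 (Vw (t + h)).1) (Vw t).2).
by rewrite mulrC ler_pM2r// normr_gt0.
Qed.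

Lemma wave_trace a b l G g : isprim G g ->
  H1deriv a b (trace l (wave G g)) (fun t => g (t + l) - g (t - l)).
Proof.
move=> Gg; have := isprimB (isprim_shift l Gg) (isprim_shift (- l) Gg).
by move=> /(isprim_H1 a b).
Qed.

Lemma wave_solution l mu G g wi : 0 < l -> isprim G g -> eqV l (wave G g 0) wi ->
  (forall t, 0 <= t -> g (t + l) + g (t - l) =
     neumann l mu (fun s => g (s + l) - g (s - l)) t) ->
  solution l mu wi (wave G g).
Proof.
move=> l0 Gg i0 gN; split.
- exact: wave_contV.
- by [].
- by move=> t t0; exact: wave_sol_dt.
exists (fun s => g (s + l) - g (s - l)); split.
  by move=> T T0; exact: wave_trace.
move=> phi t Vp t0; have [_ _ _ W] := wave_weaksol t l0 Gg.
rewrite (W phi t Vp) ?t0 ?lexx//; congr (_ + _).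
apply: eq_ivint => s; rewrite in_itv/= => /andP[s0 _].
by rewrite gN.
Qed.

(* On ]0, l[ it solves g(x) + g(-x) = y_x(x, 0) and g(x) - g(-x) = y_t(x, 0). *)
Definition init_profile l (wi : state R) : R -> R := fun s =>
  ((fun x => 2^-1 * (dx 0 l wi.1 x + wi.2 x)) \_ `[0, l[) s +
  ((fun x => 2^-1 * (dx 0 l wi.1 x - wi.2 x)) \_ `]0, l]) (- s).

Lemma init_profileE l wi x : 0 < x < l ->
  init_profile l wi x = 2^-1 * (dx 0 l wi.1 x + wi.2 x) /\
  init_profile l wi (- x) = 2^-1 * (dx 0 l wi.1 x - wi.2 x).
Proof.
move=> /andP[x0 xl]; rewrite /init_profile !patchE opprK; split.
  rewrite mem_set /= ?in_itv/= ?(ltW x0)// memNset /= ?addr0//.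
  by rewrite in_itv/=; apply/negP; rewrite negb_and -leNgt oppr_le0 ltW.
rewrite memNset /=; last by rewrite in_itv/=; apply/negP; rewrite negb_and -ltNge oppr_lt0 x0.
by rewrite add0r mem_set//= in_itv/= x0 ltW.
Qed.

Lemma init_profile_locL2 l wi : calV l wi -> locL2 (init_profile l wi).
Proof.
move=> [V1 V2]; have Ld := V12_dx_L2 V1.
apply: locL2D.
  apply: (@locL2_patch _ 0 l); [exact: measurable_itv| |exact/L2Z/L2D].
  exact: subset_itv_co_cc.
apply: locL2_opp; apply: (@locL2_patch _ 0 l); [exact: measurable_itv| |exact/L2Z/L2B].
exact: subset_itv_oc_cc.
Qed.

(** The half-open intervals in [init_profile] give a support inside [-l, l[, including the end point
    l here, so that the translates by multiples of 2 l tile the line without overlap. *)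
Lemma init_profile_right l wi x : 0 < l -> l <= x -> init_profile l wi x = 0.
Proof.
move=> l0 lx; rewrite /init_profile !patchE !memNset ?addr0//=; rewrite in_itv/=; apply/negP.
  by rewrite negb_and -leNgt; apply/orP; left; lra.
by rewrite negb_and -!leNgt; apply/orP; right.
Qed.

Lemma init_profile_left l wi x : 0 < l -> x < - l -> init_profile l wi x = 0.
Proof.
move=> l0 lx; rewrite /init_profile !patchE !memNset ?addr0//=; rewrite in_itv/=; apply/negP.
  by rewrite negb_and -ltNge; apply/orP; right; lra.
by rewrite negb_and -!ltNge; apply/orP; left; lra.
Qed.

Definition sol_profile l mu wi : R -> R := profile l mu (init_profile l wi).

Definition sol_wave_of l mu wi : R -> state R :=
  wave (prim (sol_profile l mu wi)) (sol_profile l mu wi).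

Lemma sol_profile_locL2 l mu wi : 0 < l -> calV l wi -> locL2 (sol_profile l mu wi).
Proof.
move=> l0 V0; apply: locL2_profile => //.
- by move=> x; exact: init_profile_left.
- exact: init_profile_locL2.
Qed.

Lemma sol_profile_isprim l mu wi : 0 < l -> calV l wi ->
  isprim (prim (sol_profile l mu wi)) (sol_profile l mu wi).
Proof. by move=> l0 V0; apply: prim_isprim; exact: sol_profile_locL2. Qed.

Lemma sol_profile_neumann l mu wi t : 0 < l -> 0 <= t ->
  sol_profile l mu wi (t + l) + sol_profile l mu wi (t - l) =
  neumann l mu (fun s => sol_profile l mu wi (s + l) - sol_profile l mu wi (s - l)) t.
Proof.
move=> l0 t0; apply: profile_neumann => //.
- by move=> x; exact: init_profile_right.
- by move=> x; exact: init_profile_left.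
Qed.

Lemma sol_wave_init l mu wi : 0 < l -> calV l wi -> eqV l (sol_wave_of l mu wi 0) wi.
Proof.
move=> l0 V0; set g := sol_profile l mu wi.
have Gg : isprim (prim g) g := sol_profile_isprim mu l0 V0.
have gE x : 0 < x < l -> g x = 2^-1 * (dx 0 l wi.1 x + wi.2 x) /\
    g (- x) = 2^-1 * (dx 0 l wi.1 x - wi.2 x).
  move=> xl; have [<- <-] := init_profileE wi xl.
  by case/andP: xl => x0 xl; split; apply: profile_init => //;
    [move=> y; exact: init_profile_left|move=> y; exact: init_profile_left|lra].
(* At 0 and l the profile does not in general carry the prescribed values; these points are
   negligible. *)
have aex : \forall x \ae leb, x \in `[0, l] -> 0 < x < l.
  apply: ae_imp (ae_and (ae_neq 0) (ae_neq l)) => x [x0 xl]; rewrite in_itv/= => /andP[].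
  by rewrite !le_eqVlt (eq_sym 0) (negbTE x0) (negbTE xl)/= => -> ->.
split.
  move=> x xl; rewrite /sol_wave_of -/g.
  have Lg : L2 0 l (fun x => g (0 + x) + g (0 - x)) by exact: (wave_isprim 0 Gg).1.2.
  have H : H1deriv 0 l wi.1 (fun x => g (0 + x) + g (0 - x)).
    apply: H1deriv_aeq (V12_deriv V0.1) => //.
    apply: ae_imp aex => y ya /ya /gE; rewrite sub0r add0r => -[-> ->].
    by move: (dx _ _ _ _) (wi.2 y) => u v; field.
  rewrite (H1derivE H xl) (H1derivE (isprim_H1 0 l (wave_isprim 0 Gg)) xl).
  by case: V0 => -[_ ->] _; rewrite /= addr0 subr0 subrr.
apply: ae_imp aex => y ya /ya /gE; rewrite /= -/g sub0r add0r => -[-> ->].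
by move: (dx _ _ _ _) (wi.2 y) => u v; field.
Qed.

Lemma solution_exists l mu wi : 0 < l -> calV l wi ->
  solution l mu wi (sol_wave_of l mu wi).
Proof.
move=> l0 V0; apply: wave_solution => //.
- exact: sol_profile_isprim.
- exact: sol_wave_init.
- by move=> t t0; exact: sol_profile_neumann.
Qed.

End Solutions.

(** * Uniqueness for the delay system *)

Section SolutionUniqueness.
Context {R : realType}.
Implicit Types (a c l mu r s t x y T : R) (b f g q v G p : R -> R)
  (w : R -> state R) (wi : state R).

(** Extending b by zero turns the case distinction in [neumann] into a translation by 2 l. The
    primitive at time t involves b up to t - 2 l only, which drives the induction on delay
    intervals. *)
Lemma itg_neumann l mu b T : 0 < l -> itg 0 T b -> itg 0 T (neumann l mu b) /\
  forall t, 0 <= t <= T -> ivint 0 t (neumann l mu b) = mu * ivint 0 (t - 2 * l) b.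
Proof.
move=> l0 bi; pose c := b \_ `[0, T].
have ci x y : itg x y c.
  have := (itg_patch 0 T b).1 bi => H.
  exact: (integrableS measurableT (mitv x y) (@subsetT _ _) H).
have cb x : 0 <= x <= T -> c x = b x by move=> xT; rewrite /c patchE mem_set.
have c0 x : x < 0 -> c x = 0.
  move=> x0; rewrite /c patchE memNset//= in_itv/=; apply/negP.
  by rewrite negb_and -ltNge x0.
have E t : 0 <= t <= T -> neumann l mu b t = mu * c (t + - (2 * l)).
  move=> /andP[t0 tT]; rewrite /neumann; case: ltP => tl.
    by rewrite c0 ?mulr0//; lra.
  by rewrite cb//; apply/andP; split; lra.
split.
  have := itgZ mu (itg_shift (ci (0 + - (2 * l)) (T + - (2 * l)))).
  by apply: itg_eq => x; rewrite in_itv/= => xT; rewrite E.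
move=> t /andP[t0 tT].
rewrite (@eq_ivint _ _ _ _ (fun x => mu * c (x + - (2 * l)))); last first.
  by move=> x; rewrite in_itv/= => /andP[x0 xt]; rewrite E// x0 (le_trans xt).
rewrite (ivintZ _ (itg_shift (ci _ _))) (ivint_shift (ci _ _)) add0r; congr (_ * _).
have [tl|tl] := ltP t (2 * l).
  rewrite (ivint_nil b) ?subr_le0 ?(ltW tl)// -[RHS](ivint0 (- (2 * l)) (t - 2 * l)).
  by apply: eq_ivint => x; rewrite in_itv/= => /andP[_ xt]; rewrite c0//; lra.
have l1 : - (2 * l) <= 0 by lra.
have l2 : 0 <= t - 2 * l by lra.
rewrite (ivint_chasles l1 l2 (ci _ _)).
rewrite (_ : ivint (- (2 * l)) 0 c = 0) ?add0r.
  apply: eq_ivint => x; rewrite in_itv/= => /andP[x0 xt]; rewrite cb// x0; lra.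
rewrite -[RHS](ivint0 (- (2 * l)) 0); apply: eq_ivint_oo.
- exact: itg_measurable.
- exact: measurable_cst.
- by move=> x; rewrite in_itv/= => /andP[_ x0]; exact: c0.
Qed.

Lemma solution_uniq l mu wi w w' : 0 < l ->
  solution l mu wi w -> solution l mu wi w' ->
  forall t, 0 <= t -> eqV l (w t) (w' t).
Proof.
move=> l0 [cw iw dw [b [Hb ww]]] [cw' iw' dw' [b' [Hb' ww']]].
suff H n : forall t, 0 <= t <= 2 * l * n%:R -> eqV l (w t) (w' t).
  move=> t t0; apply: (H (Num.truncn (t / (2 * l))).+1); rewrite t0/=.
  have := truncnS_gt (t / (2 * l)); rewrite ltr_pdivrMr; last lra.
  by rewrite mulrC; exact: ltW.
have i0 : eqV l (w 0) (w' 0) by exact: eqV_trans iw (eqV_sym iw').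
elim: n => [|n IH] t.
  by rewrite mulr0 => /andP[t0 t0']; have -> : t = 0 by apply/eqP; rewrite eq_le t0 t0'.
set T := 2 * l * n.+1%:R.
have T0 : 0 < T by rewrite /T mulr_gt0//; lra.
have [vi vE] := itg_neumann mu l0 (H1deriv_itg (Hb T T0)).
have [vi' vE'] := itg_neumann mu l0 (H1deriv_itg (Hb' T T0)).
move=> tT; apply: (weaksol_uniq l0 vi vi' _ _ _ i0 tT).
(* The primitives of b and b' at s - 2 l are increments of the two traces, which agree by the
   induction hypothesis. *)
- move=> s sT; rewrite vE// vE'//; congr (_ * _).
  have [sl|sl] := leP (s - 2 * l) 0; first by rewrite !ivint_nil.
  have sT' : s - 2 * l \in `[0, T].
    by move: sT => /andP[s0 sT]; rewrite in_itv/=; apply/andP; split; lra.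
  have := H1derivE (Hb T T0) sT'; have := H1derivE (Hb' T T0) sT'.
  have sn : 0 <= s - 2 * l <= 2 * l * n%:R.
    apply/andP; split; first exact: ltW.
    by move: sT => /andP[_]; rewrite /T -[n.+1%:R]natr1 mulrDr mulr1; lra.
  have ll : l \in `[0, l] by rewrite in_itv/= lexx ltW.
  rewrite /trace (i0.1 l ll) ((IH _ sn).1 l ll).
  by move: (ivint _ _ _) (ivint _ _ _) => u u' A B; lra.
- exact: (solution_weaksol T cw dw ww).
- exact: (solution_weaksol T cw' dw' ww').
Qed.

End SolutionUniqueness.

(** * Orbits of the wave group *)

Section GroupOrbits.
Context {R : realType}.
Implicit Types (c h l mu r s t x y T : R) (f g q v G : R -> R)
  (w u : state R) (S : R -> state R -> state R).

(** A distance equivalent to [normV l (w - u)]. Being a sum rather than a root of squares, it is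
    estimated componentwise. *)
Definition dV l w u : R :=
  normV12 l (fun x => w.1 x - u.1 x) + normL2 0 l (fun x => w.2 x - u.2 x).

Lemma dV_triangle l w u u' : calV l w -> calV l u -> calV l u' ->
  dV l w u' <= dV l w u + dV l u u'.
Proof.
move=> [w1 w2] [u1 u2] [v1 v2]; rewrite /dV.
have := normV12B_le w1 u1 v1; have := normL2B_le w2 u2 v2.
move: (normV12 _ _) (normV12 _ _) (normV12 _ _) => a b c.
by move: (normL2 _ _ _) (normL2 _ _ _) (normL2 _ _ _) => a' b' c'; lra.
Qed.

Lemma normV_le_dV l w u : normV l (w - u) <= dV l w u.
Proof. exact: normV_le. Qed.

Lemma dV_le_normV l w u : dV l w u <= 2 * normV l (w - u).
Proof.
rewrite mulr_natl mulr2n; apply: lerD.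
  exact: (normV12_le_normV l (w - u)).
exact: (normL2_le_normV l (w - u)).
Qed.

Lemma dV_eqV l w u w' u' : calV l w -> calV l u -> calV l w' -> calV l u' ->
  eqV l w w' -> eqV l u u' -> dV l w u = dV l w' u'.
Proof.
move=> [w1 w2] [u1 u2] [w1' w2'] [u1' u2'] [ww ww'] [uu uu'].
rewrite /dV (normV12_eq (g := fun x => w'.1 x - u'.1 x)); last first.
  by move=> x xl; rewrite ww// uu.
by rewrite (norm_aeq (L2B w2 u2) (L2B w2' u2') (aeonB ww' uu')).
Qed.

Lemma eqV_dV l w u : calV l w -> calV l u ->
  (forall eps, 0 < eps -> dV l w u <= eps) -> eqV l w u.
Proof.
move=> Vw Vu H; apply: normV_eqV0 => //; apply/eqP; rewrite eq_le normV_ge0 andbT.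
by apply/ler_addgt0Pr => e e0; rewrite add0r; apply: le_trans (normV_le_dV _ _ _) (H _ e0).
Qed.

Lemma dVC l w u : calV l w -> calV l u -> dV l w u = dV l u w.
Proof.
move=> [w1 w2] [u1 u2]; rewrite /dV normBC; congr (_ + _).
rewrite (normV12E (H1derivB (V12_deriv w1) (V12_deriv u1))) normBC.
by rewrite (normV12E (H1derivB (V12_deriv u1) (V12_deriv w1))).
Qed.

Lemma V12_0 l : V12 l (fun=> 0).
Proof.
have H : H1deriv 0 l (fun=> 0) (fun=> 0 : R).
  by apply: H1deriv_intro; [exact: L2_cst|move=> x _; rewrite ivint0 addr0].
exact: V12_of H _.
Qed.

Lemma calV_0 l : calV l (0 : state R).
Proof. by split; [exact: V12_0|exact: L2_cst]. Qed.

Lemma normVZ l c w : calV l w -> normV l (c *: w) = `|c| * normV l w.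
Proof.
move=> [w1 w2]; rewrite -sqrtr_sqr -sqrtrM ?sqr_ge0//; congr Num.sqrt.
rewrite -[normV12 l (c *: w).1]/(normV12 l (fun x => c * w.1 x)).
rewrite -[normL2 0 l (c *: w).2]/(normL2 0 l (fun x => c * w.2 x)).
rewrite (normV12E (H1derivZ c (V12_deriv w1))) !normZ//; last exact: V12_dx_L2.
by rewrite !exprMn real_normK ?num_real// mulrDr.
Qed.

Section Group.
Context (l : R) (S : R -> state R -> state R) (l0 : 0 < l) (SG : wave_group l S).

Lemma group0 t : eqV l (S t 0) 0.
Proof.
have := wg_linear SG t (-1) (calV_0 l) (calV_0 l).
by rewrite !scaleN1r !addNr.
Qed.

Lemma groupZ t c w : calV l w -> eqV l (S t (c *: w)) (c *: S t w).
Proof.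
move=> Vw; have H := wg_linear SG t c Vw (calV_0 l); rewrite addr0 in H.
apply: eqV_trans H _; have [A B] := group0 t; split.
  move=> x xl; change (c * (S t w).1 x + (S t 0).1 x = c * (S t w).1 x).
  by rewrite A// addr0.
apply: ae_imp B => x B xl; change (c * (S t w).2 x + (S t 0).2 x = c * (S t w).2 x).
by rewrite B// addr0.
Qed.

Lemma groupB t w u : calV l w -> calV l u -> eqV l (S t (w - u)) (S t w - S t u).
Proof.
move=> Vw Vu; have := wg_linear SG t (-1) Vu Vw.
by rewrite !scaleN1r ![- _ + _]addrC.
Qed.

Lemma groupC s t w : calV l w -> eqV l (S s (S t w)) (S t (S s w)).
Proof.
move=> Vw; apply: eqV_trans (eqV_sym (wg_add SG s t Vw)) _.
by rewrite addrC; exact: wg_add.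
Qed.

Lemma group_normVB t w u : calV l w -> calV l u ->
  normV l (S t w - S t u) = normV l (w - u).
Proof.
move=> Vw Vu; rewrite -(wg_isometry SG t (calVB Vw Vu)).
apply: normV_eqV; last exact: eqV_sym (groupB t Vw Vu).
  by apply: calVB; exact: (wg_stable SG).
by apply: (wg_stable SG); exact: calVB.
Qed.

(** The left-hand quotient is the image under [S t] of the right-hand one, and [S t] is an isometry.
    Hence the domain is invariant, and differentiability at time 0 transports to every t,
    uniformly. *)
Lemma group_quotient t h w w' : calV l w -> calV l w' ->
  normV l (h^-1 *: (S h (S t w) - S t w) - S t w') =
  normV l (h^-1 *: (S h w - w) - w').
Proof.
move=> Vw Vw'; have VS r u : calV l u -> calV l (S r u) := @wg_stable _ _ _ SG r u.
have V1 : calV l (S h w - w) by apply: calVB => //; exact: VS.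
rewrite -(group_normVB t (calVZ h^-1 V1) Vw').
apply: normV_eqV.
- have VSt := VS t _ Vw.
  exact: (calVB (calVZ h^-1 (calVB (VS h _ VSt) VSt)) (VS t _ Vw')).
- exact: (calVB (VS t _ (calVZ h^-1 V1)) (VS t _ Vw')).
apply: eqVB; last exact: eqV_refl.
apply: eqV_trans (eqV_sym (groupZ t h^-1 V1)); apply: eqVZ.
apply: eqV_trans (eqV_sym (groupB t (VS h _ Vw) Vw)).
by apply: eqVB; [exact: groupC|exact: eqV_refl].
Qed.

Context (w0 w0' : state R) (V0 : calV l w0) (V0' : calV l w0')
  (Aw0 : waveop l w0 w0').

Lemma orbit_waveop t : waveop l (S t w0) (S t w0').
Proof.
apply/(wg_generator SG (wg_stable SG t V0) (wg_stable SG t V0')).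
rewrite (_ : (fun h => _) = (fun h => normV l (h^-1 *: (S h w0 - w0) - w0'))).
  exact/(wg_generator SG V0 V0').
by apply/funext => h; rewrite group_quotient.
Qed.

Lemma orbit_diff t eps : 0 < eps -> exists2 del, 0 < del & forall s, `|s - t| < del ->
  normV l (S s w0 - S t w0 - (s - t) *: S t w0') <= eps * `|s - t|.
Proof.
move=> eps0; have := (wg_generator SG V0 V0').2 Aw0.
move=> /cvgrPdist_le/(_ eps eps0).
rewrite /dnbhs near_withinE => -[del /= del0 H]; exists del => // s std.
have VS r u : calV l u -> calV l (S r u) := @wg_stable _ _ _ SG r u.
have VSt := VS t _ V0; have VSt' := VS t _ V0'.
have [->|st] := eqVneq s t.
  rewrite !subrr scale0r subr0 normr0 mulr0.
  have := normVZ 0 (calV_0 l); rewrite scale0r normr0 mul0r => ->.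
  by [].
have h0 : s - t != 0 by rewrite subr_eq0.
have := H (s - t); rewrite /ball_/= sub0r normrN => /(_ std h0).
rewrite sub0r normrN ger0_norm ?normV_ge0// -(group_quotient t (s - t) V0 V0').
set D := _ - S t w0'; set h := s - t => Dle.
have VD : calV l D := calVB (calVZ h^-1 (calVB (VS h _ VSt) VSt)) VSt'.
have VE : calV l (S s w0 - S t w0 - h *: S t w0') :=
  calVB (calVB (VS s _ V0) VSt) (calVZ h VSt').
rewrite (normV_eqV VE (calVZ h VD)).
  by rewrite normVZ// mulrC ler_wpM2r.
rewrite scalerBr scalerA mulfV// scale1r.
apply: eqVB; last exact: eqV_refl.
apply: eqVB; last exact: eqV_refl.
by have := wg_add SG h t V0; rewrite /h subrK.
Qed.

(** The orbit is differentiable in the energy norm with derivative [S t w0'], whose first component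
    represents y_t and whose second is - A y. The Neumann condition in the domain of A gives zero
    forcing. *)
Lemma orbit_weaksol T : weaksol l T (fun=> 0) (fun t => S t w0).
Proof.
have VS t : calV l (S t w0) := wg_stable SG t V0.
have VS' t : calV l (S t w0') := wg_stable SG t V0'.
have C : econtL 0 l T (fun t => dx 0 l (S t w0).1).
  move=> t _ eps eps0; have /cvgrPdist_le/(_ eps eps0) := wg_continuous SG V0.
  move=> [del /= del0 H]; exists del => // s _ std.
  have := H (s - t); rewrite /ball_/= !sub0r !normrN => /(_ std).
  rewrite ger0_norm ?normV_ge0//; apply: le_trans.
  rewrite -(group_normVB t (wg_stable SG (s - t) V0) V0).
  rewrite -(normV_eqV (calVB (VS s) (VS t))).
  - apply: le_trans (normV12_le_normV _ _).
    by rewrite (normV12E (H1derivB (V12_deriv (VS s).1) (V12_deriv (VS t).1))).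
  - by apply: calVB => //; apply: (wg_stable SG); exact: (wg_stable SG).
  - apply: eqVB; last exact: eqV_refl.
    by have := wg_add SG t (s - t) V0; rewrite addrCA subrr addr0.
have z' t : aeon 0 l (S t w0').1 (S t w0).2 by case: (orbit_waveop t).
have D1 : ediffL 0 l T (fun t => (S t w0).1) (fun t => (S t w0).2).
  (* The division by l compensates the Poincare constant in passing from the norm of V_{1/2} to that
     of L2. *)
  move=> t _ eps eps0; have e1 : 0 < eps / l by rewrite divr_gt0.
  have [del del0 H] := orbit_diff t e1; exists del => // s _ std.
  have := le_trans (normV12_le_normV _ _) (H s std).
  rewrite -[X in X <= _ -> _]/(normV12 l (fun x => (S s w0).1 x - (S t w0).1 x
     - (s - t) * (S t w0').1 x)).
  have VD := V12B (V12B (VS s).1 (VS t).1) (V12Z (s - t) (VS' t).1).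
  move=> A; have := V12_norm_le (ltW l0) VD.
  rewrite (norm_aeq (V12_L2 VD) (L2B (L2B (V12_L2 (VS s).1) (V12_L2 (VS t).1))
     (L2Z (s - t) (VS t).2))); last first.
    by apply: ae_imp (z' t) => x zx xl; rewrite zx.
  move=> /le_trans; apply; apply: le_trans (ler_wpM2l (ltW l0) A) _.
  by rewrite mulrA (mulrC l) divfK// gt_eqF.
have D2 : ediffL 0 l T (fun t => (S t w0).2) (fun t => (S t w0').2).
  move=> t _ eps eps0.
  have [del del0 H] := orbit_diff t eps0; exists del => // s _ std.
  exact: le_trans (normL2_le_normV _ _) (H s std).
have Ldx t : L2 0 l (dx 0 l (S t w0).1) := V12_dx_L2 (VS t).1.
split => // phi t Vp tT.
have Lp := V12_dx_L2 Vp; have Lphi := V12_L2 Vp.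
(* Green's formula: the boundary term at l vanishes by g l = 0, the one at 0 by phi 0 = 0. *)
have dE s : dotL2 0 l (S s w0').2 phi = - dotL2 0 l (dx 0 l (S s w0).1) (dx 0 l phi).
  have [_ _ [u [g [Hy Hg y0 gl]] zu]] := orbit_waveop s.
  have Lu : L2 0 l (fun x => - u x) by case: Hg.
  rewrite (dot_aeq (VS' s).2 Lphi Lu Lphi zu (aeon_refl _ _)).
  rewrite (dot_dx Hy Lp).
  have := H1_parts (ltW l0) Hg (V12_deriv Vp); case: Vp => _ ->.
  by rewrite gl mul0r mulr0 subr0 => /eqP; rewrite addr_eq0 => /eqP.
have ed := ediffL_dot (fun s _ => (VS s).2) (fun s _ => (VS' s).2) Lphi D2.
have ec : econt T (fun s => dotL2 0 l (S s w0').2 phi).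
  move=> s sT eps eps0; have [del del0 H] := econtL_dot (fun s _ => Ldx s) Lp C sT eps0.
  by exists del => // r rT rs; rewrite !dE -opprD normrN; exact: H.
rewrite (ediff_ivint ec ed tT); congr (_ + _).
by apply: eq_ivint => s _; rewrite dE mul0r sub0r.
Qed.

End Group.
End GroupOrbits.

(** * Identification of forward orbits with free waves *)

Section FreeOrbits.
Context {R : realType}.
Implicit Types (c h l mu r s t x y T : R) (f g q v G : R -> R)
  (w u : state R).

Definition free_profile l g : Prop := forall s, 0 <= s -> g (s + l) + g (s - l) = 0.

Lemma free_prim_cst l G g s : isprim G g -> free_profile l g -> 0 <= s ->
  G (s + l) + G (s - l) = G l + G (- l).
Proof.
move=> Gg gf s0; have Lg := Gg.1.
have Lp := locL2_shift l Lg; have Lm := locL2_shift (- l) Lg.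
have := ivintD (L2_itg (Lp.2 0 s)) (L2_itg (Lm.2 0 s)).
rewrite (@eq_ivint _ _ _ (fun x => g (x + l) + g (x - l)) (fun=> 0)); last first.
  by move=> x; rewrite in_itv/= => /andP[x0 _]; exact: gf.
rewrite ivint0 (ivint_plus _ _ _ Lg) (ivint_plus _ _ (- l) Lg) !add0r.
rewrite -(Gg.2 l (s + l)) ?lerDr// -(Gg.2 (- l) (s - l)) ?lerDr//.
lra.
Qed.

(** For h > 0 this is the mean of g over [x, x + h]. It gains one derivative, which puts the
    resulting wave in the domain of the generator at time 0. *)
Definition regularized G h : R -> R := fun x => h^-1 * (G (x + h) - G x).

Lemma regularized_isprim G g h : isprim G g ->
  isprim (regularized G h) (fun x => h^-1 * (g (x + h) - g x)).
Proof.
move=> Gg; have := isprimZ h^-1 (isprimB (isprim_shift h Gg) Gg).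
exact: eq_isprim.
Qed.

(** Integrating the condition on g makes G (s + l) + G (s - l) constant for s >= 0, and a difference
    quotient kills the constant. The shift goes to the right because the condition is known at
    nonnegative times only. *)
Lemma regularized_free l G g h : isprim G g -> free_profile l g -> 0 < h ->
  free_profile l (regularized G h).
Proof.
move=> Gg gf h0 s s0; rewrite /regularized -mulrDr.
have := free_prim_cst Gg gf s0; have := free_prim_cst Gg gf (addr_ge0 s0 (ltW h0)).
rewrite (_ : s + h + l = s + l + h); last by ring.
rewrite (_ : s + h - l = s - l + h); last by ring.
by move=> A B; rewrite (_ : _ + _ = 0) ?mulr0//; lra.
Qed.

Lemma wave_waveop l G g q : 0 < l -> isprim G g -> isprim g q -> free_profile l g ->
  waveop l (wave G g 0) (wave g q 0).
Proof.
move=> l0 Gg gq gf; split.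
- by case: (wave_calV l 0 gq).
- exact: aeon_refl.
- exists (fun x => - (q (0 + x) - q (0 - x))).
    exists (fun x => g (0 + x) + g (0 - x)); split.
    + exact: isprim_H1 (wave_isprim 0 Gg).
    + have := isprim_H1 0 l (wave_sum_isprim 0 gq).
      apply: H1deriv_aeq; last by apply: aeW => x _; rewrite opprK.
      apply: (L2_eq (f := (wave g q 0).2)); last exact: (wave_sum_isprim 0 gq).1.2.
      by move=> x _; rewrite opprK.
    + by rewrite /= addr0 subr0 subrr.
    (* The Neumann condition at time 0 is [free_profile] at s = 0, a pointwise statement that is
       meaningful because g is here the continuous representative. *)
    + exact: gf.
  by apply: aeW => x _; rewrite /= opprK.
Qed.

Lemma regularized_dV l G g t eps : 0 < l -> isprim G g -> 0 < eps ->
  exists2 del, 0 < del & forall h, 0 < h < del ->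
    dV l (wave (prim (regularized G h)) (regularized G h) t) (wave G g t) <= eps.
Proof.
move=> l0 Gg eps0; have e4 : 0 < eps / 4 by lra.
have [d1 d10 H1] := primitive_diff 0 l (isprim_plus t Gg) e4.
have [d2 d20 H2] := primitive_diff 0 l (isprim_minus t Gg) e4.
exists (Num.min d1 d2) => [|h]; first by rewrite lt_min d10.
rewrite lt_min => /and3P[h0 hd1 hd2].
have hn : h != 0 by rewrite gt_eqF.
set gh := regularized G h.
have Gh : isprim (prim gh) gh.
  by apply: prim_isprim; exact: isprim_locL2 (regularized_isprim h Gg).
have Lh := Gh.1; have Lg := Gg.1.
have Lpg : locL2 (fun x => g (t + x)) := (isprim_plus t Gg).1.
have Lmg : locL2 (fun x => g (t - x)) := (isprim_minus t Gg).1.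
have Lph : locL2 (fun x => gh (t + x)) := (isprim_plus t Gh).1.
have Lmh : locL2 (fun x => gh (t - x)) := (isprim_minus t Gh).1.
have Lp : L2 0 l (fun x => gh (t + x) - g (t + x)) := (locL2B Lph Lpg).2 0 l.
have Lm : L2 0 l (fun x => gh (t - x) - g (t - x)) := (locL2B Lmh Lmg).2 0 l.
have np : normL2 0 l (fun x => gh (t + x) - g (t + x)) <= eps / 4.
  rewrite -(ler_pM2l h0) -{1}(gtr0_norm h0) -normZ//.
  have := H1 h; rewrite gtr0_norm// => /(_ hd1); rewrite mulrC.
  apply: le_trans; rewrite le_eqVlt; apply/orP; left; apply/eqP.
  apply: eq_norm => x _; rewrite /gh /regularized mulrBr mulrA divff// mul1r.
  by rewrite addrA.
have nm : normL2 0 l (fun x => gh (t - x) - g (t - x)) <= eps / 4.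
  rewrite -(ler_pM2l h0) -{1}(gtr0_norm h0) -normZ//.
  have := H2 (- h); rewrite normrN gtr0_norm// => /(_ hd2); rewrite [_ * h]mulrC.
  apply: le_trans; rewrite le_eqVlt; apply/orP; left; apply/eqP.
  rewrite -normN.
  apply: eq_norm => x _; rewrite /gh /regularized mulrBr mulrA divff// mul1r.
  by rewrite (_ : t - (x - h) = t - x + h); ring.
rewrite /dV (normV12E (H1derivB (isprim_H1 0 l (wave_isprim t Gh))
   (isprim_H1 0 l (wave_isprim t Gg)))).
rewrite (eq_norm (g := fun x => (gh (t + x) - g (t + x)) + (gh (t - x) - g (t - x))));
  last by move=> x _; ring.
rewrite [X in _ + X](eq_norm (g := fun x =>
   (gh (t + x) - g (t + x)) - (gh (t - x) - g (t - x)))); last first.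
  by move=> x _; rewrite /=; ring.
have := normD Lp Lm; have := normB Lp Lm; move: np nm.
move: (normL2 _ _ _) (normL2 _ _ _) (normL2 _ _ _) (normL2 _ _ _) => a b c d; lra.
Qed.

(** The regularized wave is an orbit by uniqueness of weak solutions. The isometry carries the
    approximation error at time 0 to time t, so only the errors of the explicit waves at 0 and at t
    have to be small. *)
Lemma group_orbit_wave l (S : R -> state R -> state R) w G g t : 0 < l ->
  wave_group l S -> calV l w -> isprim G g -> free_profile l g ->
  eqV l (wave G g 0) w -> 0 <= t -> eqV l (S t w) (wave G g t).
Proof.
move=> l0 SG Vw Gg gf i0 t0.
have VS s u : calV l u -> calV l (S s u) := @wg_stable _ _ _ SG s u.
have VG s : calV l (wave G g s) := wave_calV l s Gg.
apply: eqV_dV => //; first exact: VS.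
move=> eps eps0; have e4 : 0 < eps / 4 by lra.
have [d1 d10 H1] := regularized_dV 0 l0 Gg e4.
have [d2 d20 H2] := regularized_dV t l0 Gg e4.
pose h := Num.min d1 d2 / 2.
have m0 : 0 < Num.min d1 d2 by rewrite lt_min d10.
have h0 : 0 < h by rewrite /h; lra.
have hm : h < Num.min d1 d2 by rewrite /h; lra.
move: (hm); rewrite lt_min => /andP[hd1 hd2].
have {}H1 := H1 h (introT andP (conj h0 hd1)).
have {}H2 := H2 h (introT andP (conj h0 hd2)).
set gh := regularized G h in H1 H2.
have Qh := regularized_isprim h Gg.
have Gh : isprim (prim gh) gh by apply: prim_isprim; exact: isprim_locL2 Qh.
have fh : free_profile l gh := regularized_free Gg gf h0.
set w1 := wave (prim gh) gh in H1 H2.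
have V1 s : calV l (w1 s) := wave_calV l s Gh.
have E : eqV l (S t (w1 0)) (w1 t).
  have tT : 0 <= t <= t by rewrite t0 lexx.
  have A := orbit_weaksol l0 SG (V1 0) (wave_calV l 0 Qh) (wave_waveop l0 Gh Qh fh) t.
  have B := wave_weaksol t l0 Gh.
  apply: (weaksol_uniq l0 (itg_cst 0 t 0) _ _ A B) => //.
  - apply: L2_itg; apply: L2D; first exact: (locL2_shift l Gh.1).2.
    exact: (locL2_shift (- l) Gh.1).2.
  - move=> s /andP[s0 _]; apply: eq_ivint => x; rewrite in_itv/= => /andP[x0 _].
    by rewrite fh.
  - exact: (wg_0 SG (V1 0)).
apply: le_trans (dV_triangle (VS t w Vw) (VS t (w1 0) (V1 0)) (VG t)) _.
rewrite [X in _ + X](dV_eqV (VS t (w1 0) (V1 0)) (VG t) (V1 t) (VG t) E (eqV_refl _ _)).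
have A : dV l (S t w) (S t (w1 0)) <= 2 * (2^-1 * (eps / 2)).
  apply: le_trans (dV_le_normV _ _ _) _; rewrite ler_pM2l//.
  rewrite (group_normVB SG t Vw (V1 0)).
  apply: le_trans (normV_le_dV _ _ _) _.
  rewrite (dV_eqV Vw (V1 0) (VG 0) (V1 0) (eqV_sym i0) (eqV_refl _ _)).
  rewrite (dVC (VG 0) (V1 0)); apply: le_trans H1 _; lra.
by move: A H2; move: (dV _ _ _) (dV _ _ _) => a b; lra.
Qed.

End FreeOrbits.

(** * Duality and Duhamel's formula *)

Section Duality.
Context {R : realType}.
Implicit Types (c h l mu r s t x y T : R) (f g k p q v G K : R -> R)
  (w u : state R).

(* The duality of V x V_{-1/2} with V x V_{1/2}, the two components of u being
   tested in the order (V_{1/2}, V). *)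
Definition bform l w u : R := dotL2 0 l w.1 u.2 + dotL2 0 l w.2 u.1.

Lemma bform_eqV l w w' u u' : calV l w -> calV l w' -> calV l u -> calV l u' ->
  eqV l w w' -> eqV l u u' -> bform l w u = bform l w' u'.
Proof.
move=> [w1 w2] [w1' w2'] [u1 u2] [u1' u2'] [ew1 ew2] [eu1 eu2].
rewrite /bform.
rewrite (dot_aeq (V12_L2 w1) u2 (V12_L2 w1') u2' (aeon_eq ew1) eu2).
by rewrite (dot_aeq w2 (V12_L2 u1) w2' (V12_L2 u1') ew2 (aeon_eq eu1)).
Qed.

Lemma isprim_locL2_minus G g t : isprim G g -> locL2 (fun x => G (t - x)).
Proof.
move=> Gg; have := locL2Z (-1) (isprim_locL2 (isprim_minus t Gg)).
by congr locL2; apply/funext => x; rewrite mulN1r opprK.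
Qed.

(* Testing against a free wave: one integration by parts leaves only the
   products of profiles travelling in opposite directions. *)
Lemma bform_wave l G g K k s r : 0 < l -> isprim G g -> isprim K k ->
  K (r + l) + K (r - l) = 0 ->
  bform l (wave G g s) (wave K k r) =
  - 2 * ivint (s - l) (s + l) (fun y => g y * K (s + r - y)).
Proof.
move=> l0 Gg Kk Kr.
have LK := isprim_locL2 Kk; have Lg := Gg.1.
have LKt t : locL2 (fun x => K (t - x)) := isprim_locL2_minus t Kk.
have LKp : locL2 (fun x => K (r + x)) by exact: isprim_locL2 (isprim_plus r Kk).
have Lgp : locL2 (fun x => g (s + x)) := (isprim_plus s Gg).1.
have Lgm : locL2 (fun x => g (s - x)) := (isprim_minus s Gg).1.
have LP : L2 0 l (fun x => g (s + x) + g (s - x)) := (locL2D Lgp Lgm).2 0 l.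
have LM : L2 0 l (wave K k r).1 := (locL2B LKp (LKt r)).2 0 l.
have LN : L2 0 l (fun x => K (r + x) + K (r - x)) := (locL2D LKp (LKt r)).2 0 l.
have LQ : L2 0 l (wave G g s).2 := (locL2B Lgp Lgm).2 0 l.
have := H1_parts (ltW l0) (isprim_H1 0 l (wave_isprim s Gg))
  (isprim_H1 0 l (wave_sum_isprim r Kk)).
rewrite Kr mulr0 addr0 subr0 /= addr0 subr0 subrr mul0r subr0 => /eqP.
rewrite addrC addr_eq0 => /eqP E; rewrite /bform {}E.
rewrite addrC !dotE -(ivintB (L2M LQ LM) (L2M LP LN)).
have ti a b : itg a b (fun y => g y * K (s + r - y)).
  by apply: L2M; [exact: Lg.2|exact: (LKt _).2].
have sl : s - l <= s by rewrite gerBl ltW.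
have sr : s <= s + l by rewrite lerDl ltW.
rewrite (ivint_chasles sl sr (ti _ _)).
have E1 : ivint s (s + l) (fun y => g y * K (s + r - y)) =
    ivint 0 l (fun x => g (s + x) * K (r - x)).
  have := ivint_shift (ti (0 + s) (l + s)); rewrite add0r (addrC l) => <-.
  by apply: eq_ivint => x _; rewrite (addrC x); congr (_ * K _); ring.
have E2 : ivint (s - l) s (fun y => g y * K (s + r - y)) =
    ivint 0 l (fun x => g (s - x) * K (r + x)).
  have := ivint_shift (ti (- l + s) (0 + s)); rewrite add0r (addrC (- l)) => <-.
  have i1 : itg (- l) (- 0) (fun x => g (x + s) * K (s + r - (x + s))) :=
    itg_shift (ti (- l + s) (- 0 + s)).
  have := ivint_opp i1; rewrite oppr0 => <-.
  by apply: eq_ivint => x _; rewrite (addrC (- x)); congr (_ * K _); ring.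
have i1 : itg 0 l (fun x => g (s + x) * K (r - x)).
  exact: L2M (Lgp.2 0 l) ((LKt r).2 0 l).
have i2 : itg 0 l (fun x => g (s - x) * K (r + x)).
  exact: L2M (Lgm.2 0 l) (LKp.2 0 l).
rewrite E1 E2 -(ivintD i2 i1) -(ivintZ _ (itgD i2 i1)).
apply: eq_ivint => x _ /=; ring.
Qed.

(** By [bform_wave] both pairings integrate the same function tau, over windows of length 2 l
    centred at t and T. Their difference is carried by two strips, the translates of [T, t] by l and
    -l, where the condition on K combines the values of tau into the forcing times the trace of the
    test wave. *)
Lemma duality l G g K k t T : 0 < l -> isprim G g -> isprim K k ->
  (forall r, 0 <= r -> K (r + l) + K (r - l) = 0) -> 0 <= T <= t ->
  bform l (wave G g t) (wave K k 0) = bform l (wave G g T) (wave K k (t - T)) +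
    ivint T t (fun s => (g (s + l) + g (s - l)) * (wave K k (t - s)).1 l).
Proof.
move=> l0 Gg Kk Kf /andP[T0 Tt].
rewrite (bform_wave _ l0 Gg Kk (Kf 0 (lexx 0))) (bform_wave _ l0 Gg Kk (Kf (t - T) _)) ?subr_ge0//.
rewrite addr0 (_ : T + (t - T) = t); last by ring.
have Lg := Gg.1.
have LKt : locL2 (fun x => K (t - x)) := isprim_locL2_minus t Kk.
pose tau y := g y * K (t - y).
have ti a b : itg a b tau by apply: L2M; [exact: Lg.2|exact: LKt.2].
rewrite -[ivint (t - l) _ _]/(ivint (t - l) (t + l) tau).
rewrite -[ivint (T - l) _ _]/(ivint (T - l) (T + l) tau).
rewrite (@eq_ivint _ T t _ (fun s => - 2 * (tau (s + l) - tau (s + - l)))); last first.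
  move=> s; rewrite in_itv/= => /andP[_ st]; rewrite /tau.
  have := Kf (t - s); rewrite subr_ge0 => /(_ st).
  rewrite (_ : t - (s + l) = t - s - l); last by ring.
  rewrite (_ : t - (s - l) = t - s + l); last by ring.
  by move/eqP; rewrite addr_eq0 => /eqP ->; ring.
have ip : itg T t (fun s => tau (s + l)) := itg_shift (ti _ _).
have im : itg T t (fun s => tau (s + - l)) := itg_shift (ti _ _).
rewrite (ivintZ _ (itgB ip im)) (ivintB ip im) !(ivint_shift (ti _ _)).
have h1 : T - l <= t - l by lra.
have h2 : t - l <= t + l by lra.
have h3 : T - l <= T + l by lra.
have h4 : T + l <= t + l by lra.
have := ivint_chasles h1 h2 (ti _ _); rewrite (ivint_chasles h3 h4 (ti _ _)).
by move: (ivint _ _ _) (ivint _ _ _) (ivint _ _ _) (ivint _ _ _) => A B C D; lra.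
Qed.

(* The free wave with given initial data, with a primitive normalized so that
   [duality] applies. *)
Lemma free_wave l w : 0 < l -> calV l w -> exists G g,
  [/\ isprim G g, free_profile l g,
      forall r, 0 <= r -> G (r + l) + G (r - l) = 0 & eqV l (wave G g 0) w].
Proof.
(* For mu = 0 the delay system is the free wave equation with a homogeneous Neumann condition at
   l. *)
move=> l0 Vw; pose g := sol_profile l 0 w; pose G := prim g.
have Gg : isprim G g := sol_profile_isprim 0 l0 Vw.
have gf : free_profile l g.
  move=> s s0; rewrite (sol_profile_neumann 0 w l0 s0) /neumann mul0r.
  by case: ifP.
(* An additive constant leaves G (t + x) - G (t - x) unchanged and can be chosen to cancel the
   constant of [free_prim_cst]. *)
exists (fun x => G x + - ((G l + G (- l)) / 2)), g; split => //.
- exact: isprim_cst.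
- by move=> r r0; have := free_prim_cst Gg gf r0; lra.
- have := sol_wave_init 0 l0 Vw; apply: eqV_trans; split; last exact: aeon_refl.
  by move=> x _ /=; rewrite /sol_wave_of /= -/g -/G; ring.
Qed.

End Duality.

(** * Norms and pairings on V x V_{-1/2} *)

Section ExtrapolationSpace.
Context {R : realType}.
Implicit Types (c h l mu r s t x y T : R) (f g k p q v G K : R -> R)
  (w u : state R) (F : (R -> R) -> R) (X Y : xstate R).

Lemma Vm12_0 l F : Vm12 l F -> F (fun=> 0) = 0.
Proof.
move=> [lin _]; have := lin (-1) _ _ (V12_0 l) (V12_0 l).
rewrite (_ : -1 *: _ + _ = (fun=> 0)); last first.
  by apply/funext => x; change (-1 * 0 + 0 = 0 :> R); rewrite mulr0 addr0.
lra.
Qed.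

Lemma normV12_cst0 l : normV12 l (fun=> 0) = 0.
Proof.
have H : H1deriv 0 l (fun=> 0) (fun=> 0 : R).
  by apply: H1deriv_intro; [exact: L2_cst|move=> x _; rewrite ivint0 addr0].
rewrite (normV12E H) /normL2 dotE (@eq_ivint _ _ _ _ (fun=> 0)); last first.
  by move=> x _; rewrite mulr0.
by rewrite ivint0 sqrtr0.
Qed.

Lemma normVm12_has_sup l F : Vm12 l F ->
  has_sup [set `|F f| | f in [set f | V12 l f /\ normV12 l f <= 1]].
Proof.
move=> VF; have [_ [C HC]] := VF; split.
  exists `|F (fun=> 0)|, (fun=> 0) => //=; split; first exact: V12_0.
  by rewrite normV12_cst0.
exists `|C| => _ [f [Vf f1] <-]; apply: le_trans (HC f Vf) _.
apply: le_trans (ler_norm _) _; rewrite normrM ler_piMr// ger0_norm//.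
exact: norm_ge0.
Qed.

Lemma normVm12_le l F r : Vm12 l F ->
  (forall f, V12 l f -> normV12 l f <= 1 -> `|F f| <= r) -> normVm12 l F <= r.
Proof.
move=> VF H; apply: ge_sup; first by case: (normVm12_has_sup VF).
by move=> _ [f [Vf f1] <-]; exact: H.
Qed.

Lemma normVm12_bound l F f : Vm12 l F -> V12 l f ->
  `|F f| <= normVm12 l F * normV12 l f.
Proof.
move=> VF Vf; have [lin [C HC]] := VF.
have [N0|N0] := eqVneq (normV12 l f) 0.
  by have := HC f Vf; rewrite N0 !mulr0.
have Np : 0 < normV12 l f by rewrite lt_neqAle eq_sym N0 norm_ge0.
set N := normV12 l f in Np N0 *.
have E : F (fun x => N^-1 * f x) = N^-1 * F f.
  have := lin N^-1 f (fun=> 0) Vf (V12_0 l); by rewrite (Vm12_0 VF) !addr0 => <-.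
have Vg : V12 l (fun x => N^-1 * f x) by exact: V12Z.
have n1 : normV12 l (fun x => N^-1 * f x) <= 1.
  rewrite (normV12E (H1derivZ N^-1 (V12_deriv Vf))) normZ; last exact: V12_dx_L2.
  by rewrite -/(normV12 l f) -/N gtr0_norm ?invr_gt0// mulVf.
have : `|F (fun x => N^-1 * f x)| <= normVm12 l F.
  apply: (sup_ubound (normVm12_has_sup VF).2).
  by exists (fun x => N^-1 * f x).
by rewrite E normrM gtr0_norm ?invr_gt0// mulrC ler_pdivrMr.
Qed.

Lemma normX1 l X : normL2 0 l X.1 <= normX l X.
Proof.
rewrite -[leLHS]ger0_norm ?norm_ge0// -sqrtr_sqr; apply: ler_wsqrtr.
by rewrite lerDl sqr_ge0.
Qed.

Lemma normX2 l X : normVm12 l X.2 <= normX l X.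
Proof.
apply: le_trans (ler_norm _) _; rewrite -sqrtr_sqr; apply: ler_wsqrtr.
by rewrite lerDr sqr_ge0.
Qed.

Lemma normX_le l X r r' : 0 <= r -> 0 <= r' -> 0 <= normVm12 l X.2 ->
  normL2 0 l X.1 <= r -> normVm12 l X.2 <= r' -> normX l X <= r + r'.
Proof.
move=> r0 r0' n2 H1 H2; have n1 := norm_ge0 0 l X.1.
rewrite -[leRHS]ger0_norm ?addr_ge0// -sqrtr_sqr; apply: ler_wsqrtr.
move: n1 n2 H1 H2; move: (normL2 _ _ _) (normVm12 _ _) => a b; nra.
Qed.

Lemma normVm12_ge0 l F : Vm12 l F -> 0 <= normVm12 l F.
Proof.
move=> VF; have [[y Hy] ub] := normVm12_has_sup VF.
apply: le_trans (_ : 0 <= y) _; first by case: Hy => f _ <-.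
exact: sup_ubound ub _ Hy.
Qed.

Lemma emb_calX l w : 0 < l -> calV l w -> calX l (emb l w).
Proof.
move=> l0 [w1 w2]; split; first exact: V12_L2.
split=> [c f g Vf Vg|].
  rewrite /= -[c *: f + g]/(fun x => c * f x + g x).
  rewrite (dotDr w2 (L2Z c (V12_L2 Vf)) (V12_L2 Vg)).
  by rewrite (dotZr c w2 (V12_L2 Vf)).
exists (normL2 0 l w.2 * l) => f Vf /=.
apply: le_trans (cauchy_schwarz w2 (V12_L2 Vf)) _; rewrite -mulrA.
by rewrite ler_wpM2l ?norm_ge0// V12_norm_le// ltW.
Qed.

Lemma delta_calX l c : 0 < l -> calX l (0, c *: delta l).
Proof.
move=> l0; split; first exact: L2_cst.
have ll : l \in `[0, l] by rewrite in_itv/= lexx ltW.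
split=> [r f g Vf Vg|].
  by change (c * (r * f l + g l) = r * (c * f l) + c * g l); ring.
exists (`|c| * Num.sqrt l) => f Vf; change (`|c * f l| <= `|c| * Num.sqrt l * normV12 l f).
by rewrite normrM -mulrA ler_wpM2l// V12_pt.
Qed.

Lemma calX_lin l r X Y : calX l X -> calX l Y -> calX l (r *: X + Y).
Proof.
move=> [X1 [X2 [C HC]]] [Y1 [Y2 [C' HC']]]; split.
  exact: L2D (L2Z r X1) Y1.
split=> [c f g Vf Vg|].
  change (r * X.2 (c *: f + g) + Y.2 (c *: f + g) =
    c * (r * X.2 f + Y.2 f) + (r * X.2 g + Y.2 g)).
  by rewrite X2// Y2//; ring.
exists (`|r| * C + C') => f Vf.
change (`|r * X.2 f + Y.2 f| <= (`|r| * C + C') * normV12 l f).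
apply: le_trans (ler_normD _ _) _; rewrite mulrDl; apply: lerD; last exact: HC'.
by rewrite normrM -mulrA ler_wpM2l// HC.
Qed.

Lemma pairing_lin l r X Y p f : calX l X -> calX l Y -> L2 0 l p ->
  pairing l (r *: X + Y) p f = r * pairing l X p f + pairing l Y p f.
Proof.
move=> [X1 _] [Y1 _] Lp.
rewrite /pairing -[(r *: X + Y).1]/(fun x => r * X.1 x + Y.1 x).
rewrite -[(r *: X + Y).2 f]/(r * X.2 f + Y.2 f).
rewrite (dotDl (L2Z r X1) Y1 Lp) (dotZl r X1 Lp); ring.
Qed.

Lemma pairing_eqX l X Y p f : calX l X -> calX l Y -> eqX l X Y -> L2 0 l p ->
  V12 l f -> pairing l X p f = pairing l Y p f.
Proof.
move=> [X1 _] [Y1 _] [E1 E2] Lp Vf; rewrite /pairing E2//.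
by rewrite (dot_aeq X1 Lp Y1 Lp E1 (aeon_refl _ _)).
Qed.

Lemma pairing_bound l X p f : calX l X -> L2 0 l p -> V12 l f ->
  `|pairing l X p f| <= normX l X * (normL2 0 l p + normV12 l f).
Proof.
move=> [X1 X2] Lp Vf; apply: le_trans (ler_normD _ _) _; rewrite mulrDr.
apply: lerD.
  apply: le_trans (cauchy_schwarz X1 Lp) _.
  by rewrite ler_wpM2r ?norm_ge0// normX1.
apply: le_trans (normVm12_bound X2 Vf) _.
by rewrite ler_wpM2r ?norm_ge0// normX2.
Qed.

Lemma pairing_emb l w p f : pairing l (emb l w) p f = bform l w (f, p).
Proof. by []. Qed.

End ExtrapolationSpace.

(** * The extended group on Dirac masses *)

Section ExtendedGroup.
Context {R : realType} (l : R) (S : R -> state R -> state R)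
  (Sm1 : R -> xstate R -> xstate R).
Context (l0 : 0 < l) (SG : wave_group l S) (SX : wave_group_extension l S Sm1).
Context (K k : R -> R) (Kk : isprim K k)
  (Kf : forall r, 0 <= r -> K (r + l) + K (r - l) = 0).
Implicit Types (c t r x : R) (w : state R).

(** [duality] with zero forcing. As [bform] crosses positions with velocities, the transpose of the
    evolution is again the forward evolution, without a sign change. *)
Lemma group_duality t w : 0 <= t -> calV l w ->
  bform l (S t w) (wave K k 0) = bform l w (wave K k t).
Proof.
move=> t0 Vw; have [G [g [Gg gf Gf i0]]] := free_wave l0 Vw.
have VK s : calV l (wave K k s) := wave_calV l s Kk.
have VG s : calV l (wave G g s) := wave_calV l s Gg.
rewrite (bform_eqV (wg_stable SG t Vw) (VG t) (VK 0) (VK 0)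
  (group_orbit_wave l0 SG Vw Gg gf i0 t0) (eqV_refl _ _)).
have tT : 0 <= (0 : R) <= t by rewrite lexx.
rewrite (duality l0 Gg Kk Kf tT) subr0.
rewrite (bform_eqV (VG 0) Vw (VK t) (VK t) i0 (eqV_refl _ _)).
rewrite (@eq_ivint _ _ _ _ (fun=> 0)) ?ivint0 ?addr0// => s.
by rewrite in_itv/= => /andP[s0 _]; rewrite gf ?mul0r.
Qed.

(* The mass c / e on [l - e, l], an approximation of c delta_l. *)
Let bump c e : R -> R := (fun=> c / e) \_ `[l - e, l].

Lemma dot_bump c e f : 0 < e <= l -> V12 l f ->
  dotL2 0 l (bump c e) f = c / e * ivint (l - e) l f.
Proof.
move=> /andP[e0 el] Vf; have Lf := V12_L2 Vf.
have le0 : 0 <= l - e by lra.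
have lel : l - e <= l by lra.
have Lb : locL2 (bump c e).
  apply: (@locL2_patch _ (l - e) l); [exact: mitv|by []|exact: L2_cst].
have i := L2M (Lb.2 0 l) Lf.
rewrite dotE (ivint_chasles le0 lel i) (_ : ivint 0 (l - e) _ = 0) ?add0r.
  rewrite -ivintZ; last by apply: L2_itg; exact: L2_sub Lf.
  by apply: eq_ivint => x xl; rewrite /bump patchE mem_set.
rewrite -[RHS](ivint0 0 (l - e)); apply: eq_ivint_oo.
- by apply: itg_measurable; apply: itg_sub i.
- exact: measurable_cst.
- move=> x; rewrite in_itv/= => /andP[_ xl]; rewrite /bump patchE memNset ?mul0r//=.
  by rewrite in_itv/=; apply/negP; rewrite negb_and -ltNge xl.
Qed.

Lemma bump_L2 c e : L2 0 l (bump c e).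
Proof.
by have [_ L] := @locL2_patch _ (l - e) l (fun=> c / e) _ (mitv _ _)
  (@subset_refl _ _) (L2_cst _ _ _); exact: L.
Qed.

(** Functions of V_{1/2} are Holder continuous of exponent 1/2, so f differs from f l by at most
    sqrt e times its norm on [l - e, l], and so does its mean over that interval. *)
Lemma bump_near c e f : 0 < e <= l -> V12 l f ->
  `|dotL2 0 l (bump c e) f - c * f l| <= `|c| * Num.sqrt e * normV12 l f.
Proof.
move=> el Vf; rewrite dot_bump//; move: el => /andP[e0 el].
have Lf := V12_L2 Vf; have H := V12_deriv Vf; have Ld := V12_dx_L2 Vf.
have le0 : 0 <= l - e by lra.
have lel : l - e <= l by lra.
have Lfe : L2 (l - e) l f by exact: L2_sub Lf.
rewrite (_ : _ - _ = c / e * ivint (l - e) l (fun x => f x - f l)); last first.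
  rewrite ivintB ?ivint_cst//; [|exact: L2_itg|exact: itg_cst].
  by field; rewrite gt_eqF.
rewrite normrM normrM (gtr0_norm (_ : 0 < e^-1)) ?invr_gt0//.
rewrite -!mulrA; apply: ler_wpM2l => //.
rewrite mulrC ler_pdivrMr//; apply: le_trans (_ : _ <= Num.sqrt e * normV12 l f * (l - (l - e))) _.
  apply: norm_ivint_le_cst => //.
    by apply: itgB; [exact: L2_itg|exact: itg_cst].
  move=> x; rewrite in_itv/= => /andP[ex xl].
  have xl0 : x \in `[0, l] by rewrite in_itv/= xl andbT; lra.
  have ll : l \in `[0, l] by rewrite in_itv/= lexx ltW.
  have x0 : 0 <= x by lra.
  rewrite (H1derivE H xl0) (H1derivE H ll) (ivint_chasles x0 xl (L2_itg Ld)).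
  rewrite (_ : _ - _ = - ivint x l (dx 0 l f)); last by ring.
  have Lx : L2 x l (dx 0 l f) by exact: L2_sub Ld.
  rewrite normrN; apply: le_trans (ivint_le_norm xl Lx) _.
  apply: (ler_pM (sqrtr_ge0 _) (norm_ge0 _ _ _)); first by apply: ler_wsqrtr; lra.
  exact: norm_mono.
by rewrite (_ : l - (l - e) = e) ?lexx//; ring.
Qed.

Lemma extension_delta t c p f : 0 <= t -> L2 0 l p -> V12 l f ->
  eqV l (wave K k 0) (f, p) ->
  pairing l (Sm1 t (0, c *: delta l)) p f = c * (wave K k t).1 l.
Proof.
move=> t0 Lp Vf i0.
have [C HC] := wge_bounded SX t.
have VK s : calV l (wave K k s) := wave_calV l s Kk.
have Vfp : calV l (f, p) by [].
set X : xstate R := (0, c *: delta l).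
have VX : calX l X := delta_calX c l0.
have VSX : calX l (Sm1 t X) := wge_stable SX t VX.
set psi := (wave K k t).1.
have Vpsi : V12 l psi := (VK t).1.
(* The error has two parts: [Sm1 t], of bound C, applied to the difference between bump and Dirac
   mass, and the bump tested against psi. *)
pose M := `|C| * (normL2 0 l p + normV12 l f) + normV12 l psi.
have M0 : 0 <= M by rewrite addr_ge0 ?norm_ge0// mulr_ge0// addr_ge0 ?norm_ge0.
have key e : 0 < e <= l ->
    `|pairing l (Sm1 t X) p f - c * psi l| <= `|c| * Num.sqrt e * M.
  move=> el; pose w : state R := (fun=> 0, bump c e).
  have Vw : calV l w by split; [exact: V12_0|exact: bump_L2].
  (* Bump minus Dirac mass: its norm in V x V_{-1/2} is at most |c| sqrt e by [bump_near]. *)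
  pose Y := (-1) *: X + emb l w.
  have Vemb : calX l (emb l w) := emb_calX l0 Vw.
  have VY : calX l Y := calX_lin (-1) VX Vemb.
  have Ybound : normX l Y <= 0 + `|c| * Num.sqrt e.
    have [_ VY2] := VY; apply: (normX_le (lexx 0) (mulr_ge0 (normr_ge0 c) (sqrtr_ge0 e)) (normVm12_ge0 VY2)).
    - rewrite (eq_norm (g := fun=> 0)); last first.
        by move=> x _; change (-1 * 0 + 0 = 0 :> R); rewrite mulr0 addr0.
      rewrite /normL2 dotE (@eq_ivint _ _ _ _ (fun=> 0)) ?ivint0 ?sqrtr0//.
      by move=> x _; rewrite mulr0.
    - apply: normVm12_le => // h Vh h1.
      change (`|-1 * (c * h l) + dotL2 0 l (bump c e) h| <= `|c| * Num.sqrt e).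
      rewrite mulN1r addrC; apply: le_trans (bump_near c el Vh) _.
      by rewrite ler_piMr// mulr_ge0 ?sqrtr_ge0.
  have VSe : calX l (Sm1 t (emb l w)) := wge_stable SX t Vemb.
  have VSY : calX l (Sm1 t Y) := wge_stable SX t VY.
  have E1 : pairing l (Sm1 t Y) p f =
      -1 * pairing l (Sm1 t X) p f + pairing l (Sm1 t (emb l w)) p f.
    rewrite (pairing_eqX VSY (calX_lin (-1) VSX VSe) (wge_linear SX t (-1) VX Vemb) Lp Vf).
    exact: pairing_lin.
  have E2 : pairing l (Sm1 t (emb l w)) p f = dotL2 0 l (bump c e) psi.
    rewrite (pairing_eqX VSe (emb_calX l0 (wg_stable SG t Vw)) (wge_extends SX t Vw) Lp Vf).
    rewrite pairing_emb.
    rewrite (bform_eqV (wg_stable SG t Vw) (wg_stable SG t Vw) Vfp (VK 0) (eqV_refl _ _) (eqV_sym i0)).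
    rewrite (group_duality t0 Vw) /bform /=.
    rewrite (_ : dotL2 0 l (fun=> 0) _ = 0) ?add0r//.
    by rewrite dotE (@eq_ivint _ _ _ _ (fun=> 0)) ?ivint0// => x _; rewrite mul0r.
  have B1 := pairing_bound VSY Lp Vf.
  have B2 := HC Y VY.
  have B3 : normX l (Sm1 t Y) <= `|C| * (`|c| * Num.sqrt e).
    apply: le_trans B2 _; apply: le_trans (ler_norm _) _; rewrite normrM.
    rewrite (ger0_norm (sqrtr_ge0 _)) ler_wpM2l//.
    by move: Ybound; rewrite add0r.
  rewrite (_ : _ - _ = (dotL2 0 l (bump c e) psi - c * psi l) - pairing l (Sm1 t Y) p f).
    apply: le_trans (ler_normB _ _) _; rewrite addrC /M [leRHS]mulrDr; apply: lerD.
      apply: le_trans B1 _; rewrite mulrA [_ * `|C|]mulrC.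
      by apply: (ler_wpM2r (addr_ge0 (norm_ge0 _ _ _) (norm_ge0 _ _ _))).
    exact: bump_near.
  by rewrite E1 E2; move: (pairing _ _ _ _) (dotL2 _ _ _ _) => a b; ring.
apply/eqP; rewrite -subr_eq0 -normr_le0; apply/ler_addgt0Pr => eps eps0.
rewrite add0r.
pose D := `|c| * M + 1.
have D0 : 0 < D by rewrite ltr_wpDl// mulr_ge0.
(* Then sqrt e <= eps / D, and |c| M <= D gives |c| (sqrt e) M <= eps. *)
pose e := Num.min l ((eps / D) ^+ 2).
have el : 0 < e <= l by rewrite lt_min l0 exprn_gt0 ?divr_gt0//= ge_min lexx.
apply: le_trans (key e el) _.
have se : Num.sqrt e <= eps / D.
  have eD : 0 <= eps / D by rewrite divr_ge0 ?ltW.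
  rewrite -[leRHS](ger0_norm eD) -sqrtr_sqr; apply: ler_wsqrtr.
  by rewrite ge_min lexx orbT.
rewrite mulrAC; apply: le_trans (ler_wpM2l _ se) _; first by rewrite mulr_ge0.
rewrite mulrA ler_pdivrMr// mulrC ler_pM2l//.
by rewrite /D lerDl.
Qed.

End ExtendedGroup.

(** * Duhamel's formula on each delay interval *)

Section ExplicitForm.
Context {R : realType} (l mu : R) (S : R -> state R -> state R)
  (Sm1 : R -> xstate R -> xstate R).
Context (l0 : 0 < l) (SG : wave_group l S) (SX : wave_group_extension l S Sm1).
Implicit Types (c t s r x T : R) (f p : R -> R) (j : nat).

Lemma extension_delta_group t c p f : 0 <= t -> L2 0 l p -> V12 l f ->
  pairing l (Sm1 t (0, c *: delta l)) p f = c * (S t (f, p)).1 l.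
Proof.
move=> t0 Lp Vf; have Vfp : calV l (f, p) by [].
have [K [k [Kk kf Kf i0]]] := free_wave l0 Vfp.
rewrite (extension_delta l0 SG SX Kk Kf c t0 Lp Vf i0).
have [E _] := group_orbit_wave l0 SG Vfp Kk kf i0 t0.
by rewrite E// in_itv/= lexx ltW.
Qed.

Lemma group_trace_le t w : calV l w -> `|(S t w).1 l| <= Num.sqrt l * normV l w.
Proof.
move=> Vw; have [V1 _] := wg_stable SG t Vw.
have ll : l \in `[0, l] by rewrite in_itv/= lexx ltW.
apply: le_trans (V12_pt V1 ll) _; apply: ler_wpM2l; first exact: sqrtr_ge0.
by rewrite -(wg_isometry SG t Vw); exact: normV12_le_normV.
Qed.

(** A bound uniform in t, obtained by duality: each pairing with (p, f) is c times the trace of an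
    orbit of [S], which the isometry controls. Each of the two components contributes sqrt l |c|. *)
Lemma extension_delta_norm t c : 0 <= t ->
  normX l (Sm1 t (0, c *: delta l)) <= 2 * Num.sqrt l * `|c|.
Proof.
move=> t0; set Y := Sm1 t _.
have [Y1 Y2] : calX l Y := wge_stable SX t (delta_calX c l0).
set r := Num.sqrt l * `|c|.
have r0 : 0 <= r by rewrite mulr_ge0 ?sqrtr_ge0.
rewrite (_ : 2 * _ * _ = r + r); last by rewrite /r; ring.
apply: (normX_le r0 r0 (normVm12_ge0 Y2)).
  (* The pairing with p = Y.1 and f = 0 is |Y.1|^2, bounded by r |Y.1|; one factor cancels. *)
  have Vp : calV l (fun=> 0, Y.1) by split; [exact: V12_0|].
  have E := extension_delta_group c t0 Y1 (V12_0 l).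
  rewrite /pairing -/Y (Vm12_0 Y2) addr0 -norm_sqr in E.
  have n0 := norm_ge0 0 l Y.1.
  have : normL2 0 l Y.1 ^+ 2 <= r * normL2 0 l Y.1.
    rewrite E; apply: le_trans (ler_norm _) _; rewrite normrM.
    rewrite /r mulrAC mulrC; apply: ler_wpM2r => //.
    apply: le_trans (group_trace_le t Vp) _; apply: ler_wpM2l; first exact: sqrtr_ge0.
    by apply: le_trans (normV_le _ _) _; rewrite normV12_cst0 add0r.
  move: n0; rewrite le_eqVlt => /predU1P[<- //|n0].
  by rewrite expr2 ler_pM2r.
apply: normVm12_le => // f Vf f1.
have Vf0 : calV l (f, fun=> 0) by split; [|exact: L2_cst].
have E := extension_delta_group c t0 (L2_cst 0 l 0) Vf.
have Z : dotL2 0 l Y.1 (fun=> 0) = 0.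
  by rewrite dotE (@eq_ivint _ _ _ _ (fun=> 0)) ?ivint0// => x _; rewrite mulr0.
rewrite /pairing -/Y Z add0r in E.
rewrite E normrM mulrC /r; apply: ler_wpM2r => //.
apply: le_trans (group_trace_le t Vf0) _; rewrite -[leRHS]mulr1.
apply: ler_wpM2l; first exact: sqrtr_ge0.
apply: le_trans (normV_le _ _) _.
rewrite /= /normL2 dotE (@eq_ivint _ _ _ _ (fun=> 0)) => [|x _]; last by rewrite mulr0.
by rewrite ivint0 sqrtr0 addr0.
Qed.

Lemma switch_ge0 j : 0 <= switch l j.
Proof. by rewrite /switch !mulr_ge0// ltW. Qed.

Lemma switchS j : switch l j.+1 = switch l j + 2 * l.
Proof. by rewrite /switch -[j.+1%:R]natr1; ring. Qed.

Context (wi : state R) (w : R -> state R) (Vi : calV l wi) (sw : solution l mu wi w).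

Let g := sol_profile l mu wi.
Let G := prim g.

Let Gg : isprim G g. Proof. exact: sol_profile_isprim. Qed.

Let Vw t : 0 <= t -> calV l (w t).
Proof. by move=> t0; have [+ _ _ _] := sw => /(_ t t0)[]. Qed.

(** Uniqueness makes the d'Alembert form available for an arbitrary solution, so the explicit
    formula can be computed on profiles. *)
Let wE t : 0 <= t -> eqV l (w t) (wave G g t).
Proof. by move=> t0; exact: (solution_uniq l0 sw (solution_exists mu l0 Vi) t0). Qed.

Lemma solution_trace j :
  H1deriv (switch l j) (switch l j.+1) (trace l w) (fun s => g (s + l) - g (s - l)).
Proof.
apply: H1deriv_eq (wave_trace _ _ l Gg) => t; rewrite in_itv/= => /andP[t0 _].
have [E _] := wE (le_trans (switch_ge0 j) t0).
by rewrite /trace E// in_itv/= lexx ltW.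
Qed.

Lemma solution_first t : 0 <= t <= 2 * l -> eqV l (w t) (S t wi).
Proof.
move=> tT; have [cw iw dw [b [Hb ww]]] := sw.
have [K [k [Kk kf Kf i0]]] := free_wave l0 Vi.
have T0 : 0 < 2 * l by rewrite mulr_gt0.
have [vi vE] := itg_neumann mu l0 (H1deriv_itg (Hb _ T0)).
have B := wave_weaksol (2 * l) l0 Kk.
have t0 : 0 <= t by case/andP: tT.
apply: eqV_trans (eqV_sym (group_orbit_wave l0 SG Vi Kk kf i0 t0)).
apply: (weaksol_uniq l0 vi _ _ (solution_weaksol (2 * l) cw dw ww) B _ tT).
- apply: L2_itg; apply: L2D; first exact: (locL2_shift l Kk.1).2.
  exact: (locL2_shift (- l) Kk.1).2.
(* At t = 2 l the forcing already takes its delayed value, but its primitive is still 0, so the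
   closed interval is covered. *)
- move=> s sT; rewrite vE// ivint_nil ?mulr0; last first.
    by move: sT => /andP[_]; lra.
  rewrite -[LHS](ivint0 0 s); apply: eq_ivint => x; rewrite in_itv/= => /andP[x0 _].
  by rewrite kf.
- exact: eqV_trans iw (eqV_sym i0).
Qed.

Lemma solution_contV j : contV l `[switch l j, switch l j.+1] w.
Proof.
have [cw _ _ _] := sw.
have P t : `[switch l j, switch l j.+1]%classic t -> 0 <= t.
  by rewrite /= in_itv/= => /andP[+ _]; exact: le_trans (switch_ge0 j).
move=> t tj; have [Vt] := cw t (P t tj); split => //.
apply/(cvg_within_eps _ _ (fun s => normV_ge0 l (w s - w t))) => eps eps0.
have [del del0 H] := (cvg_within_eps _ _ (fun s => normV_ge0 l (w s - w t))).1 b eps eps0.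
by exists del => // s /P s0; exact: H.
Qed.

Lemma solution_duhamel j t p f : t \in `[switch l j.+1, switch l j.+2] ->
  L2 0 l p -> V12 l f ->
  let v s := pairing l (Sm1 (t - s)
     (0, (mu * trace_dt l (fun=> w) j (s - 2 * l)) *: delta l)) p f in
  itg (switch l j.+1) t v /\
  bform l (w t) (f, p) = bform l (S (t - switch l j.+1) (w (switch l j.+1))) (f, p) +
    ivint (switch l j.+1) t v.
Proof.
set T := switch l j.+1 => tj Lp Vf v.
move: tj; rewrite in_itv/= => /andP[Tt tT].
have T0 : 0 <= T := switch_ge0 _.
have t0 : 0 <= t := le_trans T0 Tt.
have tT0 : 0 <= t - T by rewrite subr_ge0.
have Tl : 2 * l <= T by rewrite /T switchS lerDr switch_ge0.
have Vfp : calV l (f, p) by [].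
have [K [k [Kk kf Kf i0]]] := free_wave l0 Vfp.
have VK s : calV l (wave K k s) := wave_calV l s Kk.
have VG s : calV l (wave G g s) := wave_calV l s Gg.
have VwT := Vw T0.
have VS : calV l (S (t - T) (w T)) := wg_stable SG _ VwT.
have E1 : bform l (w t) (f, p) = bform l (w T) (wave K k (t - T)) +
    ivint T t (fun s => (g (s + l) + g (s - l)) * (wave K k (t - s)).1 l).
  rewrite (bform_eqV (Vw t0) (VG t) Vfp (VK 0) (wE t0) (eqV_sym i0)).
  rewrite (bform_eqV VwT (VG T) (VK _) (VK _) (wE T0) (eqV_refl _ _)).
  by apply: duality => //; rewrite T0.
have E2 : bform l (S (t - T) (w T)) (f, p) = bform l (w T) (wave K k (t - T)).
  rewrite (bform_eqV VS VS Vfp (VK 0) (eqV_refl _ _) (eqV_sym i0)).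
  exact: group_duality.
pose phi s := (wave K k (t - s)).1 l.
have Lphi : locL2 phi.
  have := locL2B (isprim_locL2_minus (t + l) Kk) (isprim_locL2_minus (t - l) Kk).
  by congr locL2; apply/funext => s; rewrite /phi /=; congr (K _ - K _); ring.
pose tdt := trace_dt l (fun=> w) j.
pose b s := g (s + l) - g (s - l).
have Ht := solution_trace j.
have tb : aeon (switch l j) (switch l j.+1) tdt b := dx_aeon Ht.
have Ltd : L2 (switch l j) (switch l j.+1) tdt by apply: dx_L2; exists b.
have Lb : L2 (switch l j) (switch l j.+1) b by case: Ht.
pose q := - (2 * l).
(* Delayed times s - 2 l, for s in [T, t], stay in the j-th interval, where [tdt] is meaningful. *)
have qa : switch l j <= T + q by rewrite /T switchS /q; lra.
have qb : t + q <= switch l j.+1 by move: tT; rewrite !switchS /q; lra.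
have vE : {in `[T, t], v =1 (fun s => mu * (tdt (s + q) * phi s))}.
  move=> s; rewrite in_itv/= => /andP[_ st]; rewrite /v mulrA.
  have st0 : 0 <= t - s by rewrite subr_ge0.
  exact: (extension_delta l0 SG SX Kk Kf _ st0 Lp Vf i0).
have Lsh d : L2 (switch l j) (switch l j.+1) d ->
    itg (T + q) (t + q) (fun s => d s * phi (s - q)).
  move=> Ld; apply: L2M; first exact: L2_sub Ld.
  exact: (locL2_shift (- q) Lphi).2.
have shE d : L2 (switch l j) (switch l j.+1) d ->
    itg T t (fun s => d (s + q) * phi s) /\
    ivint T t (fun s => d (s + q) * phi s) =
    ivint (T + q) (t + q) (fun s => d s * phi (s - q)).
  move=> Ld; have i := Lsh d Ld; split.
    by apply: itg_eq (itg_shift i) => s _; rewrite addrK.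
  by rewrite -(ivint_shift i); apply: eq_ivint => s _; rewrite addrK.
have [it1 et1] := shE tdt Ltd; have [ib1 eb1] := shE b Lb.
have iv : itg T t v by apply: itg_eq (itgZ mu it1) => s /vE ->.
split => //.
rewrite E1 E2; congr (_ + _); rewrite (eq_ivint vE) (ivintZ _ it1) et1.
(* [tdt] is a derivative of the trace selected by [dx]; it agrees with the explicit b almost
   everywhere, so the replacement is made under the integral. *)
rewrite (@ivint_aeq _ _ _ (fun s => tdt s * phi (s - q)) (fun s => b s * phi (s - q))).
- rewrite -eb1 -(ivintZ _ ib1); apply: eq_ivint => s; rewrite in_itv/= => /andP[Ts st].
  have s0 : 0 <= s := le_trans T0 Ts.
  rewrite (sol_profile_neumann mu wi l0 s0) /neumann ltNge (le_trans Tl Ts)/= -/g.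
  by rewrite -mulrA.
- exact: itg_measurable (Lsh tdt Ltd).
- exact: itg_measurable (Lsh b Lb).
- apply: ae_imp tb => s tb; rewrite in_itv/= => /andP[s1 s2]; rewrite tb// in_itv/=.
  by rewrite (le_trans qa s1) (le_trans s2 qb).
Qed.

Lemma solution_explicit : explicit_form l mu S Sm1 wi (fun=> w).
Proof.
split; first by move=> t; rewrite in_itv/= => tT; exact: solution_first.
move=> j; split; first by eexists; exact: solution_trace.
move=> t tj; set T := switch l j.+1.
have T0 : 0 <= T := switch_ge0 _.
have [Tt tT] : T <= t /\ t <= switch l j.+2 by move: tj; rewrite in_itv/= => /andP.
have t0 : 0 <= t := le_trans T0 Tt.
have VS : calV l (S (t - T) (w T)) := wg_stable SG _ (Vw T0).
have XS := emb_calX l0 VS; have Xw := emb_calX l0 (Vw t0).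
(* With X defined as the difference, the displayed formula holds by construction; what remains is
   that X is the Bochner integral, checked on pairings by [solution_duhamel]. *)
pose X := (-1) *: emb l (S (t - T) (w T)) + emb l (w t).
exists X; last first.
  split; first by apply: aeW => x _; change ((w t).1 x = (S (t - T) (w T)).1 x +
    (-1 * (S (t - T) (w T)).1 x + (w t).1 x)); ring.
  move=> f Vf; change (dotL2 0 l (w t).2 f = dotL2 0 l (S (t - T) (w T)).2 f +
    (-1 * dotL2 0 l (S (t - T) (w T)).2 f + dotL2 0 l (w t).2 f)).
  by move: (dotL2 _ _ _ _) (dotL2 _ _ _ _) => a b; ring.
split.
- exact: calX_lin.
- by move=> s _; apply: (wge_stable SX); exact: delta_calX.
- exists (fun s => 2 * Num.sqrt l * `|mu * trace_dt l (fun=> w) j (s - 2 * l)|).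
    have Ltd : L2 (switch l j) (switch l j.+1) (trace_dt l (fun=> w) j).
      by apply: dx_L2; eexists; exact: solution_trace.
    have := itg_norm (itgZ mu (L2_itg Ltd)) => i.
    have qa : switch l j <= T + - (2 * l) by rewrite /T switchS; lra.
    have qb : t + - (2 * l) <= switch l j.+1 by move: tT; rewrite !switchS; lra.
    exact: (itgZ (2 * Num.sqrt l) (itg_shift (itg_sub qa qb i))).
  move=> s; rewrite in_itv/= => /andP[_ st].
  by apply: extension_delta_norm; rewrite subr_ge0.
- move=> p f Lp Vf; have [i E] := solution_duhamel tj Lp Vf.
  split; first exact: i.
  rewrite (pairing_lin _ _ XS Xw Lp) !pairing_emb {}E -/T.
  rewrite -[\int[_]_(s in _) _]/(ivint T t _).
  by move: (bform _ _ _) (ivint _ _ _) => a b; ring.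
Qed.

End ExplicitForm.

Unset Implicit Arguments.
Set Strict Implicit.

Theorem theorem2p1 (R : realType) (l mu : R) (hl : 0 < l)
    (y0 y1 : R -> R) (h0 : calV l (y0, y1)) :
  (exists w : R -> state R, solution l mu (y0, y1) w) /\
  (forall w w' : R -> state R,
     solution l mu (y0, y1) w -> solution l mu (y0, y1) w' ->
     forall t : R, 0 <= t -> eqV l (w t) (w' t)) /\
  (forall (S : R -> state R -> state R) (Sm1 : R -> xstate R -> xstate R),
     wave_group l S -> wave_group_extension l S Sm1 ->
     forall w : R -> state R, solution l mu (y0, y1) w ->
     exists W : nat -> R -> state R,
       explicit_form l mu S Sm1 (y0, y1) W /\
       (forall j : nat, contV l `[switch l j, switch l j.+1] (W j)) /\
       (forall (j : nat) (t : R), t \in `[switch l j, switch l j.+1] ->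
          eqV l (w t) (W j t))).
Proof.
split; first by exists (sol_wave_of l mu (y0, y1)); exact: solution_exists.
split; first by move=> w w' sw sw' t t0; exact: (solution_uniq hl sw sw' t0).
(* Each W j is only read on the j-th interval, so the solution itself can serve as every term of the
   sequence. *)
move=> S Sm1 SG SX w sw; exists (fun=> w); split.
  exact: (solution_explicit hl SG SX h0 sw).
split; first by move=> j; exact: (solution_contV hl sw).
by move=> j t _; exact: eqV_refl.
Qed.
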